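(* Any connected and simply connected three-dimensional solvable (real) Lie group $G$ admits a left-invariant Lorentzian metric $g$ which is a Ricci soliton, i.e., there exist a smooth vector field $X$ on $G$ and a constant $\mu\in\mathbb{R}$ such that $\mathcal{L}_Xg+\rho=\mu g$, where $\rho$ is the Ricci tensor of $g$.
   Context: $\mathcal{L}_X$ denotes the Lie derivative. The vector field $X$ is not required to be left-invariant, and Einstein metrics ($\rho=\lambda g$) are included as trivial Ricci solitons. A left-invariant Lorentzian metric is one induced by an inner product with exactly one negative direction on the Lie algebra. *)

(* Defs.v *)
From HB Require Import structures.
From mathcomp Require Import all_boot all_order all_algebra.
From mathcomp Require Import all_classical all_reals all_analysis.
Set Implicit Arguments.
Unset Strict Implicit.
Unset Printing Implicit Defensive.
Import Order.TTheory GRing.Theory Num.Theory.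
Import numFieldNormedType.Exports.
Local Open Scope classical_set_scope.
Local Open Scope ring_scope.

Section Smoothness.
Context {R : realType}.

(* U is meant to be open: then the iterated partial derivatives at points of U
   only depend on the restriction of f to U. *)
Fixpoint Ck_on {m : nat} {W : normedModType R} (k : nat)
    (U : set 'rV[R]_m) (f : 'rV[R]_m -> W) : Prop :=
  (forall x, U x -> {for x, continuous f}) /\
  if k is k'.+1 then
    forall i : 'I_m,
      (forall x, U x -> derivable f x (delta_mx 0 i)) /\
      Ck_on k' U (fun x => 'D_(delta_mx 0 i) f x)
  else True.

Definition smooth_on {m : nat} {W : normedModType R}
    (U : set 'rV[R]_m) (f : 'rV[R]_m -> W) : Prop :=
  forall k, Ck_on k U f.

End Smoothness.

(* A chart with values in R^n; the values of cmap outside cdom and of cinv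
   outside the image of cdom are irrelevant. *)
Record chart (R : realType) (M : topologicalType) (n : nat) := Chart {
  cdom : set M;
  cmap : M -> 'rV[R]_n;
  cinv : 'rV[R]_n -> M }.

Section Manifolds.
Context {R : realType}.

Definition is_chart {M : topologicalType} {n : nat} (c : chart R M n) : Prop :=
  [/\ open (cdom c) /\ open (cmap c @` cdom c),
      forall p, cdom c p -> cinv c (cmap c p) = p,
      forall p, cdom c p -> {for p, continuous (cmap c)} &
      forall x, (cmap c @` cdom c) x -> {for x, continuous (cinv c)}].

Definition is_atlas {M : topologicalType} {n : nat} (A : set (chart R M n)) :
    Prop :=
  [/\ forall a, A a -> is_chart a,
      forall p, exists2 a, A a & cdom a p &
      forall a b, A a -> A b ->
        smooth_on (cmap a @` (cdom a `&` cdom b)) (cmap b \o cinv a)].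

Definition is_manifold {M : topologicalType} {n : nat}
    (A : set (chart R M n)) : Prop :=
  [/\ hausdorff_space M, @second_countable M & is_atlas A].

Definition prod_chart {M N : topologicalType} {m n : nat}
    (a : chart R M m) (b : chart R N n) : chart R (M * N)%type (m + n) :=
  {| cdom := cdom a `*` cdom b;
     cmap := fun p => row_mx (cmap a p.1) (cmap b p.2);
     cinv := fun v => (cinv a (lsubmx v), cinv b (rsubmx v)) |}.

Definition prod_atlas {M N : topologicalType} {m n : nat}
    (A : set (chart R M m)) (B : set (chart R N n)) :
    set (chart R (M * N)%type (m + n)) :=
  [set c | exists a b, [/\ A a, B b & c = prod_chart a b]].

Definition smooth_map {M N : topologicalType} {m n : nat}
    (A : set (chart R M m)) (B : set (chart R N n)) (F : M -> N) : Prop :=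
  continuous F /\
  forall a b, A a -> B b ->
    smooth_on (cmap a @` (cdom a `&` F @^-1` cdom b))
              (cmap b \o F \o cinv a).

Definition smooth_fun {M : topologicalType} {n : nat}
    (A : set (chart R M n)) (f : M -> R) : Prop :=
  forall a, A a -> smooth_on (cmap a @` cdom a) (f \o cinv a).

End Manifolds.

(* Every loop is homotopic, with fixed endpoints, to a constant loop. *)
Definition simply_connected (R : realType) (M : topologicalType) : Prop :=
  forall gamma : R -> M,
    {within `[0, 1], continuous gamma} -> gamma 0 = gamma 1 ->
    exists H : R * R -> M,
      {within `[0, 1] `*` `[0, 1], continuous H} /\
      forall t : R, 0 <= t <= 1 ->
        [/\ H (0, t) = gamma t, H (1, t) = gamma 0,
            H (t, 0) = gamma 0 & H (t, 1) = gamma 0].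


Section LinearAlgebra.
Context {R : realType} {V : lmodType R}.

Definition lin_span (S : set V) : set V :=
  [set v | exists (n : nat) (c : 'I_n -> R) (s : 'I_n -> V),
     (forall i, S (s i)) /\ v = \sum_(i < n) c i *: s i].

(* T is meant to be a linear subspace of V. *)
Definition is_basis {n : nat} (T : set V) (e : 'I_n -> V) : Prop :=
  (forall i, T (e i)) /\
  forall v, T v -> exists! c : 'rV[R]_n, v = \sum_(i < n) c 0 i *: e i.

(* t is the trace of the endomorphism of the n-dimensional subspace T given by
   the restriction of L. *)
Definition is_trace (n : nat) (T : set V) (L : V -> V) (t : R) : Prop :=
  exists (e : 'I_n -> V) (c : 'M[R]_n),
    [/\ is_basis T e,
        forall j, L (e j) = \sum_(i < n) c i j *: e i &
        t = \tr c].

End LinearAlgebra.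

(* Raw types for tangent vectors and vector fields. *)
Notation functional R M := ((M -> R) -> R) (only parsing).
Notation prefield R M := (M -> (M -> R) -> R) (only parsing).

Section TangentBundle.
Context {R : realType} {M : topologicalType} {n : nat}.
Variable A : set (chart R M n).

Local Notation smooth := (smooth_fun A).

(* Tangent vectors are derivations of the algebra of smooth functions. They are
   represented as functionals on all of M -> R; the value 0 is imposed on
   functions that are not smooth, so that two functionals are equal as soon as
   they agree on smooth functions. *)
Definition tangent (p : M) : set (functional R M) :=
  [set v | [/\ forall (a : R) f g, smooth f -> smooth g ->
                 v (fun x => a * f x + g x) = a * v f + v g,
               forall f g, smooth f -> smooth g ->
                 v (fun x => f x * g x) = f p * v g + g p * v f &
               forall f, ~ smooth f -> v f = 0]].

Definition vfield : set (prefield R M) :=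
  [set X | (forall p, tangent p (X p)) /\
           forall f, smooth f -> smooth (fun p => X p f)].

Definition vf_scale (f : M -> R) (X : prefield R M) : prefield R M :=
  fun p => f p *: X p.

Definition bracket (X Y : prefield R M) : prefield R M :=
  fun p f => X p (fun q => Y q f) - Y p (fun q => X q f).

Definition is_connection
    (D : prefield R M -> prefield R M -> prefield R M) : Prop :=
  [/\ forall X Y, vfield X -> vfield Y -> vfield (D X Y),
      forall f X X' Y, smooth f -> vfield X -> vfield X' -> vfield Y ->
        D (vf_scale f X + X') Y = vf_scale f (D X Y) + D X' Y,
      forall (a : R) X Y Y', vfield X -> vfield Y -> vfield Y' ->
        D X (a *: Y + Y') = a *: D X Y + D X Y' &
      forall f X Y, smooth f -> vfield X -> vfield Y ->
        D X (vf_scale f Y) =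
        vf_scale (fun p => X p f) Y + vf_scale f (D X Y)].

Definition curvature
    (D : prefield R M -> prefield R M -> prefield R M) (X Y Z : prefield R M) : prefield R M :=
  D X (D Y Z) - D Y (D X Z) - D (bracket X Y) Z.

(* rho(Y, Z) at p is the trace of the endomorphism X |-> R(X, Y) Z of the
   tangent space at p. *)
Definition is_ricci
    (D : prefield R M -> prefield R M -> prefield R M)
    (rho : M -> functional R M -> functional R M -> R) : Prop :=
  forall Y Z p, vfield Y -> vfield Z ->
    exists L : functional R M -> functional R M,
      (forall X, vfield X -> L (X p) = curvature D X Y Z p) /\
      is_trace n (tangent p) L (rho p (Y p) (Z p)).

(* A tensor field of type (0,2) is given at p by a function of two functionals,
   only meaningful on tangent vectors at p. *)
Variable g : M -> functional R M -> functional R M -> R.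

Definition lorentzian_metric : Prop :=
  [/\ forall p (a : R) u v w, tangent p u -> tangent p v -> tangent p w ->
        g p (a *: u + v) w = a * g p u w + g p v w,
      forall p u v, tangent p u -> tangent p v -> g p u v = g p v u,
      forall X Y, vfield X -> vfield Y -> smooth (fun p => g p (X p) (Y p)) &
      forall p, exists e : 'I_n -> functional R M,
        is_basis (tangent p) e /\
        exists i0 : 'I_n, forall i j,
          g p (e i) (e j) =
          if i == j then (if i == i0 then -1 else 1) else 0].

Definition levi_civita
    (D : prefield R M -> prefield R M -> prefield R M) : Prop :=
  [/\ is_connection D,
      forall X Y, vfield X -> vfield Y -> D X Y - D Y X = bracket X Y &
      forall X Y Z p, vfield X -> vfield Y -> vfield Z ->
        X p (fun q => g q (Y q) (Z q)) =
        g p (D X Y p) (Z p) + g p (Y p) (D X Z p)].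

Definition lie_derivative (X Y Z : prefield R M) : M -> R :=
  fun p => X p (fun q => g q (Y q) (Z q))
           - g p (bracket X Y p) (Z p) - g p (Y p) (bracket X Z p).

Definition ricci_soliton : Prop :=
  exists D rho, [/\ levi_civita D, is_ricci D rho &
    exists X (mu : R), vfield X /\
      forall Y Z p, vfield Y -> vfield Z ->
        lie_derivative X Y Z p + rho p (Y p) (Z p) = mu * g p (Y p) (Z p)].

End TangentBundle.

(* No compatibility is assumed between the group law and the topology: it is
   part of is_lie_group. *)
#[short(type="groupTopologicalType")]
HB.structure Definition GroupTopological := {G of Group G & Topological G}.

Section LieGroups.
Context {R : realType} {G : groupTopologicalType} {n : nat}.
Variable A : set (chart R G n).

Definition is_lie_group : Prop :=
  [/\ is_manifold A,
      smooth_map (prod_atlas A A) A (fun x : G * G => (x.1 * x.2)%g) &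
      smooth_map A A (fun x : G => x^-1%g)].

(* The differential of the left translation by a. *)
Definition dleft (a : G) (v : functional R G) : functional R G :=
  fun f => v (fun x => f (a * x)%g).

Definition lie_algebra : set (prefield R G) :=
  [set X | vfield A X /\ forall a h, X (a * h)%g = dleft a (X h)].

Fixpoint derived_algebra (k : nat) : set (prefield R G) :=
  if k is k'.+1 then
    lin_span [set Z | exists X Y,
      [/\ derived_algebra k' X, derived_algebra k' Y & Z = bracket X Y]]
  else lie_algebra.

(* A Lie group is called solvable when its Lie algebra is. *)
Definition solvable_lie_group : Prop :=
  exists k, derived_algebra k `<=` [set 0].

Definition left_invariant
    (g : G -> functional R G -> functional R G -> R) : Prop :=
  forall a h u v, tangent A h u -> tangent A h v ->
    g (a * h)%g (dleft a u) (dleft a v) = g h u v.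

End LieGroups.

(* Main.v *)
(* A three-dimensional solvable Lie algebra g is not perfect, so some plane
   contains [g, g]; this plane can be chosen to be an abelian ideal, and then
   g = R X0 + h with ad X0 acting on h as p Id + J, J of trace 0.  If J is
   invertible, J is skew for a nondegenerate form on h (unique up to scale);
   extending it by making X0 orthogonal to h gives, for a suitable value of
   <X0, X0>, a Lorentzian metric of constant curvature.  If J is nilpotent, h is
   given a degenerate form whose null direction lies in the kernel of J and is
   paired with X0, and the metric is flat.  So every such group carries a
   left-invariant Lorentzian Einstein metric, which is a Ricci soliton with
   vector field 0.

   Since tangent vectors are derivations of the global smooth functions, the
   left-invariant frame needs bump functions and Hadamard's lemma. *)
From HB Require Import structures.
Require Import Defs.
From mathcomp Require Import all_boot all_order all_algebra.
From mathcomp Require Import all_classical all_reals all_analysis.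
From mathcomp Require Import ring lra.
Set Implicit Arguments.
Unset Strict Implicit.
Unset Printing Implicit Defensive.
Import Order.TTheory GRing.Theory Num.Theory.
Import numFieldNormedType.Exports.
Local Open Scope classical_set_scope.
Local Open Scope ring_scope.


(** * Calculus of C^k functions on open sets of R^m *)

(** A left-invariant frame turns vector fields into functions with values in row vectors, and the
    connection into the differential plus constant matrices. What is asked of the metric becomes a
    finite set of matrix identities: vanishing torsion against the structure constants, skewness for
    the Gram matrix, and one trace identity. The connection matrices are therefore exhibited, and no
    Koszul formula has to be proved.

    A skew J enters only the covariant derivative along X0 and contributes nothing to the curvature,
    which is thus that of the model with ad X0 = p Id, namely -p^2 / <X0, X0>. A nonzero nilpotent J
    is skew for no nondegenerate form on the plane; this forces the degenerate form.

    Smoothness is expressed by iterated partial derivatives, so the chain rule first requires that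
    C^1 functions be differentiable; and a derivation only accepts global functions, so local ones
    must be cut off before it can be applied. *)

Lemma near_eq_continuous_at (T U : topologicalType) (f g : T -> U) x :
  {near x, f =1 g} -> {for x, continuous f} -> {for x, continuous g}.
Proof.
move=> fg cf; rewrite /prop_for /continuous_at -(nbhs_singleton fg).
by apply: cvg_trans cf; exact: near_eq_cvg.
Qed.

Section CkGeneral.
Context {R : realType} {m : nat} {W : normedModType R}.
Implicit Types (U V : set 'rV[R]_m) (f g : 'rV[R]_m -> W).

Lemma Ck_on_continuous k U f x : Ck_on k U f -> U x -> {for x, continuous f}.
Proof. by case: k => [|k] [cf _]; apply: cf. Qed.

Lemma Ck_on_sub k U V f : V `<=` U -> Ck_on k U f -> Ck_on k V f.
Proof.
move=> VU; elim: k f => [|k IH] f [cf df]; split=> //; try by move=> x /VU /cf.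
by move=> i; have [dfi Dfi] := df i; split; [move=> x /VU /dfi|exact: IH].
Qed.

Lemma Ck_on_le j k U f : (j <= k)%N -> Ck_on k U f -> Ck_on j U f.
Proof.
elim: k j f => [|k IH] [|j] f //= jk [cf df]; split=> // i.
by have [dfi Dfi] := df i; split=> //; exact: IH.
Qed.

Lemma Ck_on_ext k U f g : open U -> (forall x, U x -> f x = g x) ->
  Ck_on k U f -> Ck_on k U g.
Proof.
move=> oU; elim: k f g => [|k IH] f g fg [cf df].
  split=> // x Ux; apply: near_eq_continuous_at (cf x Ux).
  by near=> y; apply: fg; near: y; exact: open_nbhs_nbhs.
have nfg x : U x -> {near x, f =1 g}.
  by move=> Ux; near=> y; apply: fg; near: y; exact: open_nbhs_nbhs.
split=> [x Ux|i].
  by apply: near_eq_continuous_at (cf x Ux); exact: nfg.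
have [dfi Dfi] := df i; split=> [x Ux|].
  by apply: near_eq_derivable (dfi x Ux); exact: nfg.
by apply: IH Dfi => x Ux; apply: near_eq_derive; exact: nfg.
Unshelve. all: by end_near. Qed.

(** [Ck_on] only quantifies over the points of the set, the derivatives being those of the total
    function, so it passes to unions. *)
Lemma Ck_on_glue k U f :
  (forall x, U x -> exists2 V, V x & Ck_on k V f) -> Ck_on k U f.
Proof.
elim: k f => [|k IH] f Uf; split=> //.
- by move=> x /Uf[V Vx sV]; exact: (Ck_on_continuous sV).
- by move=> x /Uf[V Vx sV]; exact: (Ck_on_continuous sV).
move=> i; split; first by move=> x /Uf[V Vx [_ /(_ i)[dV _]]]; exact: dV.
by apply: IH => x /Uf[V Vx [_ /(_ i)[_ DV]]]; exists V.
Qed.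

Lemma Ck_on_cst k U (c : W) : Ck_on k U (cst c).
Proof.
have cc (c' : W) (x : 'rV[R]_m) : {for x, continuous (cst c' : 'rV[R]_m -> W)}.
  exact: cst_continuous.
elim: k c => [|k IH] c; split=> //; try by move=> x _; apply: cc.
move=> i; split; first by move=> x _; exact: derivable_cst.
rewrite (_ : (fun x => _) = cst 0); first exact: IH.
by apply/funext => x; rewrite derive_cst.
Qed.

Lemma Ck_onD k U f g : Ck_on k U f -> Ck_on k U g -> open U ->
  Ck_on k U (fun x => f x + g x).
Proof.
move=> + + oU; elim: k f g => [|k IH] f g [cf df] [cg dg]; split=> //;
  try by move=> x Ux; apply: continuousD; [exact: cf|exact: cg].
move=> i; have [dfi Dfi] := df i; have [dgi Dgi] := dg i.
split; first by move=> x Ux; apply: derivableD; [exact: dfi|exact: dgi].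
apply: Ck_on_ext (IH _ _ Dfi Dgi) => // x Ux.
by rewrite /= deriveD//; [exact: dfi|exact: dgi].
Qed.

Lemma smooth_on_sub U V f : V `<=` U -> smooth_on U f -> smooth_on V f.
Proof. by move=> VU sf k; exact: Ck_on_sub (sf k). Qed.

Lemma smooth_on_ext U f g : open U -> (forall x, U x -> f x = g x) ->
  smooth_on U f -> smooth_on U g.
Proof. by move=> oU fg sf k; exact: Ck_on_ext (sf k). Qed.

Lemma smooth_on_glue U f :
  (forall x, U x -> exists2 V, V x & smooth_on V f) -> smooth_on U f.
Proof. by move=> Uf k; apply: Ck_on_glue => x /Uf[V Vx /(_ k)]; exists V. Qed.

Lemma smooth_on_cst U (c : W) : smooth_on U (cst c).
Proof. by move=> k; exact: Ck_on_cst. Qed.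

Lemma smooth_onD U f g : open U -> smooth_on U f -> smooth_on U g ->
  smooth_on U (fun x => f x + g x).
Proof. by move=> oU sf sg k; apply: Ck_onD. Qed.

Lemma smooth_on_continuous U f x :
  smooth_on U f -> U x -> {for x, continuous f}.
Proof. by move=> /(_ 0%N) sf; exact: (Ck_on_continuous sf). Qed.

Lemma smooth_on_derivable U f x i :
  smooth_on U f -> U x -> derivable f x (delta_mx 0 i).
Proof. by move=> /(_ 1%N)[_ /(_ i)[df _]]; exact: df. Qed.

Lemma smooth_on_derive U f i :
  smooth_on U f -> smooth_on U (fun x => 'D_(delta_mx 0 i) f x).
Proof. by move=> sf k; have [_ /(_ i)[]] := sf k.+1. Qed.

Lemma is_derive_Ck k U f x i : Ck_on k.+1 U f -> U x ->
  is_derive x (delta_mx 0 i) f ('D_(delta_mx 0 i) f x).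
Proof. by move=> [_ /(_ i)[df _]] Ux; apply/derivableP/df. Qed.

End CkGeneral.

Section CkReal.
Context {R : realType} {m : nat}.
Implicit Types (U V : set 'rV[R]_m) (f g : 'rV[R]_m -> R).

Lemma Ck_onM k U f g : open U -> Ck_on k U f -> Ck_on k U g ->
  Ck_on k U (fun x => f x * g x).
Proof.
move=> oU; elim: k f g => [|k IH] f g sf sg; move: (sf) (sg) => [cf df] [cg dg];
  split=> //; try by move=> x Ux; apply: continuousM; [exact: cf|exact: cg].
move=> i; have [dfi Dfi] := df i; have [dgi Dgi] := dg i.
split; first by move=> x Ux; apply: derivableM; [exact: dfi|exact: dgi].
apply: (@Ck_on_ext _ _ _ _ _
  (fun x => f x * 'D_(delta_mx 0 i) g x + g x * 'D_(delta_mx 0 i) f x)) => //.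
  by move=> x Ux; rewrite deriveM//; [exact: dfi|exact: dgi].
apply: Ck_onD => //; apply: IH => //; exact: Ck_on_le (leqnSn k) _.
Qed.

Lemma Ck_onV k U f : open U -> (forall x, U x -> f x != 0) -> Ck_on k U f ->
  Ck_on k U (fun x => (f x)^-1).
Proof.
move=> oU f0; elim: k => [|k IH] sf; move: (sf) => [cf df];
  split=> //; try by move=> x Ux; apply: continuousV; [exact: f0|exact: cf].
move=> i; have [dfi Dfi] := df i.
split; first by move=> x Ux; apply: derivableV; [exact: f0|exact: dfi].
have IHk := IH (Ck_on_le (leqnSn k) sf).
apply: (@Ck_on_ext _ _ _ _ _
  (fun x => cst (-1) x * ((f x)^-1 * (f x)^-1) * 'D_(delta_mx 0 i) f x)) => //.
  move=> x Ux; rewrite deriveV//; [|exact: f0|exact: dfi].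
  by rewrite /cst /= mulN1r -invfM -expr2.
do 2 (apply: Ck_onM => //); last exact: Ck_onM.
exact: Ck_on_cst.
Qed.

Lemma Ck_on_sum k U (I : Type) (r : seq I) (P : pred I)
    (F : I -> 'rV[R]_m -> R) : open U ->
  (forall i, P i -> Ck_on k U (F i)) ->
  Ck_on k U (fun x => \sum_(i <- r | P i) F i x).
Proof.
move=> oU sF; elim: r => [|a r IH].
  by apply: Ck_on_ext (Ck_on_cst k U (0 : R)) => // x _; rewrite big_nil.
case Pa: (P a); last by under eq_fun do rewrite big_cons Pa.
by under eq_fun do rewrite big_cons Pa; apply: Ck_onD => //; exact: sF.
Qed.

Lemma smooth_onM U f g : open U -> smooth_on U f -> smooth_on U g ->
  smooth_on U (fun x => f x * g x).
Proof. by move=> oU sf sg k; apply: Ck_onM. Qed.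

Lemma smooth_onV U f : open U -> (forall x, U x -> f x != 0) ->
  smooth_on U f -> smooth_on U (fun x => (f x)^-1).
Proof. by move=> oU f0 sf k; apply: Ck_onV. Qed.

Lemma smooth_on_sum U (I : Type) (r : seq I) (P : pred I)
    (F : I -> 'rV[R]_m -> R) : open U ->
  (forall i, P i -> smooth_on U (F i)) ->
  smooth_on U (fun x => \sum_(i <- r | P i) F i x).
Proof. by move=> oU sF k; apply: Ck_on_sum => // i Pi; exact: sF. Qed.

Lemma is_derive_coord (x v : 'rV[R]_m) (j : 'I_m) :
  is_derive x v (fun y : 'rV[R]_m => y 0 j : R) (v 0 j).
Proof.
have did : derivable (@id 'rV[R]_m) x v by exact: derivable_id.
apply: DeriveDef.
  by move/derivable_mxP: did => /(_ 0 j).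
by have /(congr1 (fun M : 'rV_m => M 0 j)) := derive_mx did; rewrite derive_id mxE.
Qed.

Lemma smooth_on_coord U (j : 'I_m) : smooth_on U (fun y : 'rV[R]_m => y 0 j : R).
Proof.
case=> [|k]; split=> //; try by move=> x _; exact: coord_continuous.
move=> i; split; first by move=> x _; have := is_derive_coord x (delta_mx 0 i) j.
rewrite (_ : (fun x => _) = cst ((delta_mx 0 i : 'rV[R]_m) 0 j)).
  exact: Ck_on_cst.
apply/funext => x; have := is_derive_coord x (delta_mx 0 i) j.
by case.
Qed.

End CkReal.

Lemma Ck_on_component (R : realType) m n k (U : set 'rV[R]_m)
    (f : 'rV[R]_m -> 'rV[R]_n) j :
  open U -> Ck_on k U f -> Ck_on k U (fun x => f x 0 j : R).
Proof.
have cj (g : 'rV[R]_m -> 'rV[R]_n) x : {for x, continuous g} ->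
    {for x, continuous (fun y => g y 0 j : R)}.
  move=> cg; apply: (@continuous_comp _ _ _ g (fun M : 'rV[R]_n => M 0 j)) => //.
  exact: coord_continuous.
move=> oU; elim: k f => [|k IH] f [cf df]; split=> //;
  try by move=> x Ux; exact/cj/cf.
move=> i; have [dfi Dfi] := df i.
split; first by move=> x Ux; have /derivable_mxP := dfi x Ux; apply.
apply: Ck_on_ext (IH _ Dfi) => // x Ux.
by rewrite /= derive_mx ?mxE//; exact: dfi.
Qed.

(** * Restriction to lines, differentiability of C^1 functions and the chain rule *)

Lemma is_derive_line (R : realType) (V W : normedModType R) (f : V -> W)
    (y v : V) (t : R) d :
  is_derive (y + t *: v) v f d ->
  is_derive t (1 : R) (fun s : R => f (y + s *: v)) d.
Proof.
have E : (fun h : R => h^-1 *: (((fun s : R => f (y + s *: v)) \o shift t) (h *: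
  (1 : R))
     - f (y + t *: v))) =
   (fun h => h^-1 *: ((f \o shift (y + t *: v)) (h *: v) - f (y + t *: v))).
  apply/funext => h /=; congr (_ *: (f _ - _)).
  by rewrite scalerDl addrCA /GRing.scale /= mulr1.
move=> [dfv <-]; apply: DeriveDef; first by rewrite /derivable E.
by rewrite /derive E.
Qed.

Lemma is_derive_of_line (R : realType) (V W : normedModType R) (f : V -> W)
    (y v : V) d :
  is_derive (0 : R) (1 : R) (fun s : R => f (y + s *: v)) d ->
  is_derive y v f d.
Proof.
have E : (fun h : R => h^-1 *: (((fun s : R => f (y + s *: v)) \o shift 0)
      (h *: (1 : R)) - f (y + 0 *: v))) =
    (fun h => h^-1 *: ((f \o shift y) (h *: v) - f y)).
  apply/funext => h /=; rewrite scale0r !addr0 [y + _]addrC.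
  by rewrite /GRing.scale /= mulr1.
move=> [df <-]; apply: DeriveDef.
  by move: df; rewrite /derivable E.
by rewrite /derive -E.
Qed.

Lemma mean_value_bound (R : realType) (phi dphi : R -> R) (s e : R) :
  (forall t, `|t| <= `|s| -> is_derive t (1 : R) phi (dphi t)) ->
  (forall t, `|t| <= `|s| -> `|dphi t| <= e) ->
  `|phi s - phi 0| <= e * `|s|.
Proof.
move=> dp be.
have cont : forall a b : R, (forall t, t \in `[a, b] -> `|t| <= `|s|) ->
    {within `[a, b], continuous phi}.
  move=> a b ab; apply: derivable_within_continuous => t tab.
  by have [] := dp _ (ab _ tab).
have [s0|s0] := lerP 0 s.
  have sub t : t \in `[0, s] -> `|t| <= `|s|.
    by rewrite in_itv/= => /andP[t0 ts]; rewrite !ger0_norm.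
  have [|c cs ->] := @MVT_segment R phi dphi 0 s s0 _ (cont _ _ sub).
    move=> t ts; apply: dp; apply: sub; exact: subset_itv_oo_cc.
  by rewrite subr0 normrM; apply: ler_wpM2r => //; apply/be/sub.
have sub t : t \in `[s, 0] -> `|t| <= `|s|.
  rewrite in_itv/= => /andP[st t0].
  by rewrite !ler0_norm ?(ltW s0)// lerN2.
have [|c cs E] := @MVT_segment R phi dphi s 0 (ltW s0) _ (cont _ _ sub).
  move=> t ts; apply: dp; apply: sub; exact: subset_itv_oo_cc.
rewrite distrC E sub0r normrM normrN; apply: ler_wpM2r => //; exact/be/sub.
Qed.

Lemma first_order_differentiable (R : realType) (V W : normedModType R)
    (f : V -> W) (L : {linear V -> W}) x : continuous L ->
  (forall e, 0 < e -> \forall h \near 0, `|f (x + h) - (f x + L h)| <= e * `|h|) ->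
  differentiable f x.
Proof.
move=> cL fL; have fo : f \o shift x = cst (f x) + L +o_ 0 id.
  apply/eqaddoP => e e0; have := fL e e0; apply: filter_app; near=> h.
  by rewrite [x + h]addrC.
by apply/diff_locallyP; rewrite (diff_unique cL fo).
Unshelve. all: by end_near. Qed.

Section Differentiability.
Context {R : realType} {m : nat}.
Implicit Types (U : set 'rV[R]_m) (f : 'rV[R]_m -> R).

Lemma coord_le_norm (x : 'rV[R]_m) i : `|x 0 i| <= `|x|.
Proof.
by rewrite [leRHS]/Num.Def.normr/= mx_normrE; exact: (le_bigmax _ _ (0, i)).
Qed.

Lemma norm_le_coord (x : 'rV[R]_m) (e : R) : 0 <= e ->
  (forall i, `|x 0 i| <= e) -> `|x| <= e.
Proof.
move=> e0 xe; rewrite [leLHS]/Num.Def.normr/= mx_normrE (bigmax_le _ e0)//.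
by move=> [i j] _ /=; rewrite ord1.
Qed.

(** By the mean value inequality, each coordinate axis contributes an error of at most [e * |h|],
    since the partial derivatives are [e]-close to their values at [x] on a ball; hence the factor
    [e *+ m]. *)
Lemma Ck1_first_order U f x (e : R) : open U -> Ck_on 1 U f -> U x -> 0 < e ->
  \forall h \near (0 : 'rV[R]_m),
    `|f (x + h) - f x - \sum_i h 0 i * 'D_(delta_mx 0 i) f x| <= e *+ m * `|h|.
Proof.
move=> oU sf Ux e0.
have : \forall y \near x, U y /\ forall i : 'I_m,
    `|'D_(delta_mx 0 i) f x - 'D_(delta_mx 0 i) f y| <= e.
  near=> y; split; first by near: y; exact: open_nbhs_nbhs.
  near: y; apply: filter_forall => i.
  have [_ /(_ i)[_ [ci _]]] := sf.
  by move/cvgrPdist_le : (ci x Ux); apply.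
move=> /nbhs_ballP[d /= d0 dP].
near=> h.
have hd : `|h| < d.
  near: h; apply/nbhs_ballP; exists d => // y.
  by rewrite -ball_normE/= sub0r normrN.
(* T k keeps the first k coordinates of h: the increment is telescoped along
   the coordinate axes. *)
pose T k : 'rV[R]_m := \row_(i < m) if (i < k)%N then h 0 i else 0.
suff H k : (k <= m)%N ->
    `|f (x + T k) - f x - \sum_(i < m | (i < k)%N) h 0 i * 'D_(delta_mx 0 i) f x|
    <= e *+ k * `|h|.
  have := H m (leqnn _); rewrite (_ : T m = h); last first.
    by apply/rowP => i; rewrite mxE ltn_ord.
  have E : (fun i : 'I_m => (i < m)%N) =1 xpredT by move=> i; exact: ltn_ord.
  by rewrite (eq_bigl _ _ E).
elim: k => [_|k IH km].
  rewrite big1 ?subr0 ?mulr0n ?mul0r ?subr0//.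
  rewrite (_ : T 0%N = 0) ?addr0 ?subrr ?normr0//.
  by apply/rowP => i; rewrite !mxE.
pose i := Ordinal km.
have TS : T k.+1 = T k + h 0 i *: delta_mx 0 i.
  apply/rowP => j; rewrite !mxE/= ltnS leq_eqVlt -val_eqE/= eq_sym.
  case: (eqVneq (k : nat) j) => [kj|kj]; last by rewrite mulr0 addr0.
  by rewrite -kj ltnn mulr1 add0r; congr (h _ _); apply: val_inj.
rewrite (bigD1 i)//=.
under eq_bigl => j do rewrite ltnS -val_eqE/= [(_ <= k)%N]leq_eqVlt andbC.
rewrite (eq_bigl (fun j : 'I_m => (j < k)%N)); last first.
  by move=> j /=; case: (ltngtP j k).
have -> : f (x + T k.+1) - f x - (h 0 i * 'D_(delta_mx 0 i) f x +
     \sum_(j < m | (j < k)%N) h 0 j * 'D_(delta_mx 0 j) f x) =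
  (f (x + T k) - f x - \sum_(j < m | (j < k)%N) h 0 j * 'D_(delta_mx 0 j) f x)
  + (f (x + T k.+1) - f (x + T k) - h 0 i * 'D_(delta_mx 0 i) f x).
  by ring.
rewrite mulrSr mulrDl; apply: le_trans (ler_normD _ _) _; apply: lerD.
  exact/IH/ltnW.
pose phi t := f (x + T k + t *: delta_mx 0 i) - t * 'D_(delta_mx 0 i) f x.
have -> : f (x + T k.+1) - f (x + T k) - h 0 i * 'D_(delta_mx 0 i) f x =
   phi (h 0 i) - phi 0.
  by rewrite /phi TS [x + (_ + _)]addrA scale0r addr0 mul0r subr0; ring.
have bT t : `|t| <= `|h 0 i| -> ball x d (x + T k + t *: delta_mx 0 i).
  move=> th; rewrite -ball_normE/= -addrA opprD addNKr normrN.
  apply: le_lt_trans hd; apply: norm_le_coord => // j; rewrite !mxE /=.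
  have := coord_le_norm h j.
  case: (eqVneq j i) => [->|ji].
    by rewrite ltnn add0r mulr1 => _; apply: le_trans th (coord_le_norm _ _).
  by rewrite mulr0 addr0; case: ifP => // _ _; rewrite normr0.
apply: le_trans (_ : e * `|h 0 i| <= _); last first.
  by apply: ler_wpM2l; [exact: ltW|exact: coord_le_norm].
apply: (@mean_value_bound _ phi (fun t => 'D_(delta_mx 0 i) f
   (x + T k + t *: delta_mx 0 i) - 'D_(delta_mx 0 i) f x)) => t th.
  apply: is_deriveB; last first.
    by apply: is_derive_eq; rewrite /GRing.scale/= !(mulr0,mulr1,addr0,add0r).
  apply: is_derive_line; apply: is_derive_Ck sf _.
  by have [] := dP _ (bT _ th).
by rewrite distrC; have [_] := dP _ (bT _ th); apply.
Unshelve. all: by end_near. Qed.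

(** Bridge from partial derivatives, the only ones in [Ck_on], to the total differential on which
    the chain rule rests. *)
Lemma Ck1_differentiable U f x : open U -> Ck_on 1 U f -> U x ->
  differentiable f x.
Proof.
move=> oU sf Ux.
pose d (h : 'rV[R]_m) := \sum_i h 0 i * 'D_(delta_mx 0 i) f x.
have lin_d : linear d.
  move=> a u v; rewrite /d scaler_sumr -big_split/=.
  by apply: eq_bigr => i _; rewrite !mxE mulrDl -mulrA.
pose L : {linear 'rV[R]_m -> R} :=
  HB.pack d (GRing.isLinear.Build R 'rV[R]_m R *:%R d lin_d).
have cL : continuous L.
  move=> y; apply: differentiable_continuous.
  rewrite -[L : _ -> _]/d.
  have -> : d = \sum_i (fun h : 'rV[R]_m => h 0 i * 'D_(delta_mx 0 i) f x).
    by apply/funext => h; rewrite fct_sumE.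
  apply: differentiable_sum => i.
  by apply: differentiableM => //; exact: differentiable_coord.
apply: (first_order_differentiable cL) => e e0.
(* Dividing by [m.+1] rather than [m] also covers dimension 0. *)
have e'0 : 0 < e / m.+1%:R by rewrite divr_gt0.
have := Ck1_first_order oU sf Ux e'0; apply: filter_app; near=> h.
rewrite opprD addrA; move=> /le_trans; apply; apply: ler_wpM2r => //.
rewrite -[leLHS]mulr_natr mulrAC ler_pdivrMr//; apply: ler_wpM2l; first exact: ltW.
by rewrite ler_nat.
Unshelve. all: by end_near. Qed.

Lemma is_derive_curve U f (c : R -> 'rV[R]_m) (dc : 'rV[R]_m) t :
  open U -> Ck_on 1 U f -> U (c t) -> is_derive t (1 : R) c dc ->
  is_derive t (1 : R) (f \o c)
    (\sum_i 'D_(delta_mx 0 i) f (c t) * dc 0 i).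
Proof.
move=> oU sf Uc [/derivable1_diffP dfc <-].
have dff := Ck1_differentiable oU sf Uc.
have dfcc : differentiable (f \o c) t by exact: differentiable_comp.
apply: DeriveDef; first exact/derivable1_diffP.
rewrite !deriveE// diff_comp//= [in LHS](row_sum_delta ('d c t 1)) linear_sum.
by apply: eq_bigr => i _; rewrite linearZ/= (deriveE _ dff) mulrC.
Qed.

End Differentiability.

(** The chain rule writes a partial derivative of [f \o phi] as a sum of products of a partial
    derivative of [f] composed with [phi], covered by the induction hypothesis, and a partial
    derivative of a component of [phi]. *)
Lemma Ck_on_comp (R : realType) m n k (U : set 'rV[R]_m) (V : set 'rV[R]_n)
    (f : 'rV[R]_n -> R) (phi : 'rV[R]_m -> 'rV[R]_n) :
  open U -> open V -> (forall x, U x -> V (phi x)) ->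
  Ck_on k V f -> Ck_on k U phi -> Ck_on k U (f \o phi).
Proof.
move=> oU oV UV; have cfphi j f' x : Ck_on j V f' -> Ck_on j U phi -> U x ->
    {for x, continuous (f' \o phi)}.
  move=> sf sphi Ux; apply: (@continuous_comp _ _ _ phi f').
    exact: (Ck_on_continuous sphi).
  exact/(Ck_on_continuous sf)/UV.
elim: k f => [|k IH] f sf sphi; (split; [by move=> x; exact: cfphi sf sphi|]);
  first by [].
have dcomp i x : U x -> is_derive x (delta_mx 0 i) (f \o phi)
    (\sum_j 'D_(delta_mx 0 j) f (phi x) * 'D_(delta_mx 0 i) (fun y => phi y 0 j) x).
  move=> Ux; have := is_derive_Ck i sphi Ux.
  rewrite -{1}(addr0 x) -{1}(scale0r (delta_mx 0 i)) => /is_derive_line dphi.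
  have sf1 : Ck_on 1 V f by exact: Ck_on_le sf.
  have Vx : V (phi (x + 0 *: delta_mx 0 i)) by rewrite scale0r addr0; exact: UV.
  have := is_derive_curve oV sf1 Vx dphi.
  rewrite derive_mx; last by have [_ /(_ i)[dp _]] := sphi; exact: dp.
  rewrite scale0r addr0; under eq_bigr do rewrite mxE.
  exact: (@is_derive_of_line _ _ _ (f \o phi)).
move=> i; split; first by move=> x /(dcomp i)[].
apply: (@Ck_on_ext _ _ _ _ _ (fun x => \sum_j ('D_(delta_mx 0 j) f \o phi) x *
    'D_(delta_mx 0 i) (fun y => phi y 0 j) x)) => //.
  by move=> x /(dcomp i)[_ <-].
apply: Ck_on_sum => // j _; apply: Ck_onM => //.
  apply: IH; last exact: Ck_on_le sphi.
  by have [_ /(_ j)[]] := sf.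
by have [_ /(_ i)[]] := Ck_on_component j oU sphi.
Qed.

Lemma smooth_on_comp (R : realType) m n (U : set 'rV[R]_m) (V : set 'rV[R]_n)
    (f : 'rV[R]_n -> R) (phi : 'rV[R]_m -> 'rV[R]_n) :
  open U -> open V -> (forall x, U x -> V (phi x)) ->
  smooth_on V f -> smooth_on U phi -> smooth_on U (f \o phi).
Proof. by move=> oU oV UV sf sphi k; exact: (Ck_on_comp oU oV UV (sf k) (sphi k)). Qed.


(** * Bump functions *)

(** Serves where no differentiation rule applies: for [flat] at the origin, and under the integral
    sign in Hadamard's lemma. *)
Lemma is_derive_quadratic_bound (R : realType) (f : R -> R) (x d K : R) :
  (forall h, `|f (x + h) - f x - h * d| <= K * h ^+ 2) ->
  is_derive x (1 : R) f d.
Proof.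
move=> fK.
have K0 : 0 <= K by have := le_trans (normr_ge0 _) (fK 1); rewrite expr1n mulr1.
have cv : (fun h => h^-1 *: ((f \o shift x) (h *: (1 : R)) - f x)) @ 0^' --> d.
  apply/cvgrPdist_le => e e0; near=> h.
  have h0 : h != 0 by near: h; exact: nbhs_dnbhs_neq.
  rewrite distrC [h *: 1]mulr1 /= [h + x]addrC.
  have -> : h^-1 *: (f (x + h) - f x) - d = h^-1 * (f (x + h) - f x - h * d).
    by rewrite /GRing.scale/=; field.
  rewrite normrM normfV ler_pdivrMl ?normr_gt0//.
  apply: le_trans (fK h) _; rewrite -real_normK ?num_real// expr2 mulrA mulrC.
  apply: ler_wpM2l => //; apply: le_trans (_ : (K + 1) * `|h| <= _).
    by apply: ler_wpM2r => //; rewrite lerDl.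
  rewrite mulrC -ler_pdivlMr ?ltr_wpDl//; near: h; apply: nbhs_dnbhs.
  apply/nbhs_ballP; exists (e / (K + 1)) => /=; first by rewrite divr_gt0// ltr_wpDl.
  by move=> y; rewrite /ball/= sub0r normrN => /ltW.
apply: DeriveDef; first by apply/cvg_ex; exists d.
exact: cvg_lim cv.
Unshelve. all: by end_near. Qed.

Section FlatFunction.
Context {R : realType}.

(** The exponent [n] makes the family stable: the derivative of a member is a linear combination of
    two others, so smoothness of all of them follows from one induction on the order. *)
Definition flat (n : nat) (t : R) : R :=
  if 0 < t then t^-1 ^+ n * expR (- t^-1) else 0.

Lemma flat_gt0 n t : 0 < t -> 0 < flat n t.
Proof. by move=> t0; rewrite /flat t0 mulr_gt0 ?expR_gt0 ?exprn_gt0 ?invr_gt0. Qed.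

Lemma flat_le0 n t : t <= 0 -> flat n t = 0.
Proof. by rewrite /flat leNgt; case: ifP. Qed.

Lemma flat_ge0 n t : 0 <= flat n t.
Proof.
by have [/(flat_gt0 n)/ltW//|/flat_le0 ->] := ltrP 0 t.
Qed.

(** Comes from exp(1/t) >= (1/t)^(n+2) / (n+2)!. It yields the derivative 0 at the origin. *)
Lemma flat_quadratic n t : `|flat n t| <= (n.+2)`!%:R * t ^+ 2.
Proof.
have [t0|t0] := ltrP 0 t; last by rewrite flat_le0// normr0 mulr_ge0 ?sqr_ge0.
rewrite ger0_norm ?flat_ge0// /flat t0 expRN ler_pdivrMr ?expR_gt0//.
have t'0 : 0 <= t^-1 by rewrite invr_ge0 ltW.
have := expR_ge1Dxn n.+1 t'0.
move=> /(le_trans (_ : t^-1 ^+ n.+2 / n.+2`!%:R <= _)) H.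
have {}H := H (ltac:(by rewrite lerDr)).
rewrite ler_pdivrMr ?ltr0n ?fact_gt0// in H.
have -> : t^-1 ^+ n = t ^+ 2 * t^-1 ^+ n.+2.
  by rewrite -[n.+2]addn2 exprD !exprVn mulrCA mulfV ?mulr1// expf_neq0// gt_eqF.
rewrite [leRHS]mulrAC [leRHS]mulrC; apply: ler_wpM2l; first exact: sqr_ge0.
by rewrite mulrC.
Qed.

Lemma is_derive_flat n t :
  is_derive t (1 : R) (flat n) (flat n.+2 t - n%:R * flat n.+1 t).
Proof.
have [t0|t0|<-] := ltgtP 0 t.
- apply: (@near_eq_is_derive R R R (fun s : R => s^-1 ^+ n * expR (- s^-1) : R)).
    near=> s; rewrite /flat ifT//; near: s; exact: lt_nbhsr.
  have t1 : t != 0 by rewrite gt_eqF.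
  have dV : is_derive t (1 : R) (fun s : R => s^-1) (- (t^-1 ^+ 2)).
    have dI := @is_derive_id R R t 1.
    have /= := is_deriveV t1 dI.
    by rewrite /GRing.scale/= mulr1 exprVn.
  have dX k : is_derive t (1 : R) (fun s : R => s^-1 ^+ k) (- (k%:R * t^-1 ^+ k.+1)).
    elim: k => [|k IH].
      by rewrite mul0r oppr0; under eq_fun do rewrite expr0; exact: is_derive_cst.
    under eq_fun do rewrite exprS.
    apply: is_derive_eq; rewrite /GRing.scale/= -natr1 !exprS; ring.
  have dE : is_derive t (1 : R) (fun s : R => expR (- s^-1))
      (expR (- t^-1) * t^-1 ^+ 2).
    have dN : is_derive t (1 : R) (fun s : R => - s^-1) (t^-1 ^+ 2).
      by apply: is_derive_eq; rewrite opprK.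
    exact: is_derive1_comp.
  apply: is_derive_eq; rewrite /flat t0 /GRing.scale/= !exprS; ring.
- apply: (@near_eq_is_derive R R R (cst 0)).
    near=> s; rewrite /flat ifF//; apply/negbTE; rewrite -leNgt ltW//.
    by near: s; exact: lt_nbhsl.
  by rewrite !flat_le0 ?ltW// mulr0 subr0; exact: is_derive_cst.
rewrite !flat_le0// mulr0 subr0.
apply: (@is_derive_quadratic_bound _ _ _ _ (n.+2)`!%:R) => h.
by rewrite (flat_le0 n (lexx 0)) mulr0 !subr0 add0r; exact: flat_quadratic.
Unshelve. all: by end_near. Qed.

End FlatFunction.

Section Bump.
Context {R : realType} {m : nat}.
Implicit Types (U : set 'rV[R]_m) (u : 'rV[R]_m -> R).

Lemma is_derive_real_comp U u (h : R -> R) dh x v :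
  open U -> Ck_on 1 U u -> U x -> is_derive (u x) (1 : R) h dh ->
  is_derive x v (h \o u) (dh * 'D_v u x).
Proof.
move=> oU su Ux [/derivable1_diffP dfh <-].
have dfu := Ck1_differentiable oU su Ux.
have dhu : differentiable (h \o u) x by exact: differentiable_comp.
apply: DeriveDef; first exact: diff_derivable.
rewrite (deriveE _ dhu) (deriveE _ dfu) diff_comp//= (deriveE _ dfh).
by rewrite -[X in 'd h _ X]mulr1 [LHS]linearZ/= mulrC.
Qed.

Lemma smooth_on_flat U u n : open U -> smooth_on U u ->
  smooth_on U (flat n \o u).
Proof.
move=> oU su k.
have cflat j x : U x -> {for x, continuous (flat j \o u)}.
  move=> Ux; apply: continuous_comp; first exact: smooth_on_continuous su Ux.
  by apply/differentiable_continuous/derivable1_diffP; case: (is_derive_flat j (u x)).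
have df j i x : U x -> is_derive x (delta_mx 0 i) (flat j \o u)
    ((flat j.+2 (u x) - j%:R * flat j.+1 (u x)) * 'D_(delta_mx 0 i) u x).
  move=> Ux; exact: (is_derive_real_comp _ oU (su 1%N) Ux (is_derive_flat _ _)).
elim: k n => [|k IH] n; (split; [exact: cflat|]); first by [].
move=> i; split; first by move=> x /(df n i)[].
apply: (@Ck_on_ext _ _ _ _ _ (fun x => ((flat n.+2 \o u) x +
    cst (- n%:R) x * (flat n.+1 \o u) x) * 'D_(delta_mx 0 i) u x)) => //.
  by move=> x /(df n i)[_ ->]; rewrite /cst /= mulNr.
apply: Ck_onM => //; last exact: (smooth_on_derive i su).
by apply: Ck_onD => //; apply: Ck_onM => //; exact: Ck_on_cst.
Qed.

(** The quotient a / (a + b) of two flat functions of the squared Euclidean distance s: a vanishes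
    for s >= r^2, b for s <= r^2 / 2, and never both. The function s is polynomial, whereas
    [|x - p|] is the maximum norm; as the latter is at most the Euclidean one, r <= [|x - p|]
    implies s >= r^2. *)
Lemma exists_bump (p : 'rV[R]_m) (r : R) : 0 < r ->
  exists chi : 'rV[R]_m -> R, [/\ smooth_on setT chi,
    \forall x \near p, chi x = 1 & forall x, r <= `|x - p| -> chi x = 0].
Proof.
move=> r0.
pose s (x : 'rV[R]_m) := \sum_i (x 0 i - p 0 i) * (x 0 i - p 0 i).
have ss : smooth_on setT s.
  apply: smooth_on_sum; first exact: openT.
  move=> i _.
  have sc : smooth_on setT (fun x : 'rV[R]_m => x 0 i + cst (- p 0 i) x).
    apply: smooth_onD; first exact: openT.
      exact: smooth_on_coord.
    exact: smooth_on_cst.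
  by apply: smooth_onM => //; exact: openT.
pose a x := flat 0 (r ^+ 2 + -1 * s x).
pose b x := flat 0 (s x + - (r ^+ 2 / 2)).
have sa : smooth_on setT a.
  apply: (@smooth_on_flat setT _ 0 openT); apply: (@smooth_onD _ _ _ setT (cst (r
    ^+ 2))).
  - exact: openT.
  - exact: smooth_on_cst.
  apply: (@smooth_onM _ _ setT (cst (-1))) => //; first exact: openT.
  exact: smooth_on_cst.
have sb : smooth_on setT b.
  apply: (@smooth_on_flat setT _ 0 openT).
  apply: (@smooth_onD _ _ _ setT s (cst (- (r ^+ 2 / 2)))) => //; first exact: openT.
  exact: smooth_on_cst.
have r20 : 0 < r ^+ 2 by rewrite exprn_gt0.
have ab0 x : 0 < a x + b x.
  have [h|h] := ltrP (s x) (r ^+ 2).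
    by rewrite ltr_pwDl ?flat_ge0// flat_gt0//; lra.
  by rewrite ltr_wpDl ?flat_ge0// flat_gt0//; lra.
exists (fun x => a x * (a x + b x)^-1); split.
- apply: smooth_onM => //; first exact: openT.
  apply: smooth_onV; first exact: openT.
    by move=> x _; rewrite gt_eqF.
  by apply: smooth_onD => //; exact: openT.
- have s0 : s p = 0 by rewrite /s big1// => i _; rewrite subrr mul0r.
  have cs : {for p, continuous s} by apply: smooth_on_continuous ss _.
  have : \forall x \near p, s x < r ^+ 2 / 2.
    have /cvgrPdist_lt/(_ (r ^+ 2 / 2)) := cs; rewrite s0 divr_gt0// => /(_ isT).
    by apply: filter_app; near=> x; rewrite sub0r normrN; exact/le_lt_trans/ler_norm.
  apply: filter_app; near=> x => sx.
  have -> : b x = 0 by apply: flat_le0; lra.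
  by rewrite addr0 divff// gt_eqF// flat_gt0//; lra.
- move=> x rx.
  have xp0 : mx_norm (x - p) != 0 by rewrite gt_eqF// (lt_le_trans r0).
  have [[z i] /=] := mx_norm_neq0 xp0; rewrite ord1 => xpi.
  have rs : r ^+ 2 <= s x.
    rewrite /s (bigD1 i)//=; apply: le_trans (_ : r ^+ 2 <= `|x - p| ^+ 2) _.
      by rewrite ler_sqr ?nnegrE ?normr_ge0// ltW.
    rewrite [`|x - p|]xpi real_normK ?num_real// !mxE expr2 lerDl.
    by apply: sumr_ge0 => j _; rewrite -expr2 sqr_ge0.
  by rewrite /a flat_le0 ?mul0r//; lra.
Unshelve. all: by end_near. Qed.

End Bump.



(** * Hadamard's lemma *)

Lemma lipschitz_is_continuous (R : realType) (V W : normedModType R)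
    (f : V -> W) C : 0 <= C ->
  (forall x y, `|f x - f y| <= C * `|x - y|) -> continuous f.
Proof.
move=> C0 Cf x.
apply/cvgrPdist_le => e e0; apply/nbhs_ballP.
exists (e / (C + 1)) => /=; first by rewrite divr_gt0// ltr_wpDl.
move=> y; rewrite -ball_normE/= ltr_pdivlMr ?ltr_wpDl// => xy.
apply: le_trans (Cf _ _) _; apply: le_trans (ltW xy).
by rewrite mulrC; apply: ler_wpM2l => //; rewrite lerDl.
Qed.

Lemma compact_closed_ball_rV (R : realType) m (p : 'rV[R]_m) (r : R) :
  compact [set x : 'rV[R]_m | `|x - p| <= r].
Proof.
apply: bounded_closed_compact.
  exists (`|r| + `|p|); split; first exact: num_real.
  move=> M rM x /= xr; apply/ltW; apply: le_lt_trans rM.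
  rewrite -[x](subrK p); apply: le_trans (ler_normD _ _) _.
  by apply: lerD => //; apply: le_trans xr (ler_norm _).
apply: (@closed_comp _ _ (fun x : 'rV[R]_m => `|x - p|) [set y | y <= r]).
  move=> x _; apply: (@continuous_comp _ _ _ (fun y : 'rV[R]_m => y - p) (fun y
    => `|y|)).
    by apply: continuousB; [exact: cvg_id|exact: cst_continuous].
  exact: norm_continuous.
exact: closed_le.
Qed.

Section Hadamard.
Context {R : realType} {m : nat}.
Variables (p : 'rV[R]_m) (r : R).
Implicit Types f g : 'rV[R]_m -> R.

(** Vanishing outside a fixed ball bounds every partial derivative on the whole space, so the
    estimates along rays are uniform. *)
Definition cutoff_smooth f :=
  smooth_on setT f /\ forall x, r < `|x - p| -> f x = 0.

Lemma cutoff_smooth_derive i f :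
  cutoff_smooth f -> cutoff_smooth (fun x => 'D_(delta_mx 0 i) f x).
Proof.
move=> [sf f0]; split; first exact: smooth_on_derive.
move=> x rx; rewrite -(derive_cst (0 : R) x (delta_mx 0 i)).
apply: near_eq_derive.
have cN : {for x, continuous (fun y : 'rV[R]_m => `|y - p|)}.
  apply: (@continuous_comp _ _ _ (fun y : 'rV[R]_m => y - p) (fun y => `|y|)).
    by apply: continuousB; [exact: cvg_id|exact: cst_continuous].
  exact: norm_continuous.
have /cvgrPdist_lt/(_ (`|x - p| - r)) := cN; rewrite subr_gt0 => /(_ rx).
apply: filter_app; near=> y => xy; apply: f0.
by have := ler_norm (`|x - p| - `|y - p|); lra.
Unshelve. all: by end_near. Qed.

Lemma cutoff_smooth_bounded f : cutoff_smooth f ->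
  exists2 C, 0 <= C & forall x, `|f x| <= C.
Proof.
move=> [sf f0].
have cK := @compact_closed_ball_rV R m p r.
have cf : {within [set x : 'rV[R]_m | `|x - p| <= r], continuous f}.
  apply: continuous_subspaceT => x; exact: smooth_on_continuous sf _.
have /compact_bounded[M [_ MK]] := continuous_compact cf cK.
exists (`|M| + 1) => [|x]; first by rewrite addr_ge0.
have [/f0->|xr] := ltrP r `|x - p|; first by rewrite normr0 addr_ge0.
apply: MK; last by exists x.
by rewrite (le_lt_trans (ler_norm M))// ltrDl.
Qed.

Lemma is_derive_affine (x v : 'rV[R]_m) t :
  is_derive t (1 : R) (fun s : R => x + s *: v) v.
Proof.
by have := @is_derive_line R 'rV[R]_m 'rV[R]_m id x v t v; apply.
Qed.

Lemma cutoff_smooth_lipschitz f : cutoff_smooth f ->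
  exists2 C, 0 <= C & forall x y, `|f x - f y| <= C * `|x - y|.
Proof.
move=> sf.
have [C C0 Cf] : exists2 C : 'I_m -> R, (forall i, 0 <= C i) &
    forall i x, `|'D_(delta_mx 0 i) f x| <= C i.
  have /choice[C CP] : forall i, exists C : R, 0 <= C /\ forall x,
      `|'D_(delta_mx 0 i) f x| <= C.
    by move=> i; have [C ? ?] := cutoff_smooth_bounded (cutoff_smooth_derive i
      sf); exists C.
  by exists C => i; have [] := CP i.
exists (\sum_i C i) => [|x y]; first exact: sumr_ge0.
have := @mean_value_bound R (fun t => f (y + t *: (x - y)))
  (fun t => \sum_i 'D_(delta_mx 0 i) f (y + t *: (x - y)) * (x - y) 0 i) 1
  ((\sum_i C i) * `|x - y|).
rewrite scale1r subrKC scale0r addr0 normr1 mulr1; apply => t _.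
  apply: (is_derive_curve (c := fun t : R => y + t *: (x - y)) openT (sf.1 1%N)) => //.
  exact: is_derive_affine.
rewrite mulr_suml; apply: le_trans (ler_norm_sum _ _ _) _.
apply: ler_sum => i _; rewrite normrM; apply: ler_pM => //.
exact: coord_le_norm.
Qed.

Local Notation mu := (@lebesgue_measure R).

(* Partial derivatives of ray integrals are ray integrals, with [a] increased by
   one (is_derive_ray_integral): hence they are smooth as soon as continuous. *)
Definition ray_integral (a : nat) f (x : 'rV[R]_m) : R :=
  \int[mu]_(t in `[0, 1]) (t ^+ a * f (p + t *: (x - p))).

Let contB (h k : R -> R) : continuous h -> continuous k ->
  continuous (fun t => h t - k t).
Proof. by move=> ch ck t; apply: (@continuousB _ _ _ h k); [exact: ch|exact: ck]. Qed.

Let contZ (c : R) (k : R -> R) : continuous k -> continuous (fun t => c * k t).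
Proof.
by move=> ck t; apply: (@continuousM _ _ (cst c) k); [exact: cst_continuous|exact: ck].
Qed.

Lemma integrable_unit_interval (h : R -> R) : continuous h ->
  mu.-integrable `[0, 1] (EFin \o h).
Proof.
move=> ch; apply: continuous_compact_integrable; first exact: segment_compact.
exact: continuous_subspaceT.
Qed.

Lemma integral_unit_interval_cst (C : R) : \int[mu]_(t in `[0, 1]) C = C.
Proof.
have mu01 : mu `[0%R, 1%R]%classic = 1%E.
  by rewrite lebesgue_measure_itv/= lte_fin ltr01 oppr0 adde0.
by rewrite Rintegral_cst// [X in fine X]mu01 mulr1.
Qed.

Lemma le_norm_integral_unit_interval (h : R -> R) (C : R) : continuous h ->
  (forall t, 0 <= t <= 1 -> `|h t| <= C) ->
  `|\int[mu]_(t in `[0, 1]) h t| <= C.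
Proof.
move=> ch hC.
have ih := integrable_unit_interval ch.
apply: (le_trans (le_normr_Rintegral _ ih)) => //.
apply: le_trans (_ : \int[mu]_(t in `[0, 1]) (cst C t) <= _); last first.
  by rewrite /cst integral_unit_interval_cst.
apply: le_Rintegral => //.
- apply: integrable_unit_interval => t; apply: continuous_comp; first exact: ch.
  exact: norm_continuous.
- by apply: integrable_unit_interval => t; exact: cst_continuous.
Qed.

Lemma continuous_ray_integrand a f x : smooth_on setT f ->
  continuous (fun t : R => t ^+ a * f (p + t *: (x - p))).
Proof.
move=> sf t.
apply: (@continuousM _ _ (fun t : R => t ^+ a) (fun t => f (p + t *: (x - p)))).
  exact: exprn_continuous.
apply: (@continuous_comp _ _ _ (fun t : R => p + t *: (x - p)) f).
  apply/differentiable_continuous/derivable1_diffP.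
  by case: (is_derive_affine p (x - p) t).
exact: smooth_on_continuous sf _.
Qed.

Lemma ray_integral_lipschitz a f : cutoff_smooth f ->
  exists2 C, 0 <= C & forall x y,
    `|ray_integral a f x - ray_integral a f y| <= C * `|x - y|.
Proof.
move=> sf; have [C C0 Cf] := cutoff_smooth_lipschitz sf.
exists C => // x y.
have cx z := @continuous_ray_integrand a f z sf.1.
rewrite -RintegralB//; try exact: integrable_unit_interval.
apply: le_norm_integral_unit_interval => [|t /andP[t0 t1]].
  by apply: contB; exact: cx.
rewrite -mulrBr normrM; apply: le_trans (_ : `|f (p + t *: (x - p)) - f (p + t *:
  (y - p))| <= _).
  by rewrite ler_piMl// ger0_norm ?exprn_ge0// exprn_ile1.
apply: le_trans (Cf _ _) _; apply: ler_wpM2l => //.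
rewrite opprD addrACA subrr add0r -scalerBr opprB addrA subrK normrZ.
by rewrite ler_piMl// ger0_norm.
Qed.

(** The constant does not depend on [x]: this is what allows the bound to be integrated along a
    ray. *)
Lemma cutoff_smooth_second_order i f : cutoff_smooth f ->
  exists2 C, 0 <= C & forall x (s : R),
    `|f (x + s *: delta_mx 0 i) - f x - s * 'D_(delta_mx 0 i) f x| <= C * s ^+ 2.
Proof.
move=> sf.
have [C C0 Cf] := cutoff_smooth_lipschitz (cutoff_smooth_derive i sf).
exists C => // x s.
have := @mean_value_bound R
  (fun t => f (x + t *: delta_mx 0 i) - t * 'D_(delta_mx 0 i) f x)
  (fun t => 'D_(delta_mx 0 i) f (x + t *: delta_mx 0 i) - 'D_(delta_mx 0 i) f x)
    s (C * `|s|).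
rewrite scale0r addr0 mul0r subr0 -mulrA -normrM ger0_norm -?expr2 ?sqr_ge0//.
rewrite addrAC; apply => t ts.
  apply: is_deriveB; last first.
    by apply: is_derive_eq; rewrite /GRing.scale/= !(mulr0,mulr1,addr0,add0r).
  apply: is_derive_line; exact: (is_derive_Ck i (sf.1 1%N)).
apply: le_trans (Cf _ _) _; apply: ler_wpM2l => //.
rewrite addrAC subrr add0r normrZ; apply: le_trans ts.
rewrite ler_piMr//; apply: norm_le_coord => // j; rewrite mxE eqxx/=.
by case: eqP => _; rewrite ?normr1 ?normr0.
Qed.

(** Moving [x] by h moves the point of parameter t by t h. Integrating the uniform second-order
    bound over t replaces a dominated convergence argument, and the factor t explains [a.+1]. *)
Lemma is_derive_ray_integral a f i x : cutoff_smooth f ->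
  is_derive x (delta_mx 0 i) (ray_integral a f)
    (ray_integral a.+1 (fun x => 'D_(delta_mx 0 i) f x) x).
Proof.
move=> sf; have [C C0 Cf] := cutoff_smooth_second_order i sf.
apply: is_derive_of_line; apply: (@is_derive_quadratic_bound _ _ _ _ C) => h.
have sDf := cutoff_smooth_derive i sf.
have cx z b := @continuous_ray_integrand b f z sf.1.
have cDx z b := @continuous_ray_integrand b _ z sDf.1.
rewrite add0r scale0r addr0 -RintegralB//; try exact: integrable_unit_interval.
rewrite -RintegralZl//; last exact: integrable_unit_interval.
rewrite -RintegralB//; last 2 first.
- by apply: integrable_unit_interval; apply: contB; exact: cx.
- by apply: integrable_unit_interval; apply: contZ; exact: cDx.
apply: le_norm_integral_unit_interval => [|t /andP[t0 t1]].
  apply: contB; first by apply: contB; exact: cx.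
  by apply: contZ; exact: cDx.
have := Cf (p + t *: (x - p)) (t * h).
have -> : p + t *: (x - p) + (t * h) *: delta_mx 0 i = p + t *: (x + h *:
  delta_mx 0 i - p).
  by rewrite -scalerA -addrA -scalerDr addrAC.
set A := f _; set B := f _; set D := 'D_ _ _ _ => Cth.
have -> : t ^+ a * A - t ^+ a * B - h * (t ^+ a.+1 * D) =
    t ^+ a * (A - B - t * h * D) by rewrite exprS; ring.
rewrite normrM; apply: le_trans (_ : `|A - B - t * h * D| <= _).
  by rewrite ler_piMl// ger0_norm ?exprn_ge0// exprn_ile1.
apply: le_trans Cth _; apply: ler_wpM2l => //.
by rewrite exprMn ler_piMl ?sqr_ge0// exprn_ile1.
Qed.

Lemma continuous_ray_integral a f : cutoff_smooth f -> continuous (ray_integral a f).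
Proof.
move=> sf; have [C C0 Cf] := ray_integral_lipschitz a sf.
exact: lipschitz_is_continuous C0 Cf.
Qed.

Lemma Ck_on_ray_integral k a f : cutoff_smooth f -> Ck_on k setT (ray_integral a f).
Proof.
elim: k a f => [|k IH] a f sf;
  (split; [by move=> x _; exact: (@continuous_ray_integral a f sf)|]); first by [].
move=> i; split; first by move=> x _; case: (is_derive_ray_integral a i x sf).
rewrite (_ : (fun x => _) = ray_integral a.+1 (fun x => 'D_(delta_mx 0 i) f x)).
  by apply: IH; exact: cutoff_smooth_derive.
by apply/funext => x; case: (is_derive_ray_integral a i x sf).
Qed.

Lemma integral_unit_interval_sum (h : 'I_m -> R -> R) (s : seq 'I_m) :
  (forall i, continuous (h i)) ->
  continuous (fun t => \sum_(i <- s) h i t) /\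
  \int[mu]_(t in `[0, 1]) (\sum_(i <- s) h i t) =
    \sum_(i <- s) \int[mu]_(t in `[0, 1]) h i t.
Proof.
move=> ch; elim: s => [|i s [cs IH]].
  have -> : (fun t => \sum_(i <- [::]) h i t) = cst 0.
    by apply/funext => t; rewrite big_nil.
  split; first by move=> t; exact: cst_continuous.
  by rewrite big_nil integral_unit_interval_cst.
have -> : (fun t => \sum_(j <- i :: s) h j t) =
    (fun t => h i t + \sum_(j <- s) h j t).
  by apply/funext => t; rewrite big_cons.
split.
  by move=> t; apply: (@continuousD _ _ _ (h i)); [exact: ch|exact: cs].
by rewrite big_cons RintegralD ?IH//; exact: integrable_unit_interval.
Qed.

(** The coefficients are the averages of the partial derivatives over the segment from [p] to [x];
    the formula is the fundamental theorem of calculus on that segment. *)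
Lemma hadamard_cutoff f : cutoff_smooth f ->
  exists g : 'I_m -> 'rV[R]_m -> R, (forall i, smooth_on setT (g i)) /\
    (forall x, f x = f p + \sum_i (x 0 i - p 0 i) * g i x) /\
    forall i, g i p = 'D_(delta_mx 0 i) f p.
Proof.
move=> sf.
exists (fun i => ray_integral 0 (fun x => 'D_(delta_mx 0 i) f x)); split.
  by move=> i k; apply: Ck_on_ray_integral; exact: cutoff_smooth_derive.
split=> [x|i]; last first.
  rewrite /ray_integral -[RHS]integral_unit_interval_cst.
  by apply: eq_Rintegral => t _; rewrite expr0 mul1r subrr scaler0 addr0.
pose F t := f (p + t *: (x - p)).
pose F' t := \sum_i 'D_(delta_mx 0 i) f (p + t *: (x - p)) * (x - p) 0 i.
have dF t : is_derive t (1 : R) F (F' t).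
  apply: (is_derive_curve (c := fun t : R => p + t *: (x - p)) openT (sf.1 1%N)) => //.
  exact: is_derive_affine.
have cD i : continuous (fun t : R => t ^+ 0 * 'D_(delta_mx 0 i) f (p + t *: (x - p))).
  exact: (@continuous_ray_integrand 0 _ x (cutoff_smooth_derive i sf).1).
have cD' i : continuous (fun t : R => (x 0 i - p 0 i) *
   (t ^+ 0 * 'D_(delta_mx 0 i) f (p + t *: (x - p)))) by exact: contZ.
have F'E : F' = fun t => \sum_i (x 0 i - p 0 i) *
   (t ^+ 0 * 'D_(delta_mx 0 i) f (p + t *: (x - p))).
  by apply/funext => t; apply: eq_bigr => i _; rewrite expr0 mul1r mulrC !mxE.
have [cF' int_F'] := integral_unit_interval_sum (index_enum 'I_m) cD'.
rewrite -F'E in cF' int_F'.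
have cF : continuous F.
  by move=> t; apply/differentiable_continuous/derivable1_diffP; case: (dF t).
have FTC : \int[mu]_(t in `[0, 1]) F' t = F 1 - F 0.
  rewrite /Rintegral (@continuous_FTC2 _ F' F 0 1 ltr01)//.
  - exact: continuous_subspaceT.
  - split; [by move=> t _; case: (dF t)| |].
      exact/cvg_at_right_filter/cF.
    exact/cvg_at_left_filter/cF.
  - by move=> t _; rewrite derive1E; case: (dF t).
move: FTC; rewrite int_F' /F scale1r subrKC scale0r addr0 => /eqP.
rewrite eq_sym subr_eq => /eqP ->; rewrite addrC; congr (_ + _).
apply: eq_bigr => i _; rewrite RintegralZl//; exact: integrable_unit_interval.
Qed.

End Hadamard.



(** * Smooth functions and tangent vectors on a manifold *)

Lemma openI_preimage (T U : topologicalType) (f : T -> U) (O : set T) (V : set U) :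
  open O -> (forall x, O x -> {for x, continuous f}) -> open V ->
  open (O `&` f @^-1` V).
Proof.
move=> oO cf oV; rewrite openE => x [Ox Vfx].
have nO : \forall y \near x, O y by exact: open_nbhs_nbhs.
have nV : \forall y \near x, V (f y) by apply: (cf x Ox); exact: open_nbhs_nbhs.
by rewrite /interior; near=> y; split; near: y.
Unshelve. all: by end_near. Qed.

Lemma open_chart_image (R : realType) (M : topologicalType) n (c : chart R M n)
    (N : set M) : is_chart c -> open N -> open (cmap c @` (cdom c `&` N)).
Proof.
move=> [[oD oI] cK cc ci] oN.
suff -> : cmap c @` (cdom c `&` N) = (cmap c @` cdom c) `&` cinv c @^-1` N.
  exact: openI_preimage.
apply/seteqP; split=> [x [q [Dq Nq] <-]|x [[q Dq <-]]].
  by split; [exists q|rewrite /preimage /= cK].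
by rewrite /preimage /= cK// => Nq; exists q.
Qed.

Section SmoothFunctions.
Context {R : realType} {M : topologicalType} {n : nat}.
Variable A : set (chart R M n).
Hypothesis atlasA : is_atlas A.
Implicit Types (f g : M -> R) (p q : M) (a b : chart R M n).

Definition smooth_near a p f := exists V : set 'rV[R]_n,
  [/\ open V, V (cmap a p), V `<=` cmap a @` cdom a & smooth_on V (f \o cinv a)].

Definition smooth_at p f := forall a, A a -> cdom a p -> smooth_near a p f.

Lemma atlas_chart a : A a -> is_chart a.
Proof. by case: atlasA => + _ _; apply. Qed.

(** One chart suffices to test smoothness at a point, because the transition maps are smooth. *)
Lemma smooth_at_chart a p f :
  A a -> cdom a p -> smooth_near a p f -> smooth_at p f.
Proof.
move=> Aa Dp [V [oV Vp VI sf]] b Ab Dbp.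
have [_ _ /(_ b a Ab Aa) tr] := atlasA.
have [[oDa _] aK _ _] := atlas_chart Aa.
have [_ bK _ _] := atlas_chart Ab.
have oO := open_chart_image (atlas_chart Ab) oDa.
pose phi := cmap a \o cinv b.
have oW : open (cmap b @` (cdom b `&` cdom a) `&` phi @^-1` V).
  apply: (openI_preimage oO _ oV) => x Ox.
  exact: (@smooth_on_continuous _ _ _ _ phi x tr Ox).
exists (cmap b @` (cdom b `&` cdom a) `&` phi @^-1` V); split => //.
- by split; [exists p|rewrite /preimage/phi/= bK].
- by move=> x [[q [Dq _] <-]] _; exists q.
apply: (@smooth_on_ext _ _ _ _ ((f \o cinv a) \o phi)) => //.
  by move=> x [[q [Dq Daq] <-]] _; rewrite /phi/= bK// aK.
apply: (@smooth_on_comp _ _ _ _ V) => //; first by move=> x [].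
apply: smooth_on_sub tr; exact: subIsetl.
Qed.

Lemma smooth_funP f : smooth_fun A f <-> forall p, smooth_at p f.
Proof.
split=> [sf p a Aa Dp|sf a Aa].
  have [[_ oI] _ _ _] := atlas_chart Aa.
  by exists (cmap a @` cdom a); split => //; exact: sf.
apply: smooth_on_glue => x [p Dp <-].
by have [V [oV Vp VI sV]] := sf p a Aa Dp; exists V.
Qed.

Lemma smooth_at_cst p (c : R) : smooth_at p (cst c).
Proof.
move=> a Aa Dp; have [[_ oI] _ _ _] := atlas_chart Aa.
by exists (cmap a @` cdom a); split => //; exact: smooth_on_cst.
Qed.

Lemma smooth_near2 a p f g : smooth_near a p f -> smooth_near a p g ->
  exists V : set 'rV[R]_n, [/\ open V, V (cmap a p), V `<=` cmap a @` cdom a,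
    smooth_on V (f \o cinv a) & smooth_on V (g \o cinv a)].
Proof.
move=> [V [oV Vp VI sV]] [W [oW Wp WI sW]]; exists (V `&` W); split=> //.
- exact: openI.
- by move=> x [/VI].
- by apply: smooth_on_sub sV; exact: subIsetl.
- by apply: smooth_on_sub sW; exact: subIsetr.
Qed.

Lemma smooth_atD p f g :
  smooth_at p f -> smooth_at p g -> smooth_at p (fun q => f q + g q).
Proof.
move=> sf sg a Aa Dp.
have [V [oV Vp VI sVf sVg]] := smooth_near2 (sf a Aa Dp) (sg a Aa Dp).
by exists V; split=> //; exact: smooth_onD oV sVf sVg.
Qed.

Lemma smooth_atM p f g :
  smooth_at p f -> smooth_at p g -> smooth_at p (fun q => f q * g q).
Proof.
move=> sf sg a Aa Dp.
have [V [oV Vp VI sVf sVg]] := smooth_near2 (sf a Aa Dp) (sg a Aa Dp).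
by exists V; split=> //; exact: smooth_onM oV sVf sVg.
Qed.

Lemma smooth_at_eq p f g (N : set M) : open N -> N p ->
  (forall q, N q -> f q = g q) -> smooth_at p f -> smooth_at p g.
Proof.
move=> oN Np fg sf a Aa Dp; have [V [oV Vp VI sV]] := sf a Aa Dp.
have [_ aK _ _] := atlas_chart Aa.
have oI := open_chart_image (atlas_chart Aa) oN.
exists (V `&` cmap a @` (cdom a `&` N)); split.
- exact: openI.
- by split => //; exists p.
- by move=> x [/VI].
apply: (@smooth_on_ext _ _ _ _ (f \o cinv a)); first exact: openI.
  by move=> x [_ [q [Dq Nq] <-]] /=; rewrite fg// aK.
by apply: smooth_on_sub sV; exact: subIsetl.
Qed.

Lemma smooth_atV p f : f p != 0 -> smooth_at p f -> smooth_at p (fun q => (f q)^-1).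
Proof.
move=> fp sf a Aa Dp; have [V [oV Vp VI sV]] := sf a Aa Dp.
have [_ aK _ _] := atlas_chart Aa.
have o0 : open [set x : R | x != 0] by exact: open_neq.
have oW : open (V `&` (f \o cinv a) @^-1` [set x : R | x != 0]).
  by apply: (openI_preimage oV _ o0) => x Vx; exact: (smooth_on_continuous sV Vx).
exists (V `&` (f \o cinv a) @^-1` [set x : R | x != 0]); split => //.
- by split => //=; rewrite aK.
- by move=> x [/VI].
apply: (@smooth_onV _ _ _ (f \o cinv a)) => //; first by move=> x [].
by apply: smooth_on_sub sV; exact: subIsetl.
Qed.

Lemma smooth_at_comp_chart a p (h : 'rV[R]_n -> R) : A a -> cdom a p ->
  smooth_on setT h -> smooth_at p (h \o cmap a).
Proof.
move=> Aa Dp sh; apply: (smooth_at_chart Aa Dp).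
have [[_ oI] aK _ _] := atlas_chart Aa.
exists (cmap a @` cdom a); split => //.
apply: (@smooth_on_ext _ _ _ _ h) => //.
  by move=> x [q Dq <-] /=; rewrite aK.
exact: smooth_on_sub sh.
Qed.

Lemma smooth_cst (c : R) : smooth_fun A (cst c).
Proof. by apply/smooth_funP => p; exact: smooth_at_cst. Qed.

Lemma smoothD f g : smooth_fun A f -> smooth_fun A g ->
  smooth_fun A (fun q => f q + g q).
Proof.
by move=> /smooth_funP sf /smooth_funP sg; apply/smooth_funP => p; exact: smooth_atD.
Qed.

Lemma smoothM f g : smooth_fun A f -> smooth_fun A g ->
  smooth_fun A (fun q => f q * g q).
Proof.
by move=> /smooth_funP sf /smooth_funP sg; apply/smooth_funP => p; exact: smooth_atM.
Qed.

Lemma smooth_at_sum p (I : Type) (r : seq I) (P : pred I) (F : I -> M -> R) :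
  (forall i, P i -> smooth_at p (F i)) ->
  smooth_at p (fun q => \sum_(i <- r | P i) F i q).
Proof.
move=> sF; elim: r => [|i r IH].
  by under eq_fun do rewrite big_nil; exact: smooth_at_cst.
case Pi: (P i); last by under eq_fun do rewrite big_cons Pi.
by under eq_fun do rewrite big_cons Pi; apply: smooth_atD => //; exact: sF.
Qed.

Lemma smooth_at_prod p (I : Type) (r : seq I) (P : pred I) (F : I -> M -> R) :
  (forall i, P i -> smooth_at p (F i)) ->
  smooth_at p (fun q => \prod_(i <- r | P i) F i q).
Proof.
move=> sF; elim: r => [|i r IH].
  by under eq_fun do rewrite big_nil; exact: smooth_at_cst.
case Pi: (P i); last by under eq_fun do rewrite big_cons Pi.
by under eq_fun do rewrite big_cons Pi; apply: smooth_atM => //; exact: sF.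
Qed.

Lemma smooth_sum (I : Type) (r : seq I) (P : pred I) (F : I -> M -> R) :
  (forall i, P i -> smooth_fun A (F i)) ->
  smooth_fun A (fun q => \sum_(i <- r | P i) F i q).
Proof.
move=> sF; apply/smooth_funP => p; apply: smooth_at_sum => i Pi.
by have /smooth_funP := sF i Pi; apply.
Qed.

Section BumpFunctions.
Hypothesis hausM : hausdorff_space M.

(** The closed set [K] is the image of a compact ball, closed because the manifold is Hausdorff. It
    is part of the conclusion because extensions by zero are checked on two open sets, the chart
    domain and the complement of [K]. *)
Lemma exists_smooth_bump p (N : set M) : open N -> N p ->
  exists (chi : M -> R) (K : set M), [/\ smooth_fun A chi, closed K, K `<=` N,
    forall q, ~ K q -> chi q = 0 & \forall q \near p, chi q = 1].
Proof.
move=> oN Np; have [_ /(_ p)[a Aa Dp] _] := atlasA.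
have [[oD oI] aK ca ci] := atlas_chart Aa.
have oO := open_chart_image (atlas_chart Aa) oN.
have /nbhs_ballP[e /= e0 eO] : nbhs (cmap a p) (cmap a @` (cdom a `&` N)).
  by apply: open_nbhs_nbhs; split => //; exists p.
have e20 : 0 < e / 2 by rewrite divr_gt0.
have [B [sB B1 B0]] := exists_bump (cmap a p) e20.
pose C := [set x : 'rV[R]_n | `|x - cmap a p| <= e / 2].
have CO : C `<=` cmap a @` (cdom a `&` N).
  move=> x Cx; apply: eO; rewrite -ball_normE/= distrC.
  by apply: le_lt_trans Cx _; rewrite ltr_pdivrMr// ltr_pMr// ltr1n.
pose K := cinv a @` C.
have KN q : K q -> cdom a q /\ N q.
  by move=> [x /CO[q' [Dq' Nq'] <-]] <-; rewrite aK.
have cK : closed K.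
  apply: compact_closed => //; apply: continuous_compact; last exact:
    compact_closed_ball_rV.
  apply: continuous_in_subspaceT => x /set_mem /CO[q [Dq _] <-].
  by apply: ci; exists q.
(* Outside [cdom a] the values of [cmap a] are meaningless, so 0 is imposed there. *)
pose chi q := if `[< cdom a q >] then B (cmap a q) else 0.
have chi0 q : ~ K q -> chi q = 0.
  rewrite /chi; case: asboolP => // Dq NK; apply: B0.
  rewrite leNgt; apply/negP => /ltW Cq; apply: NK.
  by exists (cmap a q) => //; exact: aK.
exists chi, K; split => //.
- apply/smooth_funP => q; have [Dq|nDq] := pselect (cdom a q).
    apply: (@smooth_at_eq _ (B \o cmap a) _ (cdom a)) => //.
      by move=> x Dx; rewrite /chi asboolT.
    exact: smooth_at_comp_chart.
  apply: (@smooth_at_eq _ (cst 0) _ (~` K)).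
  + exact: closed_openC.
  + by move=> /KN[].
  + by move=> x /chi0.
  + exact: smooth_at_cst.
- by move=> q /KN[].
- have nD : \forall q \near p, cdom a q by exact: open_nbhs_nbhs.
  have nB : \forall q \near p, B (cmap a q) = 1 by have := ca p Dp _ B1.
  near=> q; rewrite /chi asboolT; last by near: q.
  by near: q.
Unshelve. all: by end_near. Qed.

End BumpFunctions.

(** * Derivations at a point and their coordinates *)

Section Tangent.
Hypothesis hausM : hausdorff_space M.
Variable p : M.
Implicit Types v : functional R M.

Lemma tangent_zero v : tangent A p v -> v (cst 0) = 0.
Proof.
move=> [lin _ _]; have s0 := smooth_cst 0.
have := lin 1 _ _ s0 s0; rewrite mul1r (_ : (fun x => _) = cst 0); last first.
  by apply/funext => x; rewrite /cst mulr0 addr0.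
by move=> /eqP; rewrite -subr_eq subrr eq_sym => /eqP.
Qed.

Lemma tangentD v f g : tangent A p v -> smooth_fun A f -> smooth_fun A g ->
  v (fun q => f q + g q) = v f + v g.
Proof.
move=> [lin _ _] sf sg; have := lin 1 _ _ sf sg; rewrite mul1r => <-.
by congr (v _); apply/funext => q; rewrite mul1r.
Qed.

Lemma tangentZ v (c : R) f : tangent A p v -> smooth_fun A f ->
  v (fun q => c * f q) = c * v f.
Proof.
move=> tv sf; have [lin _ _] := tv; have s0 := smooth_cst 0.
have := lin c _ _ sf s0; rewrite (tangent_zero tv) addr0 => <-.
by congr (v _); apply/funext => q; rewrite addr0.
Qed.

Lemma tangentM v f g : tangent A p v -> smooth_fun A f -> smooth_fun A g ->
  v (fun q => f q * g q) = f p * v g + g p * v f.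
Proof. by move=> [_ lei _]; exact: lei. Qed.

Lemma tangent_cst v (c : R) : tangent A p v -> v (cst c) = 0.
Proof.
move=> tv; have s1 := smooth_cst 1; have [_ lei _] := tv.
have := lei _ _ s1 s1; rewrite /cst mul1r mul1r.
move=> /eqP; rewrite -subr_eq subrr eq_sym => /eqP v1.
have := tangentZ c tv s1; rewrite /cst v1 mulr0 => <-; congr (v _).
by apply/funext => q; rewrite mulr1.
Qed.

Lemma tangent_sum v (I : Type) (r : seq I) (P : pred I) (F : I -> M -> R) :
  tangent A p v -> (forall i, P i -> smooth_fun A (F i)) ->
  v (fun q => \sum_(i <- r | P i) F i q) = \sum_(i <- r | P i) v (F i).
Proof.
move=> tv sF; elim: r => [|i r IH].
  under eq_fun do rewrite big_nil; rewrite big_nil; exact: tangent_cst.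
rewrite big_cons -IH; case Pi: (P i); under eq_fun do rewrite big_cons Pi; last by [].
by rewrite tangentD//; [exact: sF|exact: smooth_sum].
Qed.

(** For a bump chi supported where [f] and [g] agree, chi (f - g) vanishes identically, and the
    Leibniz rule at [p], where chi is 1 and f - g is 0, gives v (f - g) = 0. *)
Lemma tangent_local v f g : tangent A p v -> smooth_fun A f -> smooth_fun A g ->
  (\forall q \near p, f q = g q) -> v f = v g.
Proof.
move=> tv sf sg; rewrite /prop_near1 nbhsE => -[N [oN Np] Nfg].
have [chi [K [schi cK KN chi0 chi1]]] := exists_smooth_bump hausM oN Np.
have chip : chi p = 1 by exact: (nbhs_singleton chi1).
have sgf : smooth_fun A (fun q => -1 * g q + f q).
  by apply: smoothD => //; apply: smoothM => //; exact: smooth_cst.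
have := tangentM tv schi sgf.
rewrite (Nfg p Np) mulN1r addNr mul0r addr0 chip mul1r.
rewrite (_ : (fun q => _) = cst 0); last first.
  apply/funext => q; have [/KN/Nfg ->|/chi0 ->] := pselect (K q).
    by rewrite mulN1r addNr mulr0.
  by rewrite mul0r.
rewrite tangent_zero// tangentD//; last first.
  by apply: smoothM => //; exact: smooth_cst.
by rewrite tangentZ// mulN1r => /esym/eqP; rewrite addrC subr_eq0 => /eqP.
Qed.

Variable a : chart R M n.
Hypotheses (Aa : A a) (Dp : cdom a p).

Definition coord_vector (i : 'I_n) : functional R M := fun f =>
  if `[< smooth_fun A f >] then 'D_(delta_mx 0 i) (f \o cinv a) (cmap a p) else 0.

Lemma coord_vectorE i f : smooth_fun A f ->
  coord_vector i f = 'D_(delta_mx 0 i) (f \o cinv a) (cmap a p).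
Proof. by move=> sf; rewrite /coord_vector asboolT. Qed.

Lemma smooth_fun_derivable i f : smooth_fun A f ->
  derivable (f \o cinv a) (cmap a p) (delta_mx 0 i).
Proof. by move=> sf; apply: (smooth_on_derivable (U := cmap a @` cdom a));
  [exact: sf|exact: imageP]. Qed.

Lemma tangent_coord_vector i : tangent A p (coord_vector i).
Proof.
have [_ aK _ _] := atlas_chart Aa.
split=> [c f g sf sg|f g sf sg|f nsf]; last by rewrite /coord_vector asboolF.
- have df := @smooth_fun_derivable i f sf; have dg := @smooth_fun_derivable i g sg.
  rewrite !coord_vectorE//; last first.
    by apply: smoothD => //; apply: smoothM => //; exact: smooth_cst.
  have dcf := @derivableZ _ _ _ _ c _ _ df.
  by have := deriveD dcf dg; rewrite deriveZ//; exact.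
- have df := @smooth_fun_derivable i f sf; have dg := @smooth_fun_derivable i g sg.
  rewrite !coord_vectorE//; last exact: smoothM.
  by have := deriveM df dg; rewrite /= aK//; exact.
Qed.

(** A single bump turns the centred coordinates, and any smooth function read through the chart,
    into global functions to which derivations apply. *)
Lemma exists_global_coords (x0 := cmap a p) :
  exists xi : 'I_n -> M -> R, [/\ forall i, smooth_fun A (xi i),
    forall i, \forall q \near p, xi i q = cmap a q 0 i - x0 0 i &
    forall h : 'rV[R]_n -> R, smooth_on setT h ->
      exists2 H, smooth_fun A H & \forall q \near p, H q = h (cmap a q)].
Proof.
have [[oD oI] aK ca ci] := atlas_chart Aa.
have [chi [K [schi cK KD chi0 chi1]]] := exists_smooth_bump hausM oD Dp.
have ext (h : 'rV[R]_n -> R) : smooth_on setT h ->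
    smooth_fun A (fun q => chi q * h (cmap a q)).
  move=> sh; apply/smooth_funP => q; have [/KD Dq|nK] := pselect (K q).
    apply: smooth_atM; last exact: smooth_at_comp_chart.
    by move/smooth_funP : schi; apply.
  apply: (@smooth_at_eq _ (cst 0) _ (~` K)) => //.
  - exact: closed_openC.
  - by move=> x /chi0 ->; rewrite mul0r.
  - exact: smooth_at_cst.
have near_ext (h : 'rV[R]_n -> R) :
    \forall q \near p, chi q * h (cmap a q) = h (cmap a q).
  by apply: filterS chi1 => q ->; rewrite mul1r.
exists (fun i q => chi q * (cmap a q 0 i - x0 0 i)); split => [i|i|h sh].
- apply: (ext (fun x : 'rV[R]_n => x 0 i - x0 0 i)).
  apply: (@smooth_onD _ _ _ setT (fun x : 'rV[R]_n => x 0 i) (cst (- x0 0 i))).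
  + exact: openT.
  + exact: smooth_on_coord.
  + exact: smooth_on_cst.
- exact: (near_ext (fun x : 'rV[R]_n => x 0 i - x0 0 i)).
- by exists (fun q => chi q * h (cmap a q)); [exact: ext|exact: near_ext].
Qed.

(** The opposite transfer: a function on the manifold becomes one on the whole Euclidean space, cut
    off as Hadamard's lemma demands. *)
Lemma exists_euclidean_representative f : smooth_fun A f ->
  exists (F : 'rV[R]_n -> R) (r : R), [/\ smooth_on setT F,
    forall x, r < `|x - cmap a p| -> F x = 0 &
    \forall x \near cmap a p, F x = f (cinv a x)].
Proof.
move=> sf; have [[oD oI] aK ca ci] := atlas_chart Aa.
have /nbhs_ballP[e /= e0 eI] : nbhs (cmap a p) (cmap a @` cdom a).
  by apply: open_nbhs_nbhs; split => //; exact: imageP.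
have e20 : 0 < e / 2 by rewrite divr_gt0.
have [B [sB B1 B0]] := exists_bump (cmap a p) e20.
exists (fun x => B x * f (cinv a x)), (e / 2); split.
(* Two open sets cover the space: the image of the chart, which contains the ball of radius e, and
   the complement of the closed ball of radius e / 2, where the product is 0. *)
- apply: smooth_on_glue => x _.
  have [xe|ex] := ltrP `|x - cmap a p| e.
    exists (cmap a @` cdom a).
      by apply: eI; rewrite -ball_normE/= distrC.
    apply: smooth_onM => //; last exact: (sf a Aa).
    exact: smooth_on_sub sB.
  pose V := ~` [set y : 'rV[R]_n | `|y - cmap a p| <= e / 2].
  have oV : open V.
    apply: closed_openC; apply: compact_closed; last exact: compact_closed_ball_rV.
    exact: norm_hausdorff.
  exists V.
    rewrite /V /= => /(le_trans ex); rewrite ler_pdivlMr// ger_pMr//.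
    by rewrite leNgt ltr1n.
  apply: (@smooth_on_ext _ _ _ _ (cst 0)) => //; last exact: smooth_on_cst.
  move=> y /negP; rewrite -ltNge => /ltW/B0 ->.
  by rewrite mul0r.
- by move=> x /ltW/B0 ->; rewrite mul0r.
- by apply: filterS B1 => x ->; rewrite mul1r.
Qed.

(* Hadamard's lemma writes f - f p near p as a sum of products of functions
   vanishing at p with smooth functions, so a derivation only sees the partial
   derivatives. *)
Lemma tangent_coords : exists xi : 'I_n -> M -> R,
  [/\ forall i, smooth_fun A (xi i),
      forall i j, coord_vector i (xi j) = (i == j)%:R &
      forall v, tangent A p v -> v = \sum_i v (xi i) *: coord_vector i].
Proof.
have [[oD oI] aK ca ci] := atlas_chart Aa.
have [xi [sxi nxi ext]] := exists_global_coords.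
have nI : \forall x \near cmap a p, (cmap a @` cdom a) x.
  by apply: open_nbhs_nbhs; split => //; exact: imageP.
exists xi; split => // [i j|v tv].
  rewrite coord_vectorE//.
  have nx : \forall x \near cmap a p, (xi j \o cinv a) x = (fun x : 'rV[R]_n => x
    0 j - cmap a p 0 j) x.
    have ip : (cmap a @` cdom a) (cmap a p) by exact: imageP.
    have := ci _ ip; rewrite /prop_for /continuous_at aK// => /(_ _ (nxi j)) nn.
    near=> x; have [q Dq qx] : (cmap a @` cdom a) x by near: x.
    have : xi j (cinv a x) = cmap a (cinv a x) 0 j - cmap a p 0 j by near: x.
    by rewrite /= -qx aK.
  rewrite (near_eq_derive _ nx).
  have dc := is_derive_coord (cmap a p) (delta_mx 0 i) j.
  have := is_deriveB dc (is_derive_cst (cmap a p 0 j) (cmap a p) (delta_mx 0 i)).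
  by rewrite subr0 mxE eqxx/= eq_sym; case.
apply/funext => f; rewrite fct_sumE.
have [sf|nsf] := pselect (smooth_fun A f); last first.
  rewrite big1; last by move=> i _; rewrite -[LHS]/(_ * coord_vector i f)
    /coord_vector asboolF// mulr0.
  by case: tv => _ _; apply.
have [F [r [sF F0 nF]]] := exists_euclidean_representative sf.
have [g [sg [Fg gp]]] := hadamard_cutoff (conj sF F0).
have /choice[G GP] i : exists H, smooth_fun A H /\ \forall q \near p, H q = g i
  (cmap a q).
  by have [H] := ext _ (sg i); exists H.
have fE : \forall q \near p, f q = cst (f p) q + \sum_i xi i q * G i q.
  have := ca p Dp _ nF => nFq.
  have nD : \forall q \near p, cdom a q by exact: open_nbhs_nbhs.
  have nxiG : \forall q \near p, forall i, xi i q = cmap a q 0 i - cmap a p 0 i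
    /\ G i q = g i (cmap a q).
    by apply: filter_forall => i; near=> q; split; near: q; [exact: nxi|case: (GP i)].
  near=> q; have Dq : cdom a q by near: q.
  have : F (cmap a q) = f (cinv a (cmap a q)) by near: q.
  rewrite aK// => <-; rewrite Fg (nbhs_singleton nF) aK//; congr (_ + _).
  apply: eq_bigr => i _.
  have : forall i, xi i q = cmap a q 0 i - cmap a p 0 i /\ G i q = g i (cmap a q)
    by near: q.
  by move=> /(_ i)[-> ->].
have sGi i : smooth_fun A (G i) by case: (GP i).
have sxG i : smooth_fun A (fun q => xi i q * G i q) by exact: smoothM.
have ssum : smooth_fun A (fun q => \sum_i xi i q * G i q) by exact: smooth_sum.
rewrite (tangent_local tv sf _ fE); last by apply: smoothD => //; exact: smooth_cst.
rewrite tangentD//; last exact: smooth_cst.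
rewrite tangent_cst// add0r tangent_sum//; apply: eq_bigr => i _.
rewrite tangentM// (nbhs_singleton (nxi i)) subrr mul0r add0r.
have [_ /nbhs_singleton ->] := GP i.
rewrite gp (near_eq_derive _ nF) -coord_vectorE//.
by rewrite mulrC.
Unshelve. all: by end_near. Qed.

End Tangent.
End SmoothFunctions.



(** * Left-invariant frames of a Lie group *)

Lemma smooth_on_affine (R : realType) m n (U : set 'rV[R]_m)
    (phi : 'rV[R]_m -> 'rV[R]_n) (d : 'I_m -> 'rV[R]_n) :
  continuous phi ->
  (forall x i (h : R), phi (x + h *: delta_mx 0 i) = phi x + h *: d i) ->
  smooth_on U phi.
Proof.
move=> cphi phid.
have dphi x i : is_derive x (delta_mx 0 i) phi (d i).
  apply: is_derive_of_line.
  rewrite (_ : (fun s : R => _) = fun s : R => phi x + s *: d i).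
    exact: is_derive_affine.
  by apply/funext => s.
case=> [|k]; (split; [by move=> x _; exact: cphi|]); first by [].
move=> i; split; first by move=> x _; case: (dphi x i).
rewrite (_ : (fun x => _) = cst (d i)); first exact: Ck_on_cst.
by apply/funext => x; case: (dphi x i).
Qed.

Section RowSlices.
Context {R : realType} {m n : nat}.

Lemma norm_row_mx (u : 'rV[R]_m) (w : 'rV[R]_n) : `|row_mx u w| <= `|u| + `|w|.
Proof.
apply: norm_le_coord; first by rewrite addr_ge0.
move=> i; case: (split_ordP i) => j ->; rewrite ?row_mxEl ?row_mxEr.
  by apply: le_trans (coord_le_norm u j) _; rewrite lerDl.
by apply: le_trans (coord_le_norm w j) _; rewrite lerDr.
Qed.

Lemma continuous_row_mxl (w : 'rV[R]_n) :
  continuous (fun u : 'rV[R]_m => row_mx u w).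
Proof.
apply: (@lipschitz_is_continuous _ _ _ _ 1) => // x y.
by rewrite opp_row_mx add_row_mx subrr (le_trans (norm_row_mx _ _))// normr0
  addr0 mul1r.
Qed.

Lemma continuous_row_mxr (u : 'rV[R]_m) :
  continuous (fun w : 'rV[R]_n => row_mx u w).
Proof.
apply: (@lipschitz_is_continuous _ _ _ _ 1) => // x y.
by rewrite opp_row_mx add_row_mx subrr (le_trans (norm_row_mx _ _))// normr0
  add0r mul1r.
Qed.

Lemma continuous_lsubmx_rV : continuous (fun w : 'rV[R]_(m + n) => lsubmx w).
Proof.
apply: (@lipschitz_is_continuous _ _ _ _ 1) => // x y.
rewrite mul1r -linearB; apply: norm_le_coord => // i.
by rewrite mxE; exact: coord_le_norm.
Qed.

Lemma continuous_rsubmx_rV : continuous (fun w : 'rV[R]_(m + n) => rsubmx w).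
Proof.
apply: (@lipschitz_is_continuous _ _ _ _ 1) => // x y.
rewrite mul1r -linearB; apply: norm_le_coord => // i.
by rewrite mxE; exact: coord_le_norm.
Qed.

Lemma row_mx_delta_r (i : 'I_n) :
  row_mx 0 (delta_mx 0 i) = delta_mx 0 (rshift m i) :> 'rV[R]_(m + n).
Proof.
apply/rowP => k; case: (split_ordP k) => j ->; rewrite ?row_mxEl ?row_mxEr !mxE/=.
  by rewrite eq_lrshift.
by rewrite eq_rshift.
Qed.

Lemma smooth_row_mxl U (w : 'rV[R]_n) :
  smooth_on U (fun u : 'rV[R]_m => row_mx u w).
Proof.
apply: (@smooth_on_affine _ _ _ _ _ (fun i => row_mx (delta_mx 0 i) 0)).
  exact: continuous_row_mxl.
by move=> x i h; rewrite scale_row_mx add_row_mx scaler0 addr0.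
Qed.

Lemma smooth_row_mxr U (u : 'rV[R]_m) :
  smooth_on U (fun w : 'rV[R]_n => row_mx u w).
Proof.
apply: (@smooth_on_affine _ _ _ _ _ (fun i => row_mx 0 (delta_mx 0 i))).
  exact: continuous_row_mxr.
by move=> x i h; rewrite scale_row_mx add_row_mx scaler0 addr0.
Qed.

Lemma derive_slice_r (F : 'rV[R]_(m + n) -> R) u w i :
  'D_(delta_mx 0 (rshift m i)) F (row_mx u w) =
  'D_(delta_mx 0 i) (fun y => F (row_mx u y)) w.
Proof.
have E : (fun h : R => h^-1 *: ((F \o shift (row_mx u w))
      (h *: delta_mx 0 (rshift m i)) - F (row_mx u w))) =
    (fun h : R => h^-1 *: (((fun y => F (row_mx u y)) \o shift w)
      (h *: delta_mx 0 i) - F (row_mx u w))).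
  apply/funext => h /=.
  by rewrite -row_mx_delta_r scale_row_mx add_row_mx scaler0 add0r.
by rewrite /derive E.
Qed.

End RowSlices.

Section LieGroup.
Context {R : realType} {G : groupTopologicalType} {n : nat}.
Variable A : set (chart R G n).
Hypothesis lieA : is_lie_group A.
Implicit Types (f : G -> R) (g h p q k : G) (a b c : chart R G n).

Lemma lie_atlas : is_atlas A. Proof. by case: lieA => -[]. Qed.
Lemma lie_hausdorff : hausdorff_space G. Proof. by case: lieA => -[]. Qed.

(** The joint local expression of f(xy) in a product chart. Freezing the first factor gives
    smoothness of translates; differentiating in the second and then freezing it gives smoothness of
    left-invariant fields. *)
Lemma smooth_mul_charts f a b g h : smooth_fun A f ->
  A a -> A b -> cdom a g -> cdom b h ->
  exists O : set 'rV[R]_(n + n), [/\ open O, O (row_mx (cmap a g) (cmap b h)),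
    forall w, O w -> (cmap a @` cdom a) (lsubmx w) /\ (cmap b @` cdom b) (rsubmx w) &
    smooth_on O (fun w => f (cinv a (lsubmx w) * cinv b (rsubmx w))%g)].
Proof.
move=> sf Aa Ab Dg Dh.
have [_ [cmul smul] _] := lieA.
have [_ /(_ (g * h)%g)[c Ac Dc] _] := lie_atlas.
have [[oDa oIa] aK ca cia] := atlas_chart lie_atlas Aa.
have [[oDb oIb] bK cb cib] := atlas_chart lie_atlas Ab.
have [[oDc oIc] cK cc cic] := atlas_chart lie_atlas Ac.
pose psi (w : 'rV[R]_(n + n)) := (cinv a (lsubmx w) * cinv b (rsubmx w))%g.
pose Q := [set w : 'rV[R]_(n + n) |
  (cmap a @` cdom a) (lsubmx w) /\ (cmap b @` cdom b) (rsubmx w)].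
have oQ : open Q.
  have -> : Q = (@lsubmx R 1 n n @^-1` (cmap a @` cdom a)) `&`
                (@rsubmx R 1 n n @^-1` (cmap b @` cdom b)) by [].
  apply: openI.
    by apply: open_comp => // w _; exact: continuous_lsubmx_rV.
  by apply: open_comp => // w _; exact: continuous_rsubmx_rV.
have cpsi w : Q w -> {for w, continuous psi}.
  move=> [Il Ir].
  have ha : {for w, continuous (cinv a \o @lsubmx R 1 n n)}.
    by apply: continuous_comp; [exact: continuous_lsubmx_rV|exact: cia].
  have hb : {for w, continuous (cinv b \o @rsubmx R 1 n n)}.
    by apply: continuous_comp; [exact: continuous_rsubmx_rV|exact: cib].
  apply: (@continuous_comp _ _ _ (fun w => (cinv a (lsubmx w), cinv b (rsubmx w)))
    (fun x : G * G => (x.1 * x.2)%g)); last exact: cmul.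
  exact: (cvg_pair ha hb).
pose O := Q `&` psi @^-1` cdom c.
have oO : open O by exact: openI_preimage.
exists O; split => //.
- split; first by split; rewrite ?row_mxKl ?row_mxKr; exact: imageP.
  by rewrite /preimage /psi /= row_mxKl row_mxKr aK// bK.
- by move=> w [].
apply: (@smooth_on_ext _ _ _ _ ((f \o cinv c) \o (cmap c \o psi))) => //.
  by move=> w [_ Dw] /=; rewrite cK.
apply: (@smooth_on_comp _ _ _ _ (cmap c @` cdom c)) => //.
- by move=> w [_ Dw]; exact: imageP.
- exact: sf.
have sm := smul (prod_chart a b) c (ex_intro _ a (ex_intro _ b (And3 Aa Ab erefl))) Ac.
apply: smooth_on_sub sm => w [[[x Dx xw] [y Dy yw]] Dw].
exists (x, y); last by rewrite /= xw yw hsubmxK.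
by split => //; move: Dw; rewrite /preimage /psi /= -xw -yw aK// bK.
Qed.

Lemma smooth_left_translate f g : smooth_fun A f ->
  smooth_fun A (fun x => f (g * x)%g).
Proof.
move=> sf; apply/(smooth_funP lie_atlas) => h.
have [_ /(_ g)[a Aa Dg] _] := lie_atlas.
have [_ /(_ h)[b Ab Dh] _] := lie_atlas.
have [W [oW Wgh WI sW]] := smooth_mul_charts sf Aa Ab Dg Dh.
have [_ aK _ _] := atlas_chart lie_atlas Aa.
apply: (smooth_at_chart lie_atlas Ab Dh).
pose V := (fun w : 'rV[R]_n => row_mx (cmap a g) w) @^-1` W.
have oV : open V.
  by apply: open_comp => // w _; exact: continuous_row_mxr.
exists V; split => //.
- by move=> w /WI[_]; rewrite row_mxKr.
apply: (@smooth_on_ext _ _ _ _ ((fun w : 'rV[R]_(n + n) =>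
   f (cinv a (lsubmx w) * cinv b (rsubmx w))%g) \o row_mx (cmap a g))) => //.
  by move=> w _ /=; rewrite row_mxKl row_mxKr aK.
apply: (@smooth_on_comp _ _ _ _ W) => //.
exact: smooth_row_mxr.
Qed.

(** The derivative is a partial derivative of the joint expression in the second block of variables,
    hence jointly smooth before the second variable is fixed at [h]. *)
Lemma smooth_left_derivative f b h i : smooth_fun A f -> A b -> cdom b h ->
  smooth_fun A (fun g => 'D_(delta_mx 0 i)
    ((fun x => f (g * x)%g) \o cinv b) (cmap b h)).
Proof.
move=> sf Ab Dh; apply/(smooth_funP lie_atlas) => g.
have [_ /(_ g)[a Aa Dg] _] := lie_atlas.
have [W [oW Wgh WI sW]] := smooth_mul_charts sf Aa Ab Dg Dh.
have [_ aK _ _] := atlas_chart lie_atlas Aa.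
apply: (smooth_at_chart lie_atlas Aa Dg).
pose V := (fun w : 'rV[R]_n => row_mx w (cmap b h)) @^-1` W.
have oV : open V.
  by apply: open_comp => // w _; exact: continuous_row_mxl.
exists V; split => //.
- by move=> w /WI[+ _]; rewrite row_mxKl.
apply: (@smooth_on_ext _ _ _ _ ((fun w : 'rV[R]_(n + n) =>
   'D_(delta_mx 0 (rshift n i)) (fun w => f (cinv a (lsubmx w) * cinv b (rsubmx
     w))%g) w)
    \o (fun u => row_mx u (cmap b h)))) => //.
  move=> w _; rewrite /comp derive_slice_r.
  by under eq_fun do rewrite row_mxKl row_mxKr.
apply: (@smooth_on_comp _ _ _ _ W) => //.
  exact: smooth_on_derive.
exact: smooth_row_mxl.
Qed.

Lemma smooth_left_translateP f g :
  smooth_fun A (fun x => f (g * x)%g) -> smooth_fun A f.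
Proof.
move=> /(smooth_left_translate g^-1)%g; congr smooth_fun.
by apply/funext => x; rewrite mulVKg.
Qed.

Lemma tangent_dleft k h (v : functional R G) :
  tangent A h v -> tangent A (k * h)%g (dleft k v).
Proof.
move=> [lin lei ns]; split=> [c f g sf sg|f g sf sg|f nsf].
- by rewrite /dleft lin//; exact: smooth_left_translate.
- by rewrite /dleft lei//; exact: smooth_left_translate.
- by rewrite /dleft ns// => /smooth_left_translateP.
Qed.

Lemma dleftVK k (v : functional R G) : dleft k (dleft k^-1%g v) = v.
Proof.
apply/funext => f; rewrite /dleft; congr (v _).
by apply/funext => x; rewrite mulVKg.
Qed.

Lemma smooth_continuous f : smooth_fun A f -> continuous f.
Proof.
move=> sf p; have [_ /(_ p)[a Aa Dp] _] := lie_atlas.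
have [[oD oI] aK ca cia] := atlas_chart lie_atlas Aa.
have cf : {for cmap a p, continuous (f \o cinv a)}.
  apply: (smooth_on_continuous (U := cmap a @` cdom a)); first exact: sf.
  exact: imageP.
apply: (@near_eq_continuous_at _ _ ((f \o cinv a) \o cmap a)).
  near=> q; rewrite /= aK//; near: q; exact: open_nbhs_nbhs.
by apply: continuous_comp; [exact: ca|exact: cf].
Unshelve. all: by end_near. Qed.

(* [co i g v] is the [i]-th coordinate of a tangent vector [v] at [g] in the
   left-invariant frame [E]. *)
Definition left_frame (E : 'I_n -> prefield R G) (co : 'I_n -> G -> functional R
  G -> R) :=
  [/\ forall i, lie_algebra A (E i),
      forall i j g, co i g (E j g) = (i == j)%:R,
      forall i g (c : R) u v, co i g (c *: u + v) = c * co i g u + co i g v,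
      forall g v, tangent A g v -> v = \sum_i co i g v *: E i g &
      (forall X i, vfield A X -> smooth_fun A (fun g => co i g (X g))) /\
      forall i k g v, co i (k * g)%g (dleft k v) = co i g v].

Lemma smooth_det m (F : 'I_m -> 'I_m -> G -> R) :
  (forall i j, smooth_fun A (F i j)) ->
  smooth_fun A (fun g => \det (\matrix_(i, j) F i j g)).
Proof.
move=> sF; apply/(smooth_funP lie_atlas) => p.
rewrite /determinant; apply: (smooth_at_sum lie_atlas) => s _.
apply: smooth_atM; first exact: (smooth_at_cst lie_atlas).
apply: (smooth_at_prod lie_atlas) => i _; under eq_fun do rewrite mxE.
by have /(smooth_funP lie_atlas) := sF i (perm.fun_of_perm s i); apply.
Qed.

Lemma smooth_cofactor m (F : 'I_m -> 'I_m -> G -> R) i j :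
  (forall i j, smooth_fun A (F i j)) ->
  smooth_fun A (fun g => cofactor (\matrix_(i, j) F i j g) i j).
Proof.
move=> sF; rewrite /cofactor.
apply: (smoothM lie_atlas); first exact: (smooth_cst lie_atlas).
rewrite (_ : (fun g => _) = fun g => \det (\matrix_(k, l) F (lift i k) (lift j l) g)).
  by apply: smooth_det => k l; exact: sF.
by apply/funext => g; congr (\det _); apply/matrixP => k l; rewrite !mxE.
Qed.

(** The frame consists of the left translates of the coordinate derivations at 1, and [co] evaluates
    a vector on translated coordinate functions. In [co i g (X g)] the test function itself varies
    with [g], so smoothness does not follow from that of [X]; near [p] the test functions are
    therefore frozen. *)
Lemma exists_left_frame : exists E co, left_frame E co.
Proof.
have [_ /(_ 1%g)[b Ab D1] _] := lie_atlas.
have [xi [sxi xiE xiv]] := tangent_coords lie_atlas lie_hausdorff Ab D1.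
pose e := coord_vector A 1%g b.
have te i : tangent A 1%g (e i) by exact: (tangent_coord_vector lie_atlas).
pose E i : prefield R G := fun g => dleft g (e i).
pose co i g (v : functional R G) := v (fun x => xi i (g^-1 * x)%g).
have tE i g : tangent A g (E i g).
  by have := tangent_dleft g (te i); rewrite mulg1.
have sE i f : smooth_fun A f -> smooth_fun A (fun g => E i g f).
  move=> sf; rewrite (_ : (fun g => _) = (fun g => 'D_(delta_mx 0 i)
    ((fun x => f (g * x)%g) \o cinv b) (cmap b 1%g))).
    exact: smooth_left_derivative.
  apply/funext => g; rewrite /E /dleft /e coord_vectorE//.
  exact: smooth_left_translate.
have coE i j g : co i g (E j g) = (i == j)%:R.
  rewrite /co /E /dleft eq_sym -(xiE j i); congr (e j _).
  by apply/funext => x; rewrite mulKg.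
have vE g v : tangent A g v -> v = \sum_i co i g v *: E i g.
  move=> tv; have := tangent_dleft g^-1%g tv; rewrite mulVg => /xiv.
  move=> /(congr1 (dleft g)); rewrite dleftVK => {1}->.
  by apply/funext => f; rewrite /dleft !fct_sumE.
exists E, co; split => //.
- move=> i; split; first by split => [g|f]; [exact: tE|exact: sE].
  move=> k h; apply/funext => f; rewrite /E /dleft; congr (e i _).
  by apply/funext => x; rewrite mulgA.
split; last first.
  move=> i k g v; rewrite /co /dleft; congr (v _).
  by apply/funext => x; rewrite invgM -mulgA mulKg.
move=> X i vX; apply/(smooth_funP lie_atlas) => p.
(* Near p the coordinates of X are given by Cramer's rule in terms of the smooth
   functions X (f k) and F j k, the matrix F being the identity at p. *)
pose f j x := xi j (p^-1 * x)%g.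
have sf j : smooth_fun A (f j) by exact: smooth_left_translate.
pose F j l g := E j g (f l).
have sF j l : smooth_fun A (F j l) by exact: sE.
pose D g := \det (\matrix_(j, l) F j l g).
have sD : smooth_fun A D by exact: smooth_det.
have Dp : D p = 1.
  rewrite /D -(det1 R n); congr (\det _); apply/matrixP => j l.
  by rewrite !mxE /F -[f l]/(fun x => xi l (p^-1 * x)%g) -[LHS]/(co l p (E j p))
    coE eq_sym.
have oN : open [set g | D g != 0].
  have -> : [set g | D g != 0] = D @^-1` [set x : R | x != 0] by [].
  by apply: open_comp => [g _|]; [exact: (smooth_continuous sD)|exact: open_neq].
have sat u : smooth_fun A u -> smooth_at A p u.
  by move=> /(smooth_funP lie_atlas); apply.
pose N l g := X g (f l) * cofactor (\matrix_(j, l) F j l g) i l.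
have sN l : smooth_fun A (N l).
  by apply: (smoothM lie_atlas); [case: vX => _; apply|exact: smooth_cofactor].
apply: (@smooth_at_eq _ _ _ _ lie_atlas _ (fun g => (D g)^-1 * \sum_l N l g) _
  [set g | D g != 0]) => //.
- by rewrite /= Dp oner_neq0.
- move=> g /= Dg; apply: (canLR (mulKf Dg)).
  pose M := \matrix_(j, l) F j l g.
  pose x : 'rV[R]_n := \row_j co j g (X g).
  have xM l : (x *m M) 0 l = X g (f l).
    have tX : tangent A g (X g) by case: vX.
    rewrite (vE g _ tX) fct_sumE.
    by rewrite !mxE; apply: eq_bigr => j _; rewrite !mxE.
  have -> : \sum_l N l g = (x *m M *m \adj M) 0 i.
    by rewrite mxE; apply: eq_bigr => l _; rewrite /N -xM [(\adj M) _ _]mxE.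
  by rewrite -mulmxA mul_mx_adj mul_mx_scalar !mxE.
apply: smooth_atM.
  by apply: (smooth_atV lie_atlas); [rewrite Dp oner_neq0|exact: sat].
by apply: (smooth_at_sum lie_atlas) => l _; apply: sat; exact: sN.
Qed.

End LieGroup.



(** * Brackets of vector fields *)

Section VectorFields.
Context {R : realType} {M : topologicalType} {n : nat}.
Variable A : set (chart R M n).
Hypothesis atlasA : is_atlas A.
Implicit Types (X Y Z : prefield R M) (f g : M -> R) (p : M).

Lemma tangent_scale_add p (c : R) u v :
  tangent A p u -> tangent A p v -> tangent A p (c *: u + v).
Proof.
move=> [lu mu nu] [lv mv nv]; split=> [b f g sf sg|f g sf sg|f nsf].
- rewrite -[LHS]/(c * u _ + v _) -[RHS]/(b * (c * u f + v f) + (c * u g + v g)).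
  by rewrite lu// lv//; ring.
- rewrite -[LHS]/(c * u _ + v _) -[RHS]/(f p * (c * u g + v g) + g p * (c * u f + v f)).
  by rewrite mu// mv//; ring.
- by rewrite -[LHS]/(c * u f + v f) nu// nv// mulr0 addr0.
Qed.

Lemma tangent0 p : tangent A p 0.
Proof.
split=> [b f g sf sg|f g sf sg|//]; rewrite -[(0 : functional R M) _]/(0 : R);
by rewrite !mulr0 addr0.
Qed.

Lemma tangent_comb p (I : Type) (r : seq I) (c : I -> R) (u : I -> functional R M) :
  (forall i, tangent A p (u i)) -> tangent A p (\sum_(i <- r) c i *: u i).
Proof.
move=> tu; elim: r => [|i r IH]; first by rewrite big_nil; exact: tangent0.
by rewrite big_cons; exact: tangent_scale_add.
Qed.

Lemma tangentB p v f g : tangent A p v -> smooth_fun A f -> smooth_fun A g ->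
  v (fun q => f q - g q) = v f - v g.
Proof.
move=> [lin _ _] sf sg; have := lin (-1) _ _ sg sf.
rewrite mulN1r addrC => <-; congr (v _).
by apply/funext => q; rewrite mulN1r addrC.
Qed.

(** A non-smooth [f] is sent to 0 by every tangent vector, so [X f] is then the zero function.
    Brackets and frame expansions can thus be computed without case distinctions. *)
Lemma vfield_smooth X f : vfield A X -> smooth_fun A (fun q => X q f).
Proof.
move=> [tX sX]; have [/sX//|nsf] := pselect (smooth_fun A f).
rewrite (_ : (fun q => _) = cst 0); first exact: smooth_cst.
by apply/funext => q; case: (tX q) => _ _; apply.
Qed.

Lemma vfield_scale_add (c : R) X Y : vfield A X -> vfield A Y ->
  vfield A (c *: X + Y).
Proof.
move=> vX vY; split => [p|f sf].
  by apply: tangent_scale_add; [case: vX|case: vY].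
apply: (smoothD atlasA (f := fun q => c * X q f)); last exact: vfield_smooth.
apply: (smoothM atlasA); first exact: smooth_cst.
exact: vfield_smooth.
Qed.

Lemma vfield0 : vfield A 0.
Proof. by split => [p|f _]; [exact: tangent0|exact: smooth_cst]. Qed.

Lemma vfield_comb (I : Type) (r : seq I) (c : I -> M -> R) (X : I -> prefield R M) :
  (forall i, smooth_fun A (c i)) -> (forall i, vfield A (X i)) ->
  vfield A (fun p => \sum_(i <- r) c i p *: X i p).
Proof.
move=> sc vX; split => [p|f _].
  by apply: tangent_comb => i; case: (vX i).
rewrite (_ : (fun p => _) = fun p => \sum_(i <- r) c i p * X i p f).
  by apply: smooth_sum => // i _; apply: smoothM => //; exact: vfield_smooth.
by apply/funext => p; rewrite fct_sumE.
Qed.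

Lemma vfield_bracket X Y : vfield A X -> vfield A Y -> vfield A (bracket X Y).
Proof.
move=> vX vY; have tX p : tangent A p (X p) by case: vX.
have tY p : tangent A p (Y p) by case: vY.
have sX f := vfield_smooth f vX; have sY f := vfield_smooth f vY.
split => [p|f _]; last first.
  have sXY := vfield_smooth (fun q => Y q f) vX.
  have sYX := vfield_smooth (fun q => X q f) vY.
  apply/(smooth_funP atlasA) => p.
  have := smoothD atlasA sXY (smoothM atlasA (smooth_cst atlasA (-1)) sYX).
  rewrite (_ : (fun q => _) = fun q => bracket X Y q f).
    by move=> /(smooth_funP atlasA); apply.
  by apply/funext => q; rewrite /cst /= mulN1r.
split=> [b f g sf sg|f g sf sg|f nsf]; rewrite /bracket.
- rewrite -[LHS]/(X p (fun q => Y q (fun x => b * f x + g x)) - Y p (fun q => X q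
  (fun x => b * f x + g x))).
  have lin Z' : (forall q, tangent A q (Z' q)) ->
      (fun q => Z' q (fun x => b * f x + g x)) = (fun q => b * Z' q f + Z' q g).
    by move=> tZ; apply/funext => q; case: (tZ q) => + _ _; apply.
  rewrite (lin _ tX) (lin _ tY).
  have [linX _ _] := tX p; have [linY _ _] := tY p.
  rewrite linX// linY//.
  rewrite -[RHS]/(b * (X p (fun q => Y q f) - Y p (fun q => X q f)) +
     (X p (fun q => Y q g) - Y p (fun q => X q g))).
  ring.
- rewrite -[LHS]/(X p (fun q => Y q (fun x => f x * g x)) - Y p (fun q => X q
  (fun x => f x * g x))).
  have lei Z' : (forall q, tangent A q (Z' q)) ->
      (fun q => Z' q (fun x => f x * g x)) = (fun q => f q * Z' q g + g q * Z' q f).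
    by move=> tZ; apply/funext => q; exact: (tangentM (tZ q)).
  rewrite (lei _ tX) (lei _ tY).
  have sM u w : smooth_fun A u -> smooth_fun A w -> smooth_fun A (fun q => u q * w q).
    exact: smoothM.
  rewrite (tangentD (tX p) (sM _ _ sf (sY g)) (sM _ _ sg (sY f))).
  rewrite (tangentD (tY p) (sM _ _ sf (sX g)) (sM _ _ sg (sX f))).
  rewrite !(tangentM (tX p))// !(tangentM (tY p))//.
  rewrite -[RHS]/(f p * (X p (fun q => Y q g) - Y p (fun q => X q g)) +
     g p * (X p (fun q => Y q f) - Y p (fun q => X q f))).
  ring.
- rewrite -[LHS]/(X p (fun q => Y q f) - Y p (fun q => X q f)).
  have z Z' : (forall q, tangent A q (Z' q)) -> (fun q => Z' q f) = cst 0.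
    by move=> tZ; apply/funext => q; case: (tZ q) => _ _; apply.
  by rewrite (z _ tX) (z _ tY) (tangent_cst atlasA 0 (tX p)) (tangent_cst atlasA
    0 (tY p)) subr0.
Qed.

Lemma bracketC X Y : bracket X Y = - bracket Y X.
Proof. by apply/funext => p; apply/funext => f; rewrite /bracket opprB. Qed.

Lemma bracketDl (c : R) X X' Y : vfield A X -> vfield A X' -> vfield A Y ->
  bracket (c *: X + X') Y = c *: bracket X Y + bracket X' Y.
Proof.
move=> vX vX' vY; apply/funext => p; apply/funext => f.
have [linY _ _] : tangent A p (Y p) by case: vY.
have sX := vfield_smooth f vX; have sX' := vfield_smooth f vX'.
rewrite -[LHS]/(c * X p (fun q => Y q f) + X' p (fun q => Y q f) -
   Y p (fun q => c * X q f + X' q f)) linY//.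
rewrite -[RHS]/(c * (X p (fun q => Y q f) - Y p (fun q => X q f)) +
  (X' p (fun q => Y q f) - Y p (fun q => X' q f))).
ring.
Qed.

Lemma bracketDr (c : R) X Y Y' : vfield A X -> vfield A Y -> vfield A Y' ->
  bracket X (c *: Y + Y') = c *: bracket X Y + bracket X Y'.
Proof.
move=> vX vY vY'; rewrite bracketC bracketDl// [in RHS]bracketC [bracket X Y']bracketC.
by rewrite opprD scalerN.
Qed.

Lemma bracket_jacobi X Y Z : vfield A X -> vfield A Y -> vfield A Z ->
  bracket X (bracket Y Z) = bracket (bracket X Y) Z + bracket Y (bracket X Z).
Proof.
move=> vX vY vZ; apply/funext => p; apply/funext => f.
have tX : tangent A p (X p) by case: vX.
have tY : tangent A p (Y p) by case: vY.
have tZ : tangent A p (Z p) by case: vZ.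
have sX g := vfield_smooth g vX; have sY g := vfield_smooth g vY.
have sZ g := vfield_smooth g vZ.
rewrite -[LHS]/(X p (fun q => Y q (fun r => Z r f) - Z q (fun r => Y r f)) -
  (Y p (fun q => Z q (fun r => X r f)) - Z p (fun q => Y q (fun r => X r f)))).
rewrite -[RHS]/((X p (fun q => Y q (fun r => Z r f)) - Y p (fun q => X q (fun r
  => Z r f))) -
   Z p (fun q => X q (fun r => Y r f) - Y q (fun r => X r f)) +
   (Y p (fun q => X q (fun r => Z r f) - Z q (fun r => X r f)) -
   (X p (fun q => Z q (fun r => Y r f)) - Z p (fun q => X q (fun r => Y r f))))).
rewrite (tangentB tX)// (tangentB tY)// (tangentB tZ)//.
ring.
Qed.

Lemma bracket0l X : vfield A X -> bracket 0 X = 0.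
Proof.
move=> vX; apply/funext => p; apply/funext => f.
have tX : tangent A p (X p) by case: vX.
rewrite -[LHS]/(0 - X p (cst 0)) (tangent_cst atlasA 0 tX) subr0.
by [].
Qed.

End VectorFields.

(** * Left-invariant fields and changes of frame *)

Section LeftFrames.
Context {R : realType} {G : groupTopologicalType} {n : nat}.
Variable A : set (chart R G n).
Hypothesis lieA : is_lie_group A.
Let atlasA := lie_atlas lieA.

Lemma lie_bracket X Y : lie_algebra A X -> lie_algebra A Y ->
  lie_algebra A (bracket X Y).
Proof.
move=> [vX lX] [vY lY]; split; first exact: vfield_bracket.
move=> a h; apply/funext => f; rewrite /dleft /bracket.
rewrite -[LHS]/(X (a * h)%g (fun q => Y q f) - Y (a * h)%g (fun q => X q f)).
rewrite lX lY /dleft; congr (X h _ - Y h _).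
  by apply/funext => x; rewrite lY.
by apply/funext => x; rewrite lX.
Qed.

Lemma lie_scale_add (c : R) X Y : lie_algebra A X -> lie_algebra A Y ->
  lie_algebra A (c *: X + Y).
Proof.
move=> [vX lX] [vY lY]; split; first exact: vfield_scale_add.
by move=> a h; rewrite -[LHS]/(c *: X (a * h)%g + Y (a * h)%g) lX lY.
Qed.

Lemma lie0 : lie_algebra A 0.
Proof. by split => //; exact: vfield0. Qed.

Lemma lie_comb (I : Type) (r : seq I) (c : I -> R) (X : I -> prefield R G) :
  (forall i, lie_algebra A (X i)) -> lie_algebra A (\sum_(i <- r) c i *: X i).
Proof.
move=> lX; elim: r => [|i r IH]; first by rewrite big_nil; exact: lie0.
by rewrite big_cons; exact: lie_scale_add.
Qed.

Variables (E : 'I_n -> prefield R G) (co : 'I_n -> G -> functional R G -> R).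
Hypothesis frameE : left_frame A E co.

Lemma frame_lie i : lie_algebra A (E i).
Proof. by case: frameE => + _ _ _ _; apply. Qed.

Lemma frame_vfield i : vfield A (E i).
Proof. by case: (frame_lie i). Qed.

Lemma frame_coD i g (c : R) u v : co i g (c *: u + v) = c * co i g u + co i g v.
Proof. by case: frameE => _ _ + _ _; apply. Qed.

Lemma frame_co0 i g : co i g 0 = 0.
Proof.
have := frame_coD i g 1 0 0; rewrite scaler0 addr0 mul1r => /eqP.
by rewrite -subr_eq subrr eq_sym => /eqP.
Qed.

Lemma frame_coE i j g : co i g (E j g) = (i == j)%:R.
Proof. by case: frameE => _ + _ _ _; apply. Qed.

Lemma frame_tangent g v : tangent A g v -> v = \sum_i co i g v *: E i g.
Proof. by case: frameE => _ _ _ + _; apply. Qed.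

Lemma frame_co_smooth X i : vfield A X -> smooth_fun A (fun g => co i g (X g)).
Proof. by case: frameE => _ _ _ _ [+ _]; apply. Qed.

Lemma frame_co_left i a g v : co i (a * g)%g (dleft a v) = co i g v.
Proof. by case: frameE => _ _ _ _ [_ +]; apply. Qed.

Lemma frame_co_comb k g (c : 'I_n -> R) : co k g (\sum_i c i *: E i g) = c k.
Proof.
have coS (s : seq 'I_n) :
    co k g (\sum_(i <- s) c i *: E i g) = \sum_(i <- s) c i * (k == i)%:R.
  elim: s => [|i s IH]; first by rewrite !big_nil frame_co0.
  by rewrite !big_cons frame_coD frame_coE IH.
rewrite coS (bigD1 k)//= eqxx mulr1 big1 ?addr0// => i ik.
by rewrite eq_sym (negbTE ik) mulr0.
Qed.

Lemma lie_frame_coords X : lie_algebra A X ->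
  X = \sum_i co i 1%g (X 1%g) *: E i.
Proof.
move=> [vX lX]; apply/funext => g; rewrite fct_sumE.
have tX : tangent A g (X g) by case: vX.
rewrite {1}(frame_tangent tX); apply: eq_bigr => i _; congr (_ *: _).
by rewrite -{1}(mulg1 g) -{1}[in X g](mulg1 g) lX frame_co_left.
Qed.

(** The rows of [P] are the new frame vectors, so coordinate rows are multiplied on the right by the
    inverse of [P]. *)
Lemma frame_change (P : 'M[R]_n) : P \in unitmx ->
  exists co', left_frame A (fun i => \sum_j P i j *: E j) co'.
Proof.
move=> uP; pose Q := invmx P.
exists (fun i g v => \sum_k co k g v * Q k i); split.
- by move=> i; apply: lie_comb => j; exact: frame_lie.
- move=> i j g; rewrite (eq_bigr (fun k => P j k * Q k i)).
    have /matrixP/(_ j i) := mulmxV uP; rewrite !mxE eq_sym => <-.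
    by apply: eq_bigr.
  by move=> k _; rewrite fct_sumE frame_co_comb.
- move=> i g c u v; rewrite mulr_sumr -big_split; apply: eq_bigr => k _ /=.
  by rewrite frame_coD mulrDl mulrA.
- move=> g v tv.
  rewrite {1}(frame_tangent tv).
  have vQ k : co k g v = \sum_i (\sum_l co l g v * Q l i) * P i k.
    pose x : 'rV[R]_n := \row_l co l g v.
    have : (x *m Q *m P) 0 k = x 0 k by rewrite mulmxKV.
    rewrite [RHS]mxE => <-; rewrite mxE; apply: eq_bigr => i _; congr (_ * _).
    by rewrite mxE; apply: eq_bigr => l _; rewrite mxE.
  under eq_bigr do rewrite vQ scaler_suml.
  rewrite exchange_big/=; apply: eq_bigr => i _.
  have -> : (\sum_j P i j *: E j) g = \sum_j P i j *: E j g by rewrite fct_sumE.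
  by rewrite scaler_sumr; apply: eq_bigr => k _; rewrite scalerA.
- split.
    move=> X i vX; apply: (smooth_sum atlasA) => k _.
    apply: (smoothM atlasA); first exact: frame_co_smooth.
    exact: (smooth_cst atlasA).
  by move=> i a g v; apply: eq_bigr => k _; rewrite frame_co_left.
Qed.

End LeftFrames.



(** * The Levi-Civita connection in a left-invariant frame *)

Section FrameConnection.
Context {R : realType} {G : groupTopologicalType} {n : nat}.
Variable A : set (chart R G n).
Hypothesis lieA : is_lie_group A.
Let atlasA := lie_atlas lieA.
Variables (E : 'I_n -> prefield R G) (co : 'I_n -> G -> functional R G -> R).
Hypothesis frameE : left_frame A E co.
Implicit Types (X Y Z : prefield R G) (p q : G) (u v : functional R G)
  (w x y z : 'rV[R]_n).

Definition coords p v : 'rV[R]_n := \row_k co k p v.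
Definition frame_vec p w : functional R G := \sum_k w 0 k *: E k p.

Lemma frame_vecK p w : coords p (frame_vec p w) = w.
Proof. by apply/rowP => k; rewrite mxE (frame_co_comb frameE). Qed.

Lemma coordsK p v : tangent A p v -> frame_vec p (coords p v) = v.
Proof.
move=> tv; rewrite [RHS](frame_tangent frameE tv).
by apply: eq_bigr => k _; rewrite mxE.
Qed.

Lemma frame_vecD p (c : R) w w' : frame_vec p (c *: w + w') = c *: frame_vec p w
  + frame_vec p w'.
Proof.
rewrite /frame_vec scaler_sumr -big_split; apply: eq_bigr => k _ /=.
by rewrite !mxE scalerDl scalerA.
Qed.

Lemma frame_vec0 p : frame_vec p 0 = 0.
Proof. by rewrite /frame_vec big1// => k _; rewrite mxE scale0r. Qed.

Lemma frame_vecB p w w' : frame_vec p (w - w') = frame_vec p w - frame_vec p w'.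
Proof. by rewrite addrC -scaleN1r frame_vecD scaleN1r addrC. Qed.

Lemma frame_vec_sum p (I : Type) (r : seq I) (c : I -> R) (w : I -> 'rV[R]_n) :
  frame_vec p (\sum_(i <- r) c i *: w i) = \sum_(i <- r) c i *: frame_vec p (w i).
Proof.
elim: r => [|i r IH]; first by rewrite !big_nil frame_vec0.
by rewrite !big_cons frame_vecD IH.
Qed.

Lemma coordsD p (c : R) u v : coords p (c *: u + v) = c *: coords p u + coords p v.
Proof. by apply/rowP => k; rewrite !mxE (frame_coD frameE). Qed.

Lemma coords0 p : coords p 0 = 0.
Proof. by apply/rowP => k; rewrite !mxE (frame_co0 frameE). Qed.

Lemma coords_frame p i : coords p (E i p) = delta_mx 0 i.
Proof. by apply/rowP => k; rewrite !mxE (frame_coE frameE) eqxx. Qed.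

Lemma tangent_frame_vec p w : tangent A p (frame_vec p w).
Proof. by apply: tangent_comb => i; case: (frame_vfield frameE i). Qed.

Definition smooth_vec (z : G -> 'rV[R]_n) := forall k, smooth_fun A (fun q => z q 0 k).

Lemma smooth_coords X : vfield A X -> smooth_vec (fun q => coords q (X q)).
Proof.
move=> vX k; under eq_fun do rewrite mxE; exact: (frame_co_smooth frameE).
Qed.

Lemma vfield_frame_vec (z : G -> 'rV[R]_n) : smooth_vec z ->
  vfield A (fun p => frame_vec p (z p)).
Proof. by move=> sz; apply: vfield_comb => // i; exact: (frame_vfield frameE). Qed.

Definition der v (z : G -> 'rV[R]_n) : 'rV[R]_n := \row_k v (fun q => z q 0 k).

Lemma der_scale_add (c : R) u v (z : G -> 'rV[R]_n) : der (c *: u + v) z = c *: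
  der u z + der v z.
Proof. by apply/rowP => k; rewrite !mxE. Qed.

Lemma smooth_der X (z : G -> 'rV[R]_n) : vfield A X -> smooth_vec z ->
  smooth_vec (fun p => der (X p) z).
Proof.
by move=> vX sz k; under eq_fun do rewrite mxE; exact: vfield_smooth.
Qed.

Lemma smooth_vecD (z z' : G -> 'rV[R]_n) : smooth_vec z -> smooth_vec z' ->
  smooth_vec (fun q => z q + z' q).
Proof. by move=> sz sz' k; under eq_fun do rewrite mxE; exact: smoothD. Qed.

Lemma smooth_vecZ f (z : G -> 'rV[R]_n) : smooth_fun A f -> smooth_vec z ->
  smooth_vec (fun q => f q *: z q).
Proof. by move=> sf sz k; under eq_fun do rewrite mxE; exact: smoothM. Qed.

Lemma derD p v (z z' : G -> 'rV[R]_n) : tangent A p v -> smooth_vec z ->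
  smooth_vec z' -> der v (fun q => z q + z' q) = der v z + der v z'.
Proof.
move=> tv sz sz'; apply/rowP => k; rewrite !mxE -(tangentD tv)//.
by congr (v _); apply/funext => q; rewrite mxE.
Qed.

Lemma derZ p v f (z : G -> 'rV[R]_n) : tangent A p v -> smooth_fun A f ->
  smooth_vec z -> der v (fun q => f q *: z q) = v f *: z p + f p *: der v z.
Proof.
move=> tv sf sz; apply/rowP => k; rewrite !mxE.
rewrite (_ : (fun q => _) = (fun q => f q * z q 0 k)).
  rewrite (tangentM tv)//; ring.
by apply/funext => q; rewrite mxE.
Qed.

(* [Om i j k] is the Christoffel symbol: the [k]-th coordinate of the covariant
   derivative of [E j] along [E i]. *)
Variable Om : 'I_n -> 'M[R]_n.

Definition conn_mx x : 'M[R]_n := \sum_i x 0 i *: Om i.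

Lemma conn_mxD (c : R) x y : conn_mx (c *: x + y) = c *: conn_mx x + conn_mx y.
Proof.
rewrite /conn_mx scaler_sumr -big_split; apply: eq_bigr => k _ /=.
by rewrite !mxE scalerDl scalerA.
Qed.

Lemma mul_conn_mx z y : z *m conn_mx y = \sum_i \sum_j (y 0 i * z 0 j) *: row j (Om i).
Proof.
rewrite /conn_mx mulmx_sumr; apply: eq_bigr => i _.
rewrite -scalemxAr mulmx_sum_row scaler_sumr.
by apply: eq_bigr => j _; rewrite scalerA.
Qed.

Lemma mul_conn_mx_coord z y k :
  (z *m conn_mx y) 0 k = \sum_i \sum_j y 0 i * z 0 j * Om i j k.
Proof.
rewrite mul_conn_mx summxE; apply: eq_bigr => i _; rewrite summxE.
by apply: eq_bigr => j _; rewrite !mxE.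
Qed.

Lemma smooth_mul_conn_mx (z y : G -> 'rV[R]_n) : smooth_vec z -> smooth_vec y ->
  smooth_vec (fun q => z q *m conn_mx (y q)).
Proof.
move=> sz sy k; under eq_fun do rewrite mul_conn_mx_coord.
apply: (smooth_sum atlasA) => i _; apply: (smooth_sum atlasA) => j _.
apply: (smoothM atlasA); last exact: (smooth_cst atlasA).
exact: (smoothM atlasA).
Qed.

Lemma der_mul_conn_mx p v (z y : G -> 'rV[R]_n) : tangent A p v -> smooth_vec z ->
  smooth_vec y -> der v (fun q => z q *m conn_mx (y q)) =
  der v z *m conn_mx (y p) + z p *m conn_mx (der v y).
Proof.
move=> tv sz sy; apply/rowP => k; rewrite [in RHS]mxE !mul_conn_mx_coord [LHS]mxE.
under eq_fun do rewrite mul_conn_mx_coord.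
have sM i j : smooth_fun A (fun q => y q 0 i * z q 0 j) by exact: (smoothM atlasA).
have sMO i j : smooth_fun A (fun q => y q 0 i * z q 0 j * Om i j k).
  by apply: (smoothM atlasA) => //; exact: (smooth_cst atlasA).
rewrite (tangent_sum atlasA _ tv); last by move=> i _; exact: (smooth_sum atlasA).
rewrite -big_split; apply: eq_bigr => i _ /=.
rewrite (tangent_sum atlasA _ tv)// -big_split; apply: eq_bigr => j _ /=.
rewrite (tangentM (f := fun q => y q 0 i * z q 0 j) (g := cst (Om i j k)) tv)//;
  last exact: (smooth_cst atlasA).
rewrite (tangent_cst atlasA _ tv) mulr0 add0r (tangentM tv)// !mxE /cst.
ring.
Qed.

Hypothesis bracketE : forall i j p,
  bracket (E i) (E j) p = frame_vec p (row j (Om i) - row i (Om j)).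

(** [bracketE] is vanishing torsion on the frame. For general fields, differentiating the
    coefficients gives the [der] terms, and the second-order terms combine into brackets of frame
    fields. *)
Lemma bracket_frame_coords X Y p : vfield A X -> vfield A Y ->
  let x q := coords q (X q) in let y q := coords q (Y q) in
  bracket X Y p = frame_vec p (der (X p) y - der (Y p) x +
    (y p *m conn_mx (x p) - x p *m conn_mx (y p))).
Proof.
move=> vX vY x y.
have tX q : tangent A q (X q) by case: vX.
have tY q : tangent A q (Y q) by case: vY.
have sx : smooth_vec x by exact: smooth_coords.
have sy : smooth_vec y by exact: smooth_coords.
have sE j f : smooth_fun A (fun q => E j q f).
  by apply: vfield_smooth => //; exact: (frame_vfield frameE).
have expand (Z : prefield R G) q f : tangent A q (Z q) ->
    Z q f = \sum_j coords q (Z q) 0 j * E j q f.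
  by move=> tZ; rewrite -{1}(coordsK tZ) /frame_vec fct_sumE.
(* Z (W f) splits into the derivative of the coefficients of W and a second-order part, a
   combination of the E i (E j f). *)
have half (Z W : prefield R G) f : vfield A W -> (forall q, tangent A q (Z q)) ->
    Z p (fun q => W q f) = frame_vec p (der (Z p) (fun q => coords q (W q))) f +
    \sum_j \sum_i (coords p (W p) 0 j * coords p (Z p) 0 i) * E i p (fun q => E j q f).
  move=> vW tZ; have tW q : tangent A q (W q) by case: vW.
  have sw := smooth_coords vW.
  have -> : (fun q => W q f) = fun q => \sum_j coords q (W q) 0 j * E j q f.
    by apply/funext => q; exact: expand.
  rewrite (tangent_sum atlasA _ (tZ p)); last by move=> j _; exact: (smoothM atlasA).
  rewrite /frame_vec fct_sumE -big_split; apply: eq_bigr => j _ /=.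
  rewrite (tangentM (tZ p))// (expand Z p (fun q => E j q f))// mulr_sumr addrC.
  congr (_ + _); first by apply: eq_bigr => i _; rewrite mulrA.
  by rewrite -[RHS]/(der _ _ 0 j * E j p f) mxE mulrC.
apply/funext => f.
rewrite -[LHS]/(X p (fun q => Y q f) - Y p (fun q => X q f)).
rewrite !half//.
have -> : frame_vec p (der (X p) y - der (Y p) x + (y p *m conn_mx (x p) - x p *m
  conn_mx (y p))) f =
    frame_vec p (der (X p) y) f - frame_vec p (der (Y p) x) f +
    \sum_j \sum_i (y p 0 j * x p 0 i) * bracket (E i) (E j) p f.
  have -> : frame_vec p (der (X p) y - der (Y p) x + (y p *m conn_mx (x p) - x p
    *m conn_mx (y p))) =
    (frame_vec p (der (X p) y) - frame_vec p (der (Y p) x)) +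
    frame_vec p (y p *m conn_mx (x p) - x p *m conn_mx (y p)).
    by rewrite -frame_vecB -[frame_vec p (_ - der _ _) + _]scale1r scalerDr
      !scale1r -{1}[frame_vec p (_ - der _ _)]scale1r -frame_vecD scale1r.
  rewrite -[LHS]/(frame_vec p (der (X p) y) f - frame_vec p (der (Y p) x) f +
    frame_vec p _ f).
  congr (_ + _).
  have -> : y p *m conn_mx (x p) - x p *m conn_mx (y p) =
      \sum_j \sum_i (y p 0 j * x p 0 i) *: (row j (Om i) - row i (Om j)).
    rewrite !mul_conn_mx.
    under [RHS]eq_bigr do under eq_bigr do rewrite scalerBr.
    under [RHS]eq_bigr do rewrite sumrB.
    rewrite sumrB [in LHS]exchange_big/=; congr (_ - _).
    by apply: eq_bigr => j _; apply: eq_bigr => i _; rewrite mulrC.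
  rewrite -(eq_bigr _ (fun j _ => scale1r _)) frame_vec_sum fct_sumE.
  apply: eq_bigr => j _; rewrite scale1r frame_vec_sum fct_sumE.
  by apply: eq_bigr => i _; rewrite bracketE.
rewrite [X in _ + X - _]exchange_big/=.
rewrite opprD addrACA; congr (_ + _).
rewrite -sumrB [RHS]exchange_big/=; apply: eq_bigr => i _.
rewrite -sumrB; apply: eq_bigr => j _.
rewrite -[bracket _ _ _ _]/(E i p (fun q => E j q f) - E j p (fun q => E i q f)).
by rewrite mulrBr [x p 0 i * _]mulrC.
Qed.

Lemma coords_bracket X Y p : vfield A X -> vfield A Y ->
  coords p (bracket X Y p) =
    der (X p) (fun q => coords q (Y q)) - der (Y p) (fun q => coords q (X q)) +
    (coords p (Y p) *m conn_mx (coords p (X p)) - coords p (X p) *m conn_mx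
      (coords p (Y p))).
Proof. by move=> vX vY; rewrite bracket_frame_coords// frame_vecK. Qed.

Definition nabla X Y : prefield R G := fun p =>
  frame_vec p (der (X p) (fun q => coords q (Y q)) + coords p (Y p) *m conn_mx
    (coords p (X p))).

Lemma vfield_nabla X Y : vfield A X -> vfield A Y -> vfield A (nabla X Y).
Proof.
move=> vX vY; have sx := smooth_coords vX; have sy := smooth_coords vY.
apply: vfield_frame_vec; apply: smooth_vecD; first exact: smooth_der.
exact: smooth_mul_conn_mx.
Qed.

Lemma nabla_connection : is_connection A nabla.
Proof.
split; first exact: vfield_nabla.
- move=> f X X' Y sf vX vX' vY; apply/funext => p.
  rewrite /nabla -[RHS]/(f p *: frame_vec p _ + frame_vec p _) -frame_vecD; congr
    (frame_vec p _).
  rewrite -[(vf_scale f X + X') p]/(f p *: X p + X' p) der_scale_add coordsD conn_mxD.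
  by rewrite mulmxDr -scalemxAr scalerDr addrACA.
- move=> a X Y Y' vX vY vY'; apply/funext => p.
  rewrite /nabla -[RHS]/(a *: frame_vec p _ + frame_vec p _) -frame_vecD; congr
    (frame_vec p _).
  have tX : tangent A p (X p) by case: vX.
  have sY := smooth_coords vY; have sY' := smooth_coords vY'.
  have -> : (fun q => coords q ((a *: Y + Y') q)) =
      fun q => cst a q *: coords q (Y q) + coords q (Y' q).
    by apply/funext => q; rewrite -coordsD.
  have sa : smooth_fun A (cst a) by exact: (smooth_cst atlasA).
  rewrite (derD tX)//; last exact: smooth_vecZ.
  rewrite (derZ tX)// (tangent_cst atlasA _ tX) scale0r add0r.
  rewrite -[(a *: Y + Y') p]/(a *: Y p + Y' p) coordsD mulmxDl -scalemxAl.
  by rewrite scalerDr addrACA.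
move=> f X Y sf vX vY; apply/funext => p.
have tX : tangent A p (X p) by case: vX.
have tY : tangent A p (Y p) by case: vY.
have sY := smooth_coords vY.
have cZ q (c : R) v : coords q (c *: v) = c *: coords q v.
  by rewrite -[c *: v]addr0 coordsD coords0 addr0.
rewrite /nabla -[RHS]/(X p f *: Y p + f p *: frame_vec p _).
rewrite -[in X p f *: Y p](coordsK tY).
have combZ (c : R) w : c *: frame_vec p w = frame_vec p (c *: w).
  by rewrite -[c *: w]addr0 frame_vecD frame_vec0 addr0.
rewrite (combZ (f p)) -frame_vecD; congr (frame_vec p _).
have -> : (fun q => coords q (vf_scale f Y q)) = fun q => f q *: coords q (Y q).
  by apply/funext => q; rewrite cZ.
by rewrite (derZ tX)// /vf_scale cZ -scalemxAl scalerDr addrA.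
Qed.

Lemma nabla_torsion X Y : vfield A X -> vfield A Y ->
  nabla X Y - nabla Y X = bracket X Y.
Proof.
move=> vX vY; apply/funext => p; rewrite bracket_frame_coords//.
rewrite -[LHS]/(frame_vec p _ - frame_vec p _) -frame_vecB; congr (frame_vec p _).
by rewrite opprD addrACA.
Qed.

(* In the frame the connection is d + conn_mx acting on row vectors from the
   right; the bracket of constant vectors is eliminated by vanishing torsion. *)
Definition curv_mx x y : 'M[R]_n :=
  conn_mx y *m conn_mx x - conn_mx x *m conn_mx y - conn_mx (y *m conn_mx x - x
    *m conn_mx y).

Lemma conn_mxB x y : conn_mx (x - y) = conn_mx x - conn_mx y.
Proof. by rewrite addrC -scaleN1r conn_mxD scaleN1r addrC. Qed.

(** The second derivatives of [Z] cancel against its derivative along the bracket, and so do all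
    first derivatives; only the tensorial part remains. *)
Lemma nabla_curvature X Y Z p : vfield A X -> vfield A Y -> vfield A Z ->
  curvature nabla X Y Z p =
    frame_vec p (coords p (Z p) *m curv_mx (coords p (X p)) (coords p (Y p))).
Proof.
move=> vX vY vZ.
rewrite /curvature -[LHS]/(nabla X (nabla Y Z) p - nabla Y (nabla X Z) p - nabla
  (bracket X Y) Z p).
have tX q : tangent A q (X q) by case: vX.
have tY q : tangent A q (Y q) by case: vY.
have sX := smooth_coords vX; have sY := smooth_coords vY; have sZ := smooth_coords vZ.
pose z q := coords q (Z q).
have second U V : vfield A U -> vfield A V ->
    nabla U (nabla V Z) p = frame_vec p (der (U p) (fun q => der (V q) z) +
      (der (U p) z *m conn_mx (coords p (V p)) + z p *m conn_mx (der (U p) (fun q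
        => coords q (V q)))) +
      (der (V p) z + z p *m conn_mx (coords p (V p))) *m conn_mx (coords p (U p))).
  move=> vU vV; have tU : tangent A p (U p) by case: vU.
  have sV := smooth_coords vV.
  rewrite /nabla frame_vecK; under eq_fun do rewrite frame_vecK.
  rewrite (derD tU); [|exact: smooth_der|exact: smooth_mul_conn_mx].
  by rewrite (der_mul_conn_mx tU).
rewrite !second// /nabla coords_bracket// -!frame_vecB; congr (frame_vec p _).
have -> : der (bracket X Y p) (fun q => coords q (Z q)) =
    der (X p) (fun q => der (Y q) z) - der (Y p) (fun q => der (X q) z).
  apply/rowP => k; rewrite !mxE.
  rewrite -[LHS]/(X p (fun q => Y q (fun r => coords r (Z r) 0 k)) -
    Y p (fun q => X q (fun r => coords r (Z r) 0 k))).
  by congr (X p _ - Y p _); apply/funext => q; rewrite mxE.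
rewrite -/(z p) /curv_mx.
set x := coords p (X p); set y := coords p (Y p).
set Xy := der (X p) (fun q => coords q (Y q)); set Yx := der (Y p) (fun q =>
  coords q (X q)).
set XYz := der (X p) _; set YXz := der (Y p) _.
set Xz := der (X p) z; set Yz := der (Y p) z.
have -> : conn_mx (Xy - Yx + (y *m conn_mx x - x *m conn_mx y)) =
    conn_mx Xy - conn_mx Yx + conn_mx (y *m conn_mx x - x *m conn_mx y).
  by rewrite -[Xy - Yx]scale1r conn_mxD scale1r conn_mxB.
rewrite !mulmxDl !mulmxBr !mulmxDr !mulmxN !mulmxA.
move: (conn_mx (y *m conn_mx x - x *m conn_mx y)) => W.
set t1 := Xz *m _; set t2 := z p *m conn_mx Xy; set t3 := Yz *m _.
set t4 := z p *m conn_mx y *m conn_mx x; set t5 := z p *m conn_mx Yx.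
set t6 := z p *m conn_mx x *m conn_mx y; set t7 := z p *m W.
apply/rowP => k; rewrite !mxE.
ring.
Qed.

(** * Metrics with constant coefficients in the frame *)

Variable H : 'M[R]_n.
Hypothesis symH : H^T = H.

Definition frame_metric p u v : R := (coords p u *m H *m (coords p v)^T) 0 0.

Lemma frame_metricE p u v :
  frame_metric p u v = \sum_j \sum_i coords p u 0 i * H i j * coords p v 0 j.
Proof.
rewrite /frame_metric mxE; apply: eq_bigr => j _; rewrite !mxE mulr_suml.
by apply: eq_bigr => i _; rewrite !mxE.
Qed.

Lemma frame_metric_sym p u v : frame_metric p u v = frame_metric p v u.
Proof.
rewrite /frame_metric -[RHS]/((_ *m H *m _) 0 0).
have -> : coords p v *m H *m (coords p u)^T = (coords p u *m H *m (coords p v)^T)^T.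
  by rewrite !trmx_mul trmxK symH mulmxA.
by rewrite [RHS]mxE.
Qed.

Lemma frame_metric_left : left_invariant A frame_metric.
Proof.
move=> a h u v tu tv; rewrite /frame_metric.
have cl (w : functional R G) : coords (a * h)%g (dleft a w) = coords h w.
  by apply/rowP => k; rewrite !mxE (frame_co_left frameE).
by rewrite !cl.
Qed.

Lemma frame_metric_smooth X Y : vfield A X -> vfield A Y ->
  smooth_fun A (fun p => frame_metric p (X p) (Y p)).
Proof.
move=> vX vY; under eq_fun do rewrite frame_metricE.
apply: (smooth_sum atlasA) => j _; apply: (smooth_sum atlasA) => i _.
apply: (smoothM atlasA); last exact: smooth_coords.
apply: (smoothM atlasA); first exact: smooth_coords.
exact: (smooth_cst atlasA).
Qed.

(** The rows of [P] are the frame coordinates of an orthonormal basis, the same at every point. *)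
Lemma frame_metric_lorentzian (P : 'M[R]_n) (i0 : 'I_n) :
  P *m H *m P^T = \matrix_(i, j) (if i == j then (if i == i0 then -1 else 1) else 0) ->
  lorentzian_metric A frame_metric.
Proof.
set eta := (X in _ = X) => PHP.
(* [eta] is its own inverse, so [P *m H *m P^T = eta] provides a right inverse of [P]. *)
have uP : P \in unitmx.
  have : eta *m eta = 1%:M.
    apply/matrixP => i j; rewrite !mxE (bigD1 i)//= big1 => [|k ki]; rewrite !mxE.
      rewrite eqxx addr0; case: (eqVneq i j) => [_|_]; last by rewrite mulr0.
      by case: ifP => _; rewrite ?mulrNN ?mulr1.
    by rewrite eq_sym (negbTE ki) mul0r.
  by rewrite -{1}PHP -!mulmxA => /mulmx1_unit[].
split.
- move=> p a u v w _ _ _.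
  by rewrite /frame_metric coordsD !mulmxDl -!scalemxAl !mxE.
- by move=> p u v _ _; exact: frame_metric_sym.
- exact: frame_metric_smooth.
move=> p; exists (fun i => frame_vec p (row i P)); split.
  split=> [i|v tv]; first exact: tangent_frame_vec.
  have combP (c : 'rV[R]_n) : \sum_i c 0 i *: frame_vec p (row i P) = frame_vec p
    (c *m P).
    by rewrite -frame_vec_sum mulmx_sum_row.
  exists (coords p v *m invmx P); split; first by rewrite combP mulmxKV// coordsK.
  by move=> c ->; rewrite combP frame_vecK mulmxK.
exists i0 => i j; rewrite /frame_metric !frame_vecK.
have <- : (P *m H *m P^T) i j = (row i P *m H *m (row j P)^T) 0 0.
  by rewrite -!row_mul !mxE; apply: eq_bigr => k _; rewrite !mxE.
by rewrite PHP mxE.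
Qed.

Hypothesis compatH : forall i, Om i *m H + H *m (Om i)^T = 0.

Lemma conn_mx_compat x : conn_mx x *m H + H *m (conn_mx x)^T = 0.
Proof.
rewrite /conn_mx linear_sum mulmx_suml mulmx_sumr -big_split big1// => i _ /=.
by rewrite linearZ/= -scalemxAl -scalemxAr -scalerDr compatH scaler0.
Qed.

(** Since [H] is constant, only the coordinates are differentiated; the connection terms cancel
    because every [Om i] is skew for [H]. *)
Lemma nabla_metric X Y Z p : vfield A X -> vfield A Y -> vfield A Z ->
  X p (fun q => frame_metric q (Y q) (Z q)) =
  frame_metric p (nabla X Y p) (Z p) + frame_metric p (Y p) (nabla X Z p).
Proof.
move=> vX vY vZ; have tX : tangent A p (X p) by case: vX.
have sY := smooth_coords vY; have sZ := smooth_coords vZ.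
have -> : X p (fun q => frame_metric q (Y q) (Z q)) =
   (der (X p) (fun q => coords q (Y q)) *m H *m (coords p (Z p))^T +
    coords p (Y p) *m H *m (der (X p) (fun q => coords q (Z q)))^T) 0 0.
  have -> : (fun q => frame_metric q (Y q) (Z q)) =
     fun q => \sum_j \sum_i coords q (Y q) 0 i * cst (H i j) q * coords q (Z q) 0 j.
    by apply/funext => q; rewrite frame_metricE.
  have sYH i j : smooth_fun A (fun q => coords q (Y q) 0 i * cst (H i j) q).
    by apply: (smoothM atlasA) => //; exact: (smooth_cst atlasA).
  have sYHZ i j : smooth_fun A (fun q => coords q (Y q) 0 i * cst (H i j) q *
    coords q (Z q) 0 j).
    exact: (smoothM atlasA).
  rewrite (tangent_sum atlasA _ tX); last by move=> j _; exact: (smooth_sum atlasA).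
  rewrite [RHS]mxE ![(_ *m _^T) 0 0]mxE -big_split; apply: eq_bigr => j _ /=.
  rewrite (tangent_sum atlasA _ tX); last by move=> i _; exact: sYHZ.
  rewrite !mxE !mulr_suml -big_split.
  apply: eq_bigr => i _ /=.
  rewrite (tangentM tX (sYH i j) (sZ j)).
  rewrite (tangentM tX (sY i) (smooth_cst atlasA (H i j))).
  rewrite (tangent_cst atlasA _ tX) mulr0 add0r !mxE /cst.
  ring.
rewrite /frame_metric /nabla !frame_vecK.
set y := coords p (Y p); set z := coords p (Z p); set x := coords p (X p).
set dy := der _ _; set dz := der _ _.
have om0 : y *m conn_mx x *m H *m z^T + y *m H *m (z *m conn_mx x)^T = 0.
  rewrite trmx_mul !mulmxA -mulmxDl -[y *m conn_mx x *m H]mulmxA -[y *m H *m _]mulmxA.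
  by rewrite -mulmxDr conn_mx_compat mulmx0 mul0mx.
rewrite !mulmxDl linearD/= mulmxDr.
have E00 (a b : 'M[R]_1) : a 0 0 + b 0 0 = (a + b) 0 0 by rewrite mxE.
by rewrite E00 addrACA om0 addr0.
Qed.

Lemma nabla_levi_civita : levi_civita A frame_metric nabla.
Proof.
split; [exact: nabla_connection|exact: nabla_torsion|].
by move=> X Y Z p vX vY vZ; exact: nabla_metric.
Qed.

Variable lambda : R.
Hypothesis einsteinH : forall y z,
  \sum_i (z *m curv_mx (delta_mx 0 i) y) 0 i = lambda * (y *m H *m z^T) 0 0.

(** The rows [delta_mx 0 i] are the coordinates of the frame vectors, so the left side of
    [einsteinH] is the trace of X |-> R(X, Y) Z computed in the frame. *)
Lemma nabla_einstein :
  is_ricci A nabla (fun p u v => lambda * frame_metric p u v).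
Proof.
move=> Y Z p vY vZ.
exists (fun v => frame_vec p (coords p (Z p) *m curv_mx (coords p v) (coords p (Y p)))).
split; first by move=> X vX; rewrite nabla_curvature.
exists (fun i => E i p).
exists (\matrix_(i, j) (coords p (Z p) *m curv_mx (delta_mx 0 j) (coords p (Y p))) 0 i).
split.
- split=> [i|v tv]; first by case: (frame_vfield frameE i).
  exists (coords p v); split; first by rewrite -[RHS]/(frame_vec p _) coordsK.
  by move=> c ->; rewrite -[X in coords p X]/(frame_vec p c) frame_vecK.
- by move=> j; rewrite coords_frame /frame_vec; apply: eq_bigr => i _; rewrite
  [in RHS]mxE.
- rewrite /frame_metric -einsteinH /mxtrace.
  by apply: eq_bigr => i _; rewrite [in RHS]mxE.
Qed.

Lemma frame_ricci_soliton : ricci_soliton A frame_metric.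
Proof.
exists nabla, (fun p u v => lambda * frame_metric p u v); split.
- exact: nabla_levi_civita.
- exact: nabla_einstein.
exists 0, lambda; split; first exact: vfield0.
move=> Y Z p vY vZ; rewrite /lie_derivative !(bracket0l atlasA)//.
have g0 v : frame_metric p 0 v = 0.
  by rewrite /frame_metric coords0 !mul0mx mxE.
rewrite g0 frame_metric_sym g0 -[(0 : prefield R G) p _]/(0 : R).
by rewrite !subr0 add0r.
Qed.

End FrameConnection.

(** The interface between geometry and algebra. After the frame, the hypotheses are in order:
    vanishing torsion, symmetry of the Gram matrix, its signature, compatibility with the metric,
    and the Einstein equation. *)
Lemma einstein_frame_soliton (R : realType) (G : groupTopologicalType) n
    (A : set (chart R G n)) E co (Om : 'I_n -> 'M[R]_n) (H P : 'M[R]_n)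
    (i0 : 'I_n) (lambda : R) :
  is_lie_group A -> left_frame A E co ->
  (forall i j, bracket (E i) (E j) = \sum_k (Om i j k - Om j i k) *: E k) ->
  H^T = H ->
  P *m H *m P^T = \matrix_(i, j) (if i == j then (if i == i0 then -1 else 1) else 0) ->
  (forall i, Om i *m H + H *m (Om i)^T = 0) ->
  (forall y z : 'rV[R]_n, \sum_i (z *m curv_mx Om (delta_mx 0 i) y) 0 i =
     lambda * (y *m H *m z^T) 0 0) ->
  exists g : G -> functional R G -> functional R G -> R,
    [/\ lorentzian_metric A g, left_invariant A g & ricci_soliton A g].
Proof.
move=> lieA fE brE symH PHP compH ein.
exists (frame_metric co H); split.
- exact: (frame_metric_lorentzian lieA fE symH PHP).
- exact: (frame_metric_left fE).
apply: (frame_ricci_soliton lieA fE _ symH compH ein) => i j p.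
rewrite brE fct_sumE; apply: eq_bigr => k _.
by rewrite !mxE.
Qed.



(** * Three-dimensional solvable Lie algebras *)

Definition o0 : 'I_3 := @Ordinal 3 0 isT.
Definition o1 : 'I_3 := @Ordinal 3 1 isT.
Definition o2 : 'I_3 := @Ordinal 3 2 isT.

Lemma ord3P (Q : 'I_3 -> Prop) : Q o0 -> Q o1 -> Q o2 -> forall i, Q i.
Proof.
by move=> Q0 Q1 Q2 [[|[|[|//]]] Hi]; [move: Q0|move: Q1|move: Q2];
  congr Q; apply: val_inj.
Qed.

Lemma sum3 (V : nmodType) (F : 'I_3 -> V) : \sum_i F i = F o0 + F o1 + F o2.
Proof.
rewrite !big_ord_recl big_ord0 addr0 addrA.
by congr (F _ + F _ + F _); apply: val_inj.
Qed.

(** * Rows and matrices of order three with explicit entries *)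

Section Matrix3.
Context {R : realType}.

Definition rv3 (a b c : R) : 'rV[R]_3 := \row_k nth 0 [:: a; b; c] k.

Definition mx3 (a b c d e f g h i : R) : 'M[R]_3 :=
  \matrix_(r, s) nth 0 (nth [::] [:: [:: a; b; c]; [:: d; e; f]; [:: g; h; i]] r) s.

Lemma rv3P (x : 'rV[R]_3) : x = rv3 (x 0 o0) (x 0 o1) (x 0 o2).
Proof. by apply/rowP; apply: ord3P; rewrite mxE. Qed.

Lemma eq_rv3 (x y : 'rV[R]_3) : x 0 o0 = y 0 o0 -> x 0 o1 = y 0 o1 ->
  x 0 o2 = y 0 o2 -> x = y.
Proof. by move=> e0 e1 e2; apply/rowP; exact: ord3P. Qed.

Lemma rv3_add a b c a' b' c' :
  rv3 a b c + rv3 a' b' c' = rv3 (a + a') (b + b') (c + c').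
Proof. by apply: eq_rv3; rewrite !mxE. Qed.

Lemma rv3_opp a b c : - rv3 a b c = rv3 (- a) (- b) (- c).
Proof. by apply: eq_rv3; rewrite !mxE. Qed.

Lemma rv3_scale t a b c : t *: rv3 a b c = rv3 (t * a) (t * b) (t * c).
Proof. by apply: eq_rv3; rewrite !mxE. Qed.

Lemma rv3_mul x y z a b c d e f g h i :
  rv3 x y z *m mx3 a b c d e f g h i =
  rv3 (x * a + y * d + z * g) (x * b + y * e + z * h) (x * c + y * f + z * i).
Proof. by apply: eq_rv3; rewrite !mxE sum3 !mxE. Qed.

Lemma mx3_row0 a b c d e f g h i : row o0 (mx3 a b c d e f g h i) = rv3 a b c.
Proof. by apply: eq_rv3; rewrite !mxE. Qed.
Lemma mx3_row1 a b c d e f g h i : row o1 (mx3 a b c d e f g h i) = rv3 d e f.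
Proof. by apply: eq_rv3; rewrite !mxE. Qed.
Lemma mx3_row2 a b c d e f g h i : row o2 (mx3 a b c d e f g h i) = rv3 g h i.
Proof. by apply: eq_rv3; rewrite !mxE. Qed.

Lemma eq_row3 (X Y : 'M[R]_3) : row o0 X = row o0 Y -> row o1 X = row o1 Y ->
  row o2 X = row o2 Y -> X = Y.
Proof. by move=> e0 e1 e2; apply/row_matrixP; exact: ord3P. Qed.

Lemma mx3_mul a b c d e f g h i a' b' c' d' e' f' g' h' i' :
  mx3 a b c d e f g h i *m mx3 a' b' c' d' e' f' g' h' i' =
  mx3 (a * a' + b * d' + c * g') (a * b' + b * e' + c * h') (a * c' + b * f' + c * i')
      (d * a' + e * d' + f * g') (d * b' + e * e' + f * h') (d * c' + e * f' + f * i')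
      (g * a' + h * d' + i * g') (g * b' + h * e' + i * h') (g * c' + h * f' + i * i').
Proof.
by apply: eq_row3; rewrite row_mul ?mx3_row0 ?mx3_row1 ?mx3_row2 rv3_mul.
Qed.

Lemma mx3_add a b c d e f g h i a' b' c' d' e' f' g' h' i' :
  mx3 a b c d e f g h i + mx3 a' b' c' d' e' f' g' h' i' =
  mx3 (a + a') (b + b') (c + c') (d + d') (e + e') (f + f') (g + g') (h + h') (i + i').
Proof.
by apply: eq_row3; rewrite linearD/= ?mx3_row0 ?mx3_row1 ?mx3_row2 rv3_add.
Qed.

Lemma mx3_opp a b c d e f g h i : - mx3 a b c d e f g h i =
  mx3 (- a) (- b) (- c) (- d) (- e) (- f) (- g) (- h) (- i).
Proof.
by apply: eq_row3; rewrite linearN/= ?mx3_row0 ?mx3_row1 ?mx3_row2 rv3_opp.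
Qed.

Lemma mx3_scale t a b c d e f g h i : t *: mx3 a b c d e f g h i =
  mx3 (t * a) (t * b) (t * c) (t * d) (t * e) (t * f) (t * g) (t * h) (t * i).
Proof.
by apply: eq_row3; rewrite linearZ/= ?mx3_row0 ?mx3_row1 ?mx3_row2 rv3_scale.
Qed.

Lemma mx3_tr a b c d e f g h i :
  (mx3 a b c d e f g h i)^T = mx3 a d g b e h c f i.
Proof. by apply: eq_row3; apply: eq_rv3; rewrite !mxE. Qed.

Lemma mx3_0 : 0 = mx3 0 0 0 0 0 0 0 0 0 :> 'M[R]_3.
Proof. by apply: eq_row3; apply: eq_rv3; rewrite !mxE. Qed.

Lemma mx3_1 : 1%:M = mx3 1 0 0 0 1 0 0 0 1 :> 'M[R]_3.
Proof. by apply: eq_row3; apply: eq_rv3; rewrite !mxE. Qed.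

Lemma delta3_0 : delta_mx 0 o0 = rv3 1 0 0.
Proof. by apply: eq_rv3; rewrite !mxE. Qed.
Lemma delta3_1 : delta_mx 0 o1 = rv3 0 1 0.
Proof. by apply: eq_rv3; rewrite !mxE. Qed.
Lemma delta3_2 : delta_mx 0 o2 = rv3 0 0 1.
Proof. by apply: eq_rv3; rewrite !mxE. Qed.

Lemma rv3_0 a b c : rv3 a b c 0 o0 = a. Proof. by rewrite mxE. Qed.
Lemma rv3_1 a b c : rv3 a b c 0 o1 = b. Proof. by rewrite mxE. Qed.
Lemma rv3_2 a b c : rv3 a b c 0 o2 = c. Proof. by rewrite mxE. Qed.

End Matrix3.

(** * Structure constants and their normal forms *)

Section StructureConstants.
Context {R : realType} {G : groupTopologicalType}.
Variable A : set (chart R G 3).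
Hypothesis lieA : is_lie_group A.
Let atlasA := lie_atlas lieA.
Implicit Types (E : 'I_3 -> prefield R G) (r s : 'rV[R]_3).

Definition lincomb E r : prefield R G := \sum_k r 0 k *: E k.

Definition structure_consts E (c01 c02 c12 : 'rV[R]_3) :=
  [/\ bracket (E o0) (E o1) = lincomb E c01, bracket (E o0) (E o2) = lincomb E c02 &
      bracket (E o1) (E o2) = lincomb E c12].

(* The bracket read in coordinates. *)
Definition bilin (c01 c02 c12 : 'rV[R]_3) r s : 'rV[R]_3 :=
  (r 0 o0 * s 0 o1 - r 0 o1 * s 0 o0) *: c01 +
  (r 0 o0 * s 0 o2 - r 0 o2 * s 0 o0) *: c02 +
  (r 0 o1 * s 0 o2 - r 0 o2 * s 0 o1) *: c12.

Lemma lincombD E (t : R) r s : lincomb E (t *: r + s) = t *: lincomb E r + lincomb E s.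
Proof.
rewrite /lincomb scaler_sumr -big_split; apply: eq_bigr => k _ /=.
by rewrite !mxE scalerDl scalerA.
Qed.

Lemma lincomb0 E : lincomb E 0 = 0.
Proof. by rewrite /lincomb big1// => k _; rewrite mxE scale0r. Qed.

Lemma lincombZ E (t : R) r : lincomb E (t *: r) = t *: lincomb E r.
Proof. by rewrite -[t *: r]addr0 lincombD lincomb0 addr0. Qed.

Lemma lincomb_mul E (P : 'M[R]_3) r :
  lincomb E (r *m P) = lincomb (fun i => \sum_j P i j *: E j) r.
Proof.
have H i : \sum_j P i j *: E j = lincomb E (row i P).
  by apply: eq_bigr => j _; rewrite mxE.
rewrite mulmx_sum_row [RHS]/lincomb; under [RHS]eq_bigr do rewrite H.
by rewrite !sum3 -![_ + _ + _]addrA !lincombD lincombZ.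
Qed.

Lemma bracketXX (X : prefield R G) : bracket X X = 0.
Proof.
by apply/funext => p; apply/funext => f; exact: subrr.
Qed.

Lemma bracket_lincomb E c01 c02 c12 r s : (forall i, vfield A (E i)) ->
  structure_consts E c01 c02 c12 ->
  bracket (lincomb E r) (lincomb E s) = lincomb E (bilin c01 c02 c12 r s).
Proof.
move=> vE [b01 b02 b12].
have v0 := vfield0 atlasA.
have vlc u : vfield A (lincomb E u).
  rewrite /lincomb sum3 -[_ + _ + _]addrA -[u 0 o2 *: _]addr0.
  by do 3 (apply: vfield_scale_add => //).
have br0 X : vfield A X -> bracket X 0 = 0.
  by move=> vX; rewrite bracketC (bracket0l atlasA vX) oppr0.
have half i u : bracket (E i) (lincomb E u) = u 0 o0 *: bracket (E i) (E o0) +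
    u 0 o1 *: bracket (E i) (E o1) + u 0 o2 *: bracket (E i) (E o2).
  rewrite [in LHS]/lincomb sum3 -[_ + _ + _]addrA -[u 0 o2 *: E _]addr0.
  rewrite (bracketDr atlasA)//; last by do 2 (apply: vfield_scale_add => //).
  rewrite (bracketDr atlasA)//; last by apply: vfield_scale_add.
  by rewrite (bracketDr atlasA)// br0// addr0 addrA.
rewrite {1}/lincomb sum3 -[_ + _ + _]addrA -[r 0 o2 *: E _]addr0.
rewrite (bracketDl atlasA)//; last by do 2 (apply: vfield_scale_add => //).
rewrite (bracketDl atlasA)//; last by apply: vfield_scale_add.
rewrite (bracketDl atlasA)// (bracket0l atlasA)// addr0 !half !bracketXX.
rewrite (bracketC (E o1) (E o0)) (bracketC (E o2) (E o0)) (bracketC (E o2) (E o1)).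
rewrite b01 b02 b12 /bilin -[_ + _ + _ *: c12]addrA lincombD lincombD lincombZ
  !scaler0 !add0r ?addr0.
apply/funext => p; apply/funext => f.
set X := lincomb E c01; set Y := lincomb E c02; set Z := lincomb E c12.
transitivity (r 0 o0 * (s 0 o1 * X p f + s 0 o2 * Y p f) +
  (r 0 o1 * (s 0 o0 * (- X p f) + s 0 o2 * Z p f) +
   r 0 o2 * (s 0 o0 * (- Y p f) + s 0 o1 * (- Z p f)))); first by [].
transitivity ((r 0 o0 * s 0 o1 - r 0 o1 * s 0 o0) * X p f +
  ((r 0 o0 * s 0 o2 - r 0 o2 * s 0 o0) * Y p f +
  (r 0 o1 * s 0 o2 - r 0 o2 * s 0 o1) * Z p f)); last by [].
ring.
Qed.

(** A row [d] of coordinates in the new frame reads [d *m P] in the old one; in this form the new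
    structure constants can be checked without inverting [P]. *)
Lemma structure_consts_change E co c01 c02 c12 (P : 'M[R]_3) d01 d02 d12 :
  left_frame A E co -> structure_consts E c01 c02 c12 -> P \in unitmx ->
  bilin c01 c02 c12 (row o0 P) (row o1 P) = d01 *m P ->
  bilin c01 c02 c12 (row o0 P) (row o2 P) = d02 *m P ->
  bilin c01 c02 c12 (row o1 P) (row o2 P) = d12 *m P ->
  exists E' co', left_frame A E' co' /\ structure_consts E' d01 d02 d12.
Proof.
move=> fE sE uP h01 h02 h12.
have [co' fE'] := frame_change lieA fE uP.
exists (fun i => \sum_j P i j *: E j), co'; split => //.
have vE i : vfield A (E i) := frame_vfield fE i.
have H i : \sum_j P i j *: E j = lincomb E (row i P).
  by apply: eq_bigr => j _; rewrite mxE.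
by split; rewrite !H (bracket_lincomb _ _ vE sE) -lincomb_mul ?h01 ?h02 ?h12.
Qed.

Lemma lincomb_inj E co r s : left_frame A E co -> lincomb E r = lincomb E s -> r = s.
Proof.
move=> fE rs; apply/rowP => k.
have H u : co k 1%g (lincomb E u 1%g) = u 0 k.
  by rewrite /lincomb fct_sumE (frame_co_comb fE k 1%g (fun k => u 0 k)).
by rewrite -H rs H.
Qed.

Local Ltac rv3_simpl := rewrite /bilin !(rv3_0, rv3_1, rv3_2, rv3_scale, rv3_opp,
  rv3_add, rv3_mul, mx3_row0, mx3_row1, mx3_row2).

Lemma lincomb_delta E i : lincomb E (delta_mx 0 i) = E i.
Proof.
rewrite /lincomb (bigD1 i)//= mxE !eqxx scale1r big1 ?addr0// => j ji.
by rewrite mxE (negbTE ji) andbF scale0r.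
Qed.

(** In dimension three the Jacobi identity amounts to this single relation, for the three frame
    vectors. *)
Lemma structure_jacobi E co c01 c02 c12 : left_frame A E co ->
  structure_consts E c01 c02 c12 ->
  bilin c01 c02 c12 (delta_mx 0 o0) c12 =
  bilin c01 c02 c12 c01 (delta_mx 0 o2) + bilin c01 c02 c12 (delta_mx 0 o1) c02.
Proof.
move=> fE sE; apply: (lincomb_inj fE).
have vE i : vfield A (E i) := frame_vfield fE i.
rewrite -[_ + _]scale1r scalerDr scale1r -[X in X + _]scale1r lincombD scale1r scale1r.
rewrite -!(bracket_lincomb _ _ vE sE) !lincomb_delta; case: sE => <- <- <-.
by rewrite (bracket_jacobi atlasA).
Qed.

(* If w = [X1, X2] is not 0, some u in span(X1, X2) satisfies [u, w] = w.  All
   derivations of span(u, w) are inner, so X0 can be corrected to X0' commuting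
   with u and w, and span(w, X0') is an abelian ideal. *)
Lemma abelian_ideal E co a b c d x y : left_frame A E co ->
  structure_consts E (rv3 0 a b) (rv3 0 c d) (rv3 0 x y) ->
  exists E' co' a' b' c' d', left_frame A E' co' /\
    structure_consts E' (rv3 0 a' b') (rv3 0 c' d') 0.
Proof.
move=> fE sE.
have := structure_jacobi fE sE; rewrite delta3_0 delta3_1 delta3_2; rv3_simpl.
move=> jac.
have jx := congr1 (fun r : 'rV[R]_3 => r 0 o1) jac.
have jy := congr1 (fun r : 'rV[R]_3 => r 0 o2) jac.
rewrite /= !rv3_1 in jx; rewrite /= !rv3_2 in jy.
have [xy0|xy0] := eqVneq (x ^+ 2 + y ^+ 2) 0.
  have [x0 y0] : x = 0 /\ y = 0.
    have := sqr_ge0 x; have := sqr_ge0 y => y0 x0.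
    by split; apply/eqP; rewrite -sqrf_eq0; apply/eqP; lra.
  exists E, co, a, b, c, d; split => //.
  by move: sE; rewrite x0 y0 (_ : rv3 0 0 0 = 0)//; apply: eq_rv3; rewrite !mxE.
have h1 : y * c = d * x by move: jx; lra.
have h2 : x * b = a * y by move: jy; lra.
have [t sE0] : exists t : R, t = x ^+ 2 + y ^+ 2 by exists (x ^+ 2 + y ^+ 2).
rewrite -sE0 in xy0.
(* [tau] is the trace of ad X0 on span(X1, X2). With w = x X1 + y X2, the Jacobi relations [h1] and
   [h2] say that [X0, w] = tau w. *)
pose tau := a + d.
(* For u = (y X1 - x X2) / t one has [u, w] = w, and [X0, u] is a multiple e w of w. The witness is
   the coefficient of the orthogonal projection onto w, and [r] expresses collinearity. *)
have [e [ex ey]] : exists e : R, e * x = (y * a - x * c) / t /\ e * y = (y * b -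
  x * d) / t.
  exists ((x * (y * a - x * c) + y * (y * b - x * d)) / t ^+ 2).
  have r : x * (y * b - x * d) - y * (y * a - x * c) = 0.
    transitivity (y * (x * b - a * y) - x * (d * x - y * c)); first by ring.
    by rewrite h1 h2 !subrr !mulr0 subrr.
  split; apply: (mulIf (expf_neq0 2 xy0)); rewrite mulrAC divfK ?expf_neq0//.
    rewrite expr2 mulrA divfK// sE0.
    transitivity ((y * a - x * c) * (x ^+ 2 + y ^+ 2) +
       y * (x * (y * b - x * d) - y * (y * a - x * c))); first by ring.
    by rewrite r mulr0 addr0.
  rewrite expr2 mulrA divfK// sE0.
  transitivity ((y * b - x * d) * (x ^+ 2 + y ^+ 2) -
     x * (x * (y * b - x * d) - y * (y * a - x * c))); first by ring.
  by rewrite r mulr0 subr0.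
(* The new frame is u, w and X0' = X0 - tau u + e w, the correction being chosen so that [X0', w] =
   0 and [X0', u] = 0. *)
pose P := mx3 0 (y / t) (- x / t) 0 x y 1 (- tau * y / t + e * x) (tau * x / t + e * y).
have uP : P \in unitmx.
  suff /mulmx1_unit[] : mx3 tau (- e) 1 y (x / t) 0 (- x) (y / t) 0 *m P = 1%:M by [].
  rewrite mx3_mul mx3_1; congr mx3; rewrite sE0 in xy0 *; field => //.
have h0 : 0 = rv3 0 0 0 :> 'rV[R]_3 by apply: eq_rv3; rewrite !mxE.
have [|||E' [co' [fE' sE']]] := structure_consts_change (d01 := rv3 0 1 0) (d02
  := 0) (d12 := 0) fE sE uP.
- by rewrite /P; rv3_simpl; congr rv3; rewrite sE0 in xy0 *; field.
- rewrite /P mul0mx h0; rv3_simpl.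
  have -> : y / t * (tau * x / t + e * y) - - x / t * (- tau * y / t + e * x) = e.
    by rewrite sE0 in xy0 *; field.
  by congr rv3; rewrite ?ex ?ey; field.
- rewrite /P mul0mx h0; rv3_simpl.
  have -> : x * (tau * x / t + e * y) - y * (- tau * y / t + e * x) = tau.
    by rewrite sE0 in xy0 *; field.
  congr rv3; rewrite /tau; move: jx jy; lra.
exists E', co', 1, 0, 0, 0; split => //.
by move: sE'; rewrite {1}h0.
Qed.

(** On the plane ad X0 is a Id + J with J traceless, and (w1, w2) is J u. By Cayley-Hamilton J^2 =
    m^2 + k l, so in the basis u, J u the matrix of J is a companion matrix; the determinant
    condition says that u is not an eigenvector. *)
Lemma companion_change E co (a m k l u1 u2 : R) :
  left_frame A E co ->
  structure_consts E (rv3 0 (a + m) k) (rv3 0 l (a - m)) 0 ->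
  let w1 := m * u1 + l * u2 in let w2 := k * u1 - m * u2 in
  u1 * w2 - u2 * w1 != 0 ->
  exists E' co', left_frame A E' co' /\
    structure_consts E' (rv3 0 a 1) (rv3 0 (m * m + k * l) a) 0.
Proof.
move=> fE sE w1 w2 D0.
pose t := u1 * w2 - u2 * w1.
pose P := mx3 1 0 0 0 u1 u2 0 w1 w2.
have uP : P \in unitmx.
  suff /mulmx1_unit[] : mx3 1 0 0 0 (w2 / t) (- u2 / t) 0 (- w1 / t) (u1 / t) *m
    P = 1%:M by [].
  by rewrite mx3_mul mx3_1; congr mx3; rewrite /t; field.
have h0 : 0 = rv3 0 0 0 :> 'rV[R]_3 by apply: eq_rv3; rewrite !mxE.
apply: (structure_consts_change fE sE uP).
- by rewrite /P h0; rv3_simpl; congr rv3; rewrite /w1 /w2; ring.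
- by rewrite /P h0; rv3_simpl; congr rv3; rewrite /w1 /w2; ring.
- by rewrite /P mul0mx h0; rv3_simpl; congr rv3; rewrite /w1 /w2; ring.
Qed.

(* The new frame is X0, u, J u for a vector u = u1 X1 + u2 X2 that is not an
   eigenvector of the traceless part J of ad X0 (if J <> 0). *)
Lemma companion_form E co a b c d : left_frame A E co ->
  structure_consts E (rv3 0 a b) (rv3 0 c d) 0 ->
  exists E' co' (p q D : R), [/\ left_frame A E' co',
    structure_consts E' (rv3 0 p q) (rv3 0 (- D) p) 0 & q = 1 \/ D = 0].
Proof.
move=> fE; pose t := (a + d) / 2; pose m := (a - d) / 2.
have -> : a = t + m by rewrite /t /m; field.
have -> : d = t - m by rewrite /t /m; field.
move: t m => t m sE.
have fin u1 u2 : u1 * (b * u1 - m * u2) - u2 * (m * u1 + c * u2) != 0 ->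
    exists E' co' (p q D : R), [/\ left_frame A E' co',
      structure_consts E' (rv3 0 p q) (rv3 0 (- D) p) 0 & q = 1 \/ D = 0].
  move=> D0; have [E' [co' [fE' sE']]] := companion_change fE sE D0.
  exists E', co', t, 1, (- (m * m + b * c)); split => //; last by left.
  by rewrite opprK.
(* For u = X1, X2 and X1 + X2 the determinant equals b, -c and, once b = c = 0, -2 m. If all three
   vanish then J = 0. *)
have [b0|b0] := eqVneq b 0; last first.
  by apply: (fin 1 0); rewrite !(mulr0, mul0r, mulr1, mul1r, subr0).
have [c0|c0] := eqVneq c 0; last first.
  by apply: (fin 0 1); rewrite !(mulr0, mul0r, mulr1, mul1r, sub0r, add0r) oppr_eq0.
have [m0|m0] := eqVneq m 0; last first.
  apply: (fin 1 1); rewrite b0 c0 !(mulr0, mul0r, mulr1, mul1r, sub0r, addr0).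
  by rewrite -opprD oppr_eq0 -mulr2n mulrn_eq0.
exists E, co, t, 0, 0; split => //; last by right.
by move: sE; rewrite b0 c0 m0 subr0 addr0 oppr0.
Qed.

(** If the three brackets of frame vectors were independent they would form a frame, and every term
    of the derived series would be the whole algebra. Their dependence gives a nonzero linear form
    [v] that kills all brackets. *)
Lemma lie_algebra_not_perfect E co : left_frame A E co -> solvable_lie_group A ->
  exists v : 'cV[R]_3, v != 0 /\
    forall i j, \sum_k v k 0 * co k 1%g (bracket (E i) (E j) 1%g) = 0.
Proof.
move=> fE [m solv].
have lE i : lie_algebra A (E i) := frame_lie fE i.
pose c i j k := co k 1%g (bracket (E i) (E j) 1%g).
have brE i j : bracket (E i) (E j) = \sum_k c i j k *: E k.
  exact: (lie_frame_coords fE (lie_bracket lieA (lE i) (lE j))).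
(* Row r of [N] holds the bracket of the two other frame vectors, in cyclic order. *)
pose fst3 (r : 'I_3) := if r == o0 then o1 else if r == o1 then o2 else o0.
pose snd3 (r : 'I_3) := if r == o0 then o2 else if r == o1 then o0 else o1.
pose N : 'M[R]_3 := \matrix_(r, k) c (fst3 r) (snd3 r) k.
have [uN|] := boolP (N \in unitmx).
  have [co' fE'] := frame_change lieA fE uN.
  have derE k : lie_algebra A `<=` derived_algebra A k.
    elim: k => [//|k IH] X lX /=.
    exists 3, (fun i => co' i 1%g (X 1%g)), (fun i => \sum_k N i k *: E k); split.
      move=> i; exists (E (fst3 i)), (E (snd3 i)); split; try exact/IH/lE.
      by rewrite brE; apply: eq_bigr => l _; rewrite mxE.
    exact: (lie_frame_coords fE' lX).
  have E0 : E o0 = 0 by exact: solv (derE m _ (lE o0)).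
  have := frame_coE fE o0 o0 1%g.
  rewrite E0 -[(0 : prefield R G) 1%g]/(0 : functional R G) (frame_co0 fE) eqxx => /eqP.
  by rewrite eq_sym oner_eq0.
rewrite unitmxE unitfE negbK -det_tr => /det0P[v v0 vN].
exists v^T; split; first by rewrite -(inj_eq trmx_inj) trmxK trmx0.
have vr i : \sum_k v 0 k * c (fst3 i) (snd3 i) k = 0.
  have := congr1 (fun M : 'rV[R]_3 => M 0 i) vN; rewrite [RHS]mxE [LHS]mxE => H.
  by rewrite -[RHS]H; apply: eq_bigr => k _; rewrite !mxE.
have cC i j k : c i j k = - c j i k.
  have := frame_coD fE k 1%g (-1) (bracket (E j) (E i) 1%g) 0.
  rewrite addr0 (frame_co0 fE) addr0 mulN1r scaleN1r => <-.
  by rewrite /c bracketC.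
have cN i j : \sum_k v 0 k * c i j k = - \sum_k v 0 k * c j i k.
  by rewrite -sumrN; apply: eq_bigr => k _; rewrite cC mulrN.
have cD i : \sum_k v 0 k * c i i k = 0.
  by have := cN i i => /eqP; rewrite -addr_eq0 -mulr2n mulrn_eq0 => /eqP.
have vc i j : \sum_k v 0 k * c i j k = 0.
  move: i j; apply: ord3P; apply: ord3P.
  - exact: cD.
  - exact: (vr o2).
  - by rewrite cN (vr o1) oppr0.
  - by rewrite cN (vr o2) oppr0.
  - exact: cD.
  - exact: (vr o0).
  - exact: (vr o1).
  - by rewrite cN (vr o0) oppr0.
  - exact: cD.
by move=> i j; under eq_bigr do rewrite mxE; exact: vc.
Qed.

(** The frame is adapted to the linear form killing all brackets: E1 and E2 span its kernel and E0
    lies outside it, so no bracket has a component along E0. *)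
Lemma exists_ideal_frame : solvable_lie_group A ->
  exists E co (a b c d x y : R), left_frame A E co /\
    structure_consts E (rv3 0 a b) (rv3 0 c d) (rv3 0 x y).
Proof.
move=> solA; have [E [co fE]] := exists_left_frame lieA.
have [v [v0 vE]] := lie_algebra_not_perfect fE solA.
(* As [v] is a column, its rank decomposition leaves only the first entry of [P *m v], which holds
   the values of the form on the new frame. *)
pose P := invmx (col_ebase v).
have uP : P \in unitmx by rewrite unitmx_inv col_ebase_unit.
have Pv : P *m v = pid_mx (\rank v) *m row_ebase v.
  by rewrite -[in LHS](mulmx_ebase v) /P -!mulmxA mulKmx// col_ebase_unit.
have Pv_eq0 i : i != o0 -> (P *m v) i 0 = 0.
  move=> i0; rewrite Pv mxE big_ord_recl big_ord0 addr0 mxE.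
  rewrite (_ : (i == _ :> nat) = false) ?mul0r//.
  by apply/negbTE; move: i0; rewrite -val_eqE.
have Pv0 : (P *m v) o0 0 != 0.
  apply/negP => /eqP Pv00; move/negP: v0; apply.
  rewrite -(mulKmx uP v) (_ : P *m v = 0) ?mulmx0//.
  apply/colP => i; rewrite [RHS]mxE.
  by have [->//|] := eqVneq i o0; exact: Pv_eq0.
have [co' fE'] := frame_change lieA fE uP.
set E' := (fun i => _) in fE'.
pose phi (X : prefield R G) := \sum_k v k 0 * co k 1%g (X 1%g).
have phiD (t : R) X Y : phi (t *: X + Y) = t * phi X + phi Y.
  rewrite /phi mulr_sumr -big_split; apply: eq_bigr => k _ /=.
  rewrite -[(t *: X + Y) 1%g]/(t *: X 1%g + Y 1%g) (frame_coD fE); ring.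
have phi0 : phi 0 = 0.
  by rewrite /phi big1// => k _; rewrite -[0 1%g]/(0 : functional R G) (frame_co0
    fE) mulr0.
have phi_sum (F : 'I_3 -> prefield R G) (t : 'I_3 -> R) :
    phi (\sum_i t i *: F i) = \sum_i t i * phi (F i).
  by rewrite !sum3 -!addrA -[t o2 *: F o2]addr0 !phiD phi0 addr0.
have phiE j : phi (E j) = v j 0.
  rewrite /phi (bigD1 j)//= (frame_coE fE) eqxx mulr1 big1 ?addr0// => k kj.
  by rewrite (frame_coE fE) (negbTE kj) mulr0.
have phiE' i : phi (E' i) = (P *m v) i 0.
  by rewrite /E' phi_sum mxE; apply: eq_bigr => j _; rewrite phiE.
have vfE i : vfield A (E i) := frame_vfield fE i.
have lE i : lie_algebra A (E i) := frame_lie fE i.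
pose c i j := \row_k co k 1%g (bracket (E i) (E j) 1%g).
have brE i j : bracket (E i) (E j) = lincomb E (c i j).
  rewrite {1}(lie_frame_coords fE (lie_bracket lieA (lE i) (lE j))).
  by apply: eq_bigr => k _; rewrite mxE.
have sE : structure_consts E (c o0 o1) (c o0 o2) (c o1 o2) by split; exact: brE.
have phibr i j : phi (bracket (E' i) (E' j)) = 0.
  have lcE k : E' k = lincomb E (row k P) by apply: eq_bigr => l _; rewrite mxE.
  rewrite !lcE (bracket_lincomb _ _ vfE sE) /bilin -!addrA !lincombD lincombZ
    -!brE !phiD.
  have phiZ (t : R) X : phi (t *: X) = t * phi X.
    by rewrite -[t *: X]addr0 phiD phi0 addr0.
  have phib k l : phi (bracket (E k) (E l)) = 0 by exact: vE.
  by rewrite phiZ !phib !mulr0 !addr0.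
pose d i j k := co' k 1%g (bracket (E' i) (E' j) 1%g).
have lE' i : lie_algebra A (E' i) := frame_lie fE' i.
have brE' i j : bracket (E' i) (E' j) = \sum_k d i j k *: E' k.
  exact: (lie_frame_coords fE' (lie_bracket lieA (lE' i) (lE' j))).
have d0 i j : d i j o0 = 0.
  have := phibr i j; rewrite brE' phi_sum sum3 !phiE' (Pv_eq0 o1)// (Pv_eq0 o2)//.
  by rewrite !mulr0 !addr0 => /eqP; rewrite mulf_eq0 (negbTE Pv0) orbF => /eqP.
have brlc i j : bracket (E' i) (E' j) = lincomb E' (rv3 0 (d i j o1) (d i j o2)).
  by rewrite brE' /lincomb !sum3 rv3_0 rv3_1 rv3_2 d0.
exists E', co', (d o0 o1 o1), (d o0 o1 o2), (d o0 o2 o1), (d o0 o2 o2),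
  (d o1 o2 o1), (d o1 o2 o2); split => //.
Qed.

End StructureConstants.

(** * Einstein metrics *)

Section ConstantCurvature.
Context {R : realType} {G : groupTopologicalType}.
Variable A : set (chart R G 3).
Hypothesis lieA : is_lie_group A.

Lemma conn_mx3 (Om : 'I_3 -> 'M[R]_3) a b c :
  conn_mx Om (rv3 a b c) = a *: Om o0 + b *: Om o1 + c *: Om o2.
Proof. by rewrite /conn_mx sum3 rv3_0 rv3_1 rv3_2. Qed.

Lemma structure_bracket (E : 'I_3 -> prefield R G) (Om : 'I_3 -> 'M[R]_3) c01 c02 c12 :
  structure_consts E c01 c02 c12 ->
  row o1 (Om o0) - row o0 (Om o1) = c01 ->
  row o2 (Om o0) - row o0 (Om o2) = c02 ->
  row o2 (Om o1) - row o1 (Om o2) = c12 ->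
  forall i j, bracket (E i) (E j) = \sum_k (Om i j k - Om j i k) *: E k.
Proof.
move=> [b01 b02 b12] h01 h02 h12.
have pair i j r : bracket (E i) (E j) = lincomb E r -> row j (Om i) - row i (Om
  j) = r ->
    bracket (E i) (E j) = \sum_k (Om i j k - Om j i k) *: E k.
  by move=> -> <-; apply: eq_bigr => k _; rewrite !mxE.
have flip i j : bracket (E i) (E j) = \sum_k (Om i j k - Om j i k) *: E k ->
    bracket (E j) (E i) = \sum_k (Om j i k - Om i j k) *: E k.
  move=> h; rewrite bracketC h; rewrite -sumrN; apply: eq_bigr => k _.
  by rewrite -scaleNr opprB.
have diag i : bracket (E i) (E i) = \sum_k (Om i i k - Om i i k) *: E k.
  by rewrite bracketXX big1// => k _; rewrite subrr scale0r.
apply: ord3P; apply: ord3P; rewrite ?diag//.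
- exact: pair b01 h01.
- exact: pair b02 h02.
- exact/flip/(pair _ _ _ b01 h01).
- exact: pair b12 h12.
- exact/flip/(pair _ _ _ b02 h02).
- exact/flip/(pair _ _ _ b12 h12).
Qed.

Definition om3 (M0 M1 M2 : 'M[R]_3) (i : 'I_3) := nth 0 [:: M0; M1; M2] i.

(* E2 is null and paired with E0, and E1 is a unit vector orthogonal to both. *)
Lemma flat_soliton E co (a q : R) : left_frame A E co ->
  structure_consts E (rv3 0 a q) (rv3 0 0 a) 0 ->
  exists g : G -> functional R G -> functional R G -> R,
    [/\ lorentzian_metric A g, left_invariant A g & ricci_soliton A g].
Proof.
move=> fE sE.
have h0 : 0 = rv3 0 0 0 :> 'rV[R]_3 by apply: eq_rv3; rewrite !mxE.
(* These are the Christoffel symbols that the Koszul formula yields: row j of matrix i is the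
   covariant derivative of E j along E i. The null line of E2 is parallel. *)
pose Om := om3 (mx3 (- a) (- q) 0 0 0 q 0 0 a) (mx3 0 (- a) 0 0 0 a 0 0 0)
  (mx3 0 0 0 0 0 0 0 0 0).
pose H : 'M[R]_3 := mx3 0 0 1 0 1 0 1 0 0.
(* The rows E0 / 2 + E2, E1 and E0 / 2 - E2 have squared norms 1, 1 and -1; hence the index [o2]. *)
pose P : 'M[R]_3 := mx3 2^-1 0 1 0 1 0 2^-1 0 (- 1).
apply: (@einstein_frame_soliton _ _ _ _ _ _ Om H P o2 0 lieA fE).
- apply: (structure_bracket sE); rewrite /Om /om3 /= !(mx3_row0, mx3_row1, mx3_row2)
    rv3_opp rv3_add ?h0; congr rv3; ring.
- by rewrite /H mx3_tr.
- rewrite /H /P mx3_tr !mx3_mul.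
  by apply/matrixP; apply: ord3P; apply: ord3P; rewrite !mxE /=; field.
- by apply: ord3P; rewrite /Om /om3 /= /H mx3_tr !mx3_mul mx3_add mx3_0; congr
  mx3; ring.
move=> y z; rewrite sum3 delta3_0 delta3_1 delta3_2 (rv3P y) (rv3P z) /curv_mx.
move: (y 0 o0) (y 0 o1) (y 0 o2) (z 0 o0) (z 0 o1) (z 0 o2) => y0 y1 y2 z0 z1 z2.
have omE r0 r1 r2 : conn_mx Om (rv3 r0 r1 r2) =
    mx3 (- a * r0) (- q * r0 - a * r1) 0 0 0 (q * r0 + a * r1) 0 0 (a * r0).
  rewrite conn_mx3 /Om /om3 /= !mx3_scale !mx3_add; congr mx3; ring.
rewrite !omE !rv3_mul !rv3_opp !rv3_add !omE !mx3_mul !mx3_opp !mx3_add !rv3_mul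
  rv3_0 rv3_1 rv3_2.
rewrite mul0r; ring.
Qed.

(* The frame is orthogonal with squared norms -D, 1, D: on span(E1, E2) the
   traceless part J of ad E0 satisfies J^2 = - D and is skew. *)
Lemma constant_curvature_soliton E co (a D : R) : left_frame A E co ->
  structure_consts E (rv3 0 a 1) (rv3 0 (- D) a) 0 -> D != 0 ->
  exists g : G -> functional R G -> functional R G -> R,
    [/\ lorentzian_metric A g, left_invariant A g & ricci_soliton A g].
Proof.
move=> fE sE D0.
have h0 : 0 = rv3 0 0 0 :> 'rV[R]_3 by apply: eq_rv3; rewrite !mxE.
(* The covariant derivative along E0 is J on the plane and kills E0. Those along E1 and E2 come from
   the part a Id of ad E0. *)
pose Om := om3 (mx3 0 0 0 0 0 1 0 (- D) 0) (mx3 0 (- a) 0 (- a / D) 0 0 0 0 0)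
  (mx3 0 0 (- a) 0 0 0 (- a) 0 0).
(* Skewness of J fixes the form on the plane up to scale, with signature given by the sign of D. The
   value -D for E0 has the opposite sign, so one formula is Lorentzian in both cases. *)
pose H : 'M[R]_3 := mx3 (- D) 0 0 0 1 0 0 0 D.
pose s := (Num.sqrt `|D|)^-1.
pose P : 'M[R]_3 := mx3 s 0 0 0 1 0 0 0 s.
have sD : s * s * `|D| = 1.
  have nD : 0 < `|D| by rewrite normr_gt0.
  rewrite /s -invfM -expr2 sqr_sqrtr ?mulVf ?gt_eqF//; exact: ltW.
(* The negative vector is E0 when D > 0 and E2 when D < 0. The sectional curvature is a^2 / D, and
   in dimension three the Ricci tensor of constant curvature K is 2 K g. *)
apply: (@einstein_frame_soliton _ _ _ _ _ _ Om H P (if 0 < D then o0 else o2)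
  (2 * a ^+ 2 / D) lieA fE).
- apply: (structure_bracket sE); rewrite /Om /om3 /= !(mx3_row0, mx3_row1, mx3_row2)
    rv3_opp rv3_add ?h0; congr rv3; ring.
- by rewrite /H mx3_tr.
- rewrite /H /P mx3_tr !mx3_mul.
  have [Dp|Dn] := ltrP 0 D.
    rewrite gtr0_norm// in sD.
    apply/matrixP; apply: ord3P; apply: ord3P; rewrite !mxE /=; lra.
  rewrite ler0_norm// in sD.
  apply/matrixP; apply: ord3P; apply: ord3P; rewrite !mxE /=; lra.
- by apply: ord3P; rewrite /Om /om3 /= /H mx3_tr !mx3_mul mx3_add mx3_0; congr
  mx3; field.
move=> y z; rewrite sum3 delta3_0 delta3_1 delta3_2 (rv3P y) (rv3P z) /curv_mx.
move: (y 0 o0) (y 0 o1) (y 0 o2) (z 0 o0) (z 0 o1) (z 0 o2) => y0 y1 y2 z0 z1 z2.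
have omE r0 r1 r2 : conn_mx Om (rv3 r0 r1 r2) =
    mx3 0 (- a * r1) (- a * r2) (- a / D * r1) 0 r0 (- a * r2) (- D * r0) 0.
  rewrite conn_mx3 /Om /om3 /= !mx3_scale !mx3_add; congr mx3; ring.
rewrite !omE !rv3_mul !rv3_opp !rv3_add !omE !mx3_mul !mx3_opp !mx3_add !rv3_mul
  rv3_0 rv3_1 rv3_2.
rewrite [in RHS]mxE sum3 !mxE /=.
by field.
Qed.

End ConstantCurvature.

Theorem mainTheorem4 (R : realType) (G : groupTopologicalType)
    (A : set (chart R G 3)) :
  is_lie_group A ->
  connected [set: G] ->
  simply_connected R G ->
  solvable_lie_group A ->
  exists g : G -> functional R G -> functional R G -> R,
    [/\ lorentzian_metric A g, left_invariant A g & ricci_soliton A g].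
Proof.
move=> lieA _ _ solA.
have [E [co [a [b [c [d [x [y [fE sE]]]]]]]]] := exists_ideal_frame lieA solA.
have {fE sE}[E1 [co1 [a1 [b1 [c1 [d1 [fE sE]]]]]]] := abelian_ideal lieA fE sE.
have {fE sE}[E2 [co2 [p [q [D [fE sE qD]]]]]] := companion_form lieA fE sE.
(* D = 0 means that J is nilpotent, possibly zero, which is why [flat_soliton] accepts any [q]. *)
have [D0|D0] := eqVneq D 0.
  by apply: (flat_soliton lieA fE (q := q) (a := p)); rewrite D0 oppr0 in sE.
case: qD => [q1|/eqP]; last by rewrite (negbTE D0).
by rewrite q1 in sE; exact: constant_curvature_soliton fE sE D0.
Qed.
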